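(* Let $\theta>0$ and $\nu>0$. Let $p_k=\theta/(\theta+k-1)$, $k\ge 1$, be the success probabilities and let the number of trials $N$ have the negative binomial distribution ${\rm NB}(\nu,q)$, $0<q<1$. For $k\ge 1$ let $\alpha_k\in(0,1)$ be the unique root in $(0,1)$ of the equation $W_0(x,k)=W_1(x,k)$, and put $\alpha^*:=1-e^{-1/\theta}$. Then: (1) if $\nu>\theta$, then $\alpha_k\uparrow\alpha^*$ (the sequence $(\alpha_k)_{k\ge1}$ is nondecreasing with limit $\alpha^*$); (2) if $\nu<\theta$, then $\alpha_k\downarrow\alpha^*$ (the sequence $(\alpha_k)_{k\ge1}$ is nonincreasing with limit $\alpha^*$); (3) if $\nu=\theta$, then $\alpha_k=\alpha^*$ for all $k\ge1$. Moreover, if $\nu\ge\theta$ then the myopic strategy $\tau^*$ is optimal for every $q\in(0,1)$; and if $0<\nu<\theta$ then it is not the case that $\tau^*$ is optimal for every $q\in(0,1)$.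
   Context: Notation: $(x)_n=x(x+1)\cdots(x+n-1)$, $(x)_0=1$. The distribution ${\rm NB}(\nu,q)$ is $\pi_n=\frac{(\nu)_n}{n!}(1-q)^\nu q^n$, $n\ge0$. Model. Let $N,U_1,U_2,\dots$ be independent with $\mathbb P(N=n)=\pi_n$ and $U_i$ uniform on $[0,1]$. Let $N_t=\sum_{i=1}^{N}1_{\{U_i\le t\}}$, $t\in[0,1]$, and let $T_1<\dots<T_N$ be the ordered values of $U_1,\dots,U_N$ (the epochs of the trials). The trial at epoch $T_k$ is a success with probability $p_k$, independently of everything else. $\mathcal F_t$ is the $\sigma$-algebra generated by the epochs and outcomes of the trials on $[0,t]$. A stopping strategy is a random variable $\tau$ with values in $\{T_1,\dots,T_N,1\}$ with $\{\tau\le t\}\in\mathcal F_t$ for all $t\in[0,1]$; $\tau=1$ means not stopping. The strategy wins if $\tau=T_k$ for some $k$, the $k$th trial is a success and no later trial is a success. A strategy is optimal if it maximises the probability of winning over all stopping strategies. Let $\mathcal S_0(t,k)$ and $\mathcal S_1(t,k)$ be the conditional probabilities, given $N_t=k$, that there are respectively zero and exactly one successes among the trials with indices $k+1,\dots,N$. Explicitly, given $N_t=k$ the number $N-N_t$ of remaining trials has distribution ${\rm NB}(\nu+k,x)$ with $x=q(1-t)$, so $\mathcal S_i(t,k)$ depends on $(q,t)$ only through $x$; write $W_i(x,k)=\mathcal S_i(1-x/q,k)$, $i=0,1$, that is, for $k\ge1$ and $x\in[0,1)$, $$W_i(x,k)=(1-x)^{k+\nu}\sum_{j=0}^\infty\frac{(k+\nu)_j}{j!}x^j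 s_i(k+1,k+j),$$ $$s_0(k+1,n)=\prod_{j=k+1}^n(1-p_j),\qquad s_1(k+1,n)=s_0(k+1,n)\sum_{j=k+1}^n\frac{p_j}{1-p_j}$$ (with $s_0(k+1,k)=1$, $s_1(k+1,k)=0$). The myopic strategy $\tau^*$ stops at the first success epoch $T_k$ (with index $k\ge1$) such that $\mathcal S_0(T_k,k)\ge \mathcal S_1(T_k,k)$, and $\tau^*=1$ if there is none; equivalently it stops at the first success $T_k$ with $T_k\ge a_k=(1-\alpha_k/q)_+$. *)

(* Defs.v *)
From HB Require Import structures.
From mathcomp Require Import all_boot all_order all_algebra.
From mathcomp Require Import all_classical all_reals all_analysis.
Set Implicit Arguments.
Unset Strict Implicit.
Unset Printing Implicit Defensive.
Import Order.TTheory GRing.Theory Num.Theory.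
Import numFieldNormedType.Exports.
Local Open Scope classical_set_scope.
Local Open Scope ring_scope.

Definition pochhammer (R : realType) (x : R) (n : nat) : R :=
  \prod_(i < n) (x + i%:R).

Definition nb_pmf (R : realType) (nu q : R) (n : nat) : R :=
  pochhammer nu n / n`!%:R * (1 - q) `^ nu * q ^+ n.

Definition success_prob (R : realType) (theta : R) (k : nat) : R :=
  theta / (theta + k%:R - 1).

(* Probabilities of zero and of exactly one success among trials m, ..., n. *)
Definition s0 (R : realType) (p : nat -> R) (m n : nat) : R :=
  \prod_(m <= j < n.+1) (1 - p j).

Definition s1 (R : realType) (p : nat -> R) (m n : nat) : R :=
  s0 p m n * \sum_(m <= j < n.+1) (p j / (1 - p j)).

(* Expectation of s (k+1) (k+J) for J with distribution NB(nu + k, x);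
   meant for k >= 1 and 0 <= x < 1. *)
Definition Wfun (R : realType) (nu : R) (s : nat -> nat -> R) (x : R)
    (k : nat) : R :=
  (1 - x) `^ (k%:R + nu) *
  limn (series (fun j => pochhammer (k%:R + nu) j / j`!%:R * x ^+ j
                         * s k.+1 (k + j)%N)).

Definition W0 (R : realType) (p : nat -> R) (nu x : R) (k : nat) : R :=
  Wfun nu (s0 p) x k.

Definition W1 (R : realType) (p : nat -> R) (nu x : R) (k : nat) : R :=
  Wfun nu (s1 p) x k.

Definition W_root (R : realType) (p : nat -> R) (nu : R) (k : nat) (x : R) :
    Prop :=
  0 < x < 1 /\ W0 p nu x k = W1 p nu x k.

(* Trials are numbered from 1: the coordinates U 0 and B 0 are not used.
   U i is the i-th unordered arrival time, whereas B k is the outcome of the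
   k-th trial in chronological order.  Taking some of the sets A, C i, D i to be
   full in the last field gives the product rule for every finite subfamily of
   N, U 1, U 2, ..., B 1, B 2, ... *)
Record trial_model (R : realType) (p : nat -> R) (nu q : R) := TrialModel {
  disp : measure_display ;
  Omega : measurableType disp ;
  Pr : probability Omega R ;
  N : {RV Pr >-> nat} ;
  U : nat -> {RV Pr >-> R} ;
  B : nat -> {RV Pr >-> bool} ;
  N_law : forall n, distribution Pr N [set n] = (nb_pmf nu q n)%:E ;
  U_range : forall i w, (0 < i)%N -> 0 <= U i w <= 1 ;
  U_law : forall i (C : set R), (0 < i)%N -> measurable C ->
    distribution Pr (U i) C = uniform_prob (@ltr01 R) C ;
  B_law : forall k, (0 < k)%N -> distribution Pr (B k) [set true] = (p k)%:E ;
  NUB_indep : forall (n : nat) (A : set nat) (C : nat -> set R)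
      (D : nat -> set bool),
    (forall i, measurable (C i)) ->
    (Pr (N @^-1` A `&`
        \bigcap_(i in [set i | (0 < i <= n)%N])
          (U i @^-1` C i `&` B i @^-1` D i)) =
     Pr (N @^-1` A) *
     \prod_(1 <= i < n.+1) (Pr (U i @^-1` C i) * Pr (B i @^-1` D i)))%E
}.

Arguments disp {R p nu q}.
Arguments Omega {R p nu q}.
Arguments Pr {R p nu q}.
Arguments N {R p nu q}.
Arguments U {R p nu q}.
Arguments B {R p nu q}.

(* N_t *)
Definition count_upto (R : realType) (p : nat -> R) (nu q : R)
    (M : trial_model p nu q) (t : R) (w : Omega M) : nat :=
  (\sum_(1 <= i < (N M w).+1) (U M i w <= t)%R)%N.

(* T_k for 1 <= k <= N; the value for k > N is a junk value. *)
Definition epoch (R : realType) (p : nat -> R) (nu q : R)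
    (M : trial_model p nu q) (k : nat) (w : Omega M) : R :=
  nth 1 (sort <=%R [seq U M i w | i <- iota 1 (N M w)]) k.-1.

(* Number of successes among the trials k+1, ..., N. *)
Definition later_successes (R : realType) (p : nat -> R) (nu q : R)
    (M : trial_model p nu q) (k : nat) (w : Omega M) : nat :=
  (\sum_(k.+1 <= j < (N M w).+1) B M j w)%N.

(* F_t.  The generators express that a k-th trial takes place at or before a
   time s <= t, respectively that it does and is a success. *)
Definition history (R : realType) (p : nat -> R) (nu q : R)
    (M : trial_model p nu q) (t : R) : set (set (Omega M)) :=
  <<s [set E | exists k s, [/\ (0 < k)%N, s <= t &
         E = [set w | (k <= N M w)%N /\ epoch k w <= s] \/
         E = [set w | [/\ (k <= N M w)%N, epoch k w <= s & B M k w]]]] >>.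

(* S_i(t,k): conditional probability, given N_t = k, of exactly i successes
   among the trials k+1, ..., N. *)
Definition S_cond (R : realType) (p : nat -> R) (nu q : R)
    (M : trial_model p nu q) (i : nat) (t : R) (k : nat) : R :=
  fine (Pr M [set w : Omega M | count_upto t w = k /\ later_successes k w = i])
  / fine (Pr M [set w : Omega M | count_upto t w = k]).

Definition stopping_strategy (R : realType) (p : nat -> R) (nu q : R)
    (M : trial_model p nu q) (tau : Omega M -> R) : Prop :=
  [/\ measurable_fun setT tau,
      forall w, (exists2 k, (0 < k <= N M w)%N & tau w = epoch k w)
                \/ tau w = 1 &
      forall t, 0 <= t <= 1 -> @history R p nu q M t [set w | tau w <= t]].

Definition win_event (R : realType) (p : nat -> R) (nu q : R)
    (M : trial_model p nu q) (tau : Omega M -> R) : set (Omega M) :=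
  [set w | exists k, [/\ (0 < k <= N M w)%N, tau w = epoch k w, B M k w &
                         forall j, (k < j <= N M w)%N -> ~~ B M j w]].

Definition optimal (R : realType) (p : nat -> R) (nu q : R)
    (M : trial_model p nu q) (tau : Omega M -> R) : Prop :=
  stopping_strategy tau /\
  forall sigma : Omega M -> R, stopping_strategy sigma ->
    (Pr M (win_event sigma) <= Pr M (win_event tau))%E.

Definition myopic (R : realType) (p : nat -> R) (nu q : R)
    (M : trial_model p nu q) (w : Omega M) : R :=
  head 1 [seq epoch k w | k <- iota 1 (N M w) &
    B M k w && (S_cond M 1 (epoch k w) k <= S_cond M 0 (epoch k w) k)].

(* Main.v *)
Require Import Defs.
From HB Require Import structures.
From mathcomp Require Import all_boot all_order all_algebra.
From mathcomp Require Import all_classical all_reals all_analysis.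
From mathcomp Require Import ring lra zify.
Import Order.TTheory GRing.Theory Num.Theory.
Import numFieldNormedType.Exports.
Local Open Scope classical_set_scope.
Local Open Scope ring_scope.
Set Implicit Arguments.
Unset Strict Implicit.

(** The odds of trial n + 1 are p_(n+1) / (1 - p_(n+1)) = theta / n, so that
    s1 = theta h(j) s0 for the j trials after the k-th one, where
    h(j) = 1/k + ... + 1/(k+j-1).  Hence W1 / W0 = theta H_k(x), where H_k(x) is
    the mean of h under the weights c_k(j) x^j, and the c_k(j) are the
    coefficients of the hypergeometric series F(k, k + nu; k + theta; x).  The
    root alpha_k is thus defined by H_k(alpha_k) = 1 / theta.

    All monotonicity comes from Chebyshev's sum inequality: two functions that
    are monotone in the same sense are positively correlated under any weights.
    Increasing x tilts the weights towards large j, so H_k increases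
    ([mean_har_lt]); it also exceeds 1 / theta near 1 ([mean_har_large]), which
    gives existence and uniqueness of the root.  Put
    lambda_j = (k + nu + j) / (k + theta + j).  Dividing c_(k+1)(j) by lambda_j
    yields a mixture of c_k(j) and c_(k+1)(j-1), and the same identity holds for
    c h ([coef_size_bias], [coef_har_size_bias]).  Since lambda is monotone in
    j, in a sense given by the sign of nu - theta, Chebyshev's inequality says
    whether H_(k+1) lies below or above H_k.  Finally (1 - x) H_k' differs from 1
    by a term of order |nu - theta| / (k + theta), so H_k(x) tends to -ln(1 - x),
    with equality when nu = theta ([mean_har_approx]), and alpha^* is the
    solution of -ln(1 - x) = 1 / theta.

    In the model, given N_t = k the trials after t do not depend on the history
    up to t ([markov]), and S_1(t,k) = theta H_k(q (1 - t)) S_0(t,k)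
    ([S_cond_ratio]).  Hence stopping at a success at time t is at least as good
    as waiting for the very next success exactly when t is at least the
    threshold 1 - alpha_k / q.  The step from fixed times to the epoch T_k is
    [compare_later]: for an event decided at T_k, inequalities between the
    S_i(t,k) for all t become inequalities between the probabilities of i later
    successes.

    If nu >= theta, the thresholds decrease with k: once a success is
    acceptable, so are all later ones.  A strategy which beats the threshold
    rule on some outcome has either stopped too early, at an unacceptable last
    success, or too late, letting an acceptable success pass in favour of the
    last one.  By [compare_later] each kind of win is paid for by losses of at
    least the same probability on which the threshold rule wins
    ([threshold_beats]).

    If nu < theta, take q = alpha_1.  The first threshold vanishes and p_1 = 1,
    so the myopic rule stops at T_1 almost surely.  The second threshold is
    positive because H_2 > H_1, and so is a smaller time c.  When T_1 <= b, a
    rule which skips T_1 and takes the first success after c gains at least a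
    multiple of the probability, of order b, that exactly one success is passed
    over in this way ([deviation_gain]); stopping at T_1 is better than waiting only by a
    quantity which is o(b), because T_1 is then close to its threshold
    ([early_loss]).  For small b the deviation wins with larger probability. *)

(** * Convergent series and Chebyshev's sum inequality *)

Section Series.
Context {R : realType}.
Implicit Types (a g h : nat -> R) (x y : R).

Lemma ratio_test a y n0 : (forall j, 0 <= a j) -> 0 < y < 1 ->
  (forall j, (n0 <= j)%N -> a j.+1 <= y * a j) -> cvgn (series a).
Proof.
move=> a0 /andP[y0 y1] ay.
pose C := \sum_(j < n0.+1) a j / y ^+ j.
have aC j : a j <= C * y ^+ j.
  case: (leqP j n0) => [jn|].
    rewrite -ler_pdivrMr ?exprn_gt0// /C.
    rewrite (bigD1 (Ordinal (jn : (j < n0.+1)%N)))//= lerDl.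
    by apply: sumr_ge0 => i _; rewrite divr_ge0// exprn_ge0// ltW.
  elim: j => // j IH; rewrite ltnS leq_eqVlt => /orP[/eqP <-|nj].
    apply: (le_trans (ay _ (leqnn _))); rewrite exprS mulrCA ler_pM2l//.
    rewrite -ler_pdivrMr ?exprn_gt0// /C big_ord_recr/= lerDr.
    by apply: sumr_ge0 => i _; rewrite divr_ge0// exprn_ge0// ltW.
  by apply: (le_trans (ay _ (ltnW nj))); rewrite exprS mulrCA ler_pM2l// IH.
have C0 : 0 <= C by apply: sumr_ge0 => i _; rewrite divr_ge0// exprn_ge0// ltW.
apply: (@series_le_cvg _ a (geometric C y)) => //.
- by move=> n; rewrite /= mulr_ge0// exprn_ge0// ltW.
- by apply: is_cvg_geometric_series; rewrite ger0_norm// ltW.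
Qed.

(** A relation rather than a value: [limn] is junk on divergent series, whereas a
    sum transported along this relation carries its convergence with it. *)
Definition has_sum a (s : R) := series a @ \oo --> s.

Lemma cvgn_has_sum a : cvgn (series a) -> has_sum a (limn (series a)).
Proof. by []. Qed.

Lemma has_sum_cvgn a s : has_sum a s -> cvgn (series a).
Proof. by move=> h; apply/cvg_ex; exists s. Qed.
Global Arguments has_sum_cvgn {a s} _.

Lemma has_sum_lim a s : has_sum a s -> limn (series a) = s.
Proof. by move=> h; apply: cvg_lim. Qed.
Global Arguments has_sum_lim {a s} _.

Lemma has_sum_unique a s s' : has_sum a s -> has_sum a s' -> s = s'.
Proof. by move=> /has_sum_lim <- /has_sum_lim <-. Qed.

Lemma eq_has_sum a b s : a =1 b -> has_sum a s -> has_sum b s.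
Proof. by move=> /funext ->. Qed.
Global Arguments eq_has_sum {a b s} _ _.

Lemma has_sumM (c : R) a s : has_sum a s -> has_sum (fun j => c * a j) (c * s).
Proof.
move=> as_; rewrite /has_sum (_ : series _ = (fun n => c * series a n)).
  exact: cvgMr.
by apply/funext => n; rewrite !seriesEnat/= mulr_sumr.
Qed.
Global Arguments has_sumM c {a s} _.

Lemma has_sumD a b s t : has_sum a s -> has_sum b t ->
  has_sum (fun j => a j + b j) (s + t).
Proof.
move=> as_ bt; rewrite /has_sum
  (_ : series _ = (fun n => series a n + series b n)); first exact: cvgD.
by apply/funext => n; rewrite !seriesEnat/= big_split.
Qed.
Global Arguments has_sumD {a b s t} _ _.

Lemma has_sumB a b s t : has_sum a s -> has_sum b t ->
  has_sum (fun j => a j - b j) (s - t).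
Proof.
move=> as_ /(has_sumM (-1)) bt; have := has_sumD as_ bt.
by rewrite mulN1r; apply: eq_has_sum => j; rewrite mulN1r.
Qed.
Global Arguments has_sumB {a b s t} _ _.

Lemma has_sum_ge_term a s j : (forall j, 0 <= a j) -> has_sum a s -> a j <= s.
Proof.
move=> a0 as_; rewrite -(has_sum_lim as_).
apply: limr_ge; first exact: has_sum_cvgn as_.
near=> n.
have jn : (j < n)%N by near: n; exists j.+1.
rewrite seriesEnat/= big_mkord (bigD1 (Ordinal jn))//= lerDl.
by apply: sumr_ge0.
Unshelve. all: by end_near. Qed.
Global Arguments has_sum_ge_term {a s} j _ _.

Lemma has_sum_ge0 a s : (forall j, 0 <= a j) -> has_sum a s -> 0 <= s.
Proof. by move=> a0 as_; apply: le_trans (has_sum_ge_term 0 a0 as_). Qed.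
Global Arguments has_sum_ge0 {a s} _ _.

Lemma has_sum_gt0 a s j : (forall j, 0 <= a j) -> has_sum a s -> 0 < a j ->
  0 < s.
Proof. by move=> a0 as_ aj; apply: lt_le_trans aj (has_sum_ge_term j a0 as_). Qed.
Global Arguments has_sum_gt0 {a s j} _ _ _.

Lemma le_has_sum a b s t : (forall j, a j <= b j) -> has_sum a s ->
  has_sum b t -> s <= t.
Proof.
move=> ab as_ bt; rewrite -subr_ge0.
by apply: has_sum_ge0 (has_sumB bt as_) => j; rewrite subr_ge0.
Qed.
Global Arguments le_has_sum {a b s t} _ _ _.

Lemma has_sum_shift a s : has_sum a s -> has_sum (fun j => a j.+1) (s - a 0%N).
Proof.
move=> as_; rewrite /has_sum
  (_ : series _ = (fun n => series a n.+1 - a 0%N)); last first.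
  by apply/funext => n; rewrite !seriesEnat/= big_nat_recl// addrC addKr.
by apply: cvgB; [rewrite cvg_shiftS|exact: cvg_cst].
Qed.
Global Arguments has_sum_shift {a s} _.

Lemma has_sum_unshift a s : has_sum (fun j => a j.+1) s ->
  has_sum a (a 0%N + s).
Proof.
move=> as_.
have e : (fun n => series a n.+1) =
    (fun n => a 0%N + series (fun j => a j.+1) n).
  by apply/funext => n; rewrite !seriesEnat/= big_nat_recl.
rewrite /has_sum -cvg_shiftS [X in X @ _]e.
by apply: cvgD => //; exact: cvg_cst.
Qed.
Global Arguments has_sum_unshift {a s} _.

Section Chebyshev.
Variables (a g h : nat -> R) (A B C D : R).
Hypotheses (a0 : forall j, 0 <= a j) (a00 : 0 < a 0%N).
Hypotheses (gm : {homo g : i j / (i <= j)%N >-> i <= j})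
  (hm : {homo h : i j / (i <= j)%N >-> i <= j}).
Hypotheses (sa : has_sum a A) (sag : has_sum (fun j => a j * g j) B)
  (sah : has_sum (fun j => a j * h j) C)
  (sagh : has_sum (fun j => a j * g j * h j) D).

(** The centred function G = A g - B has mean zero and changes sign once, at m0
    say, so that every term a j G j (h j - h m0) is nonnegative; these terms sum
    to D A - B C. *)
Let chebyshev_both : B * C <= D * A /\
  (0 < a 1%N -> g 0%N < g 1%N -> h 0%N < h 1%N -> B * C < D * A).
Proof.
have A0 : 0 < A by apply: has_sum_gt0 sa a00.
pose G j := g j * A - B.
have Gm : {homo G : i j / (i <= j)%N >-> i <= j}.
  by move=> i j ij; rewrite lerB// ler_pM2r// gm.
have sG : has_sum (fun j => a j * G j) 0.
  have := has_sumB (has_sumM A sag) (has_sumM B sa).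
  rewrite mulrC subrr; apply: eq_has_sum => j; rewrite /G; ring.
(* A function with mean zero cannot be negative everywhere. *)
have [m Gm0] : exists m, 0 <= G m.
  apply: contrapT => /forallNP nG.
  have Gn j : G j < 0 by rewrite ltNge; apply/negP/nG.
  have : 0 < -1 * 0 :> R.
    apply: has_sum_gt0 (has_sumM (-1) sG) (_ : 0 < -1 * (a 0%N * G 0%N)).
      by move=> j; rewrite mulN1r oppr_ge0 mulr_ge0_le0// ltW.
    by rewrite mulN1r oppr_gt0 pmulr_rlt0.
  by rewrite mulr0 ltxx.
have [m0 Gm00 m0min] :=
  @ex_minnP (fun n => 0 <= G n) (ex_intro (fun n => 0 <= G n) m Gm0).
pose d j := a j * G j * (h j - h m0).
have d0 j : 0 <= d j.
  case: (leqP m0 j) => mj.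
    apply: mulr_ge0; last by rewrite subr_ge0 hm.
    by apply: mulr_ge0 => //; exact: le_trans Gm00 (Gm _ _ mj).
  have Gj : G j < 0 by rewrite ltNge; apply/negP => /m0min; rewrite leqNgt mj.
  rewrite /d -mulrA mulr_ge0// mulr_le0//; first exact: ltW.
  by rewrite subr_le0 hm// ltnW.
have sd : has_sum d (D * A - B * C).
  have := has_sumB (has_sumB (has_sumM A sagh) (has_sumM B sah))
    (has_sumM (h m0) sG).
  rewrite mulr0 subr0 (mulrC A); apply: eq_has_sum => j; rewrite /d /G; ring.
split; first by rewrite -subr_ge0 (has_sum_ge0 d0 sd).
move=> a1 g01 h01; rewrite -subr_gt0.
have G01 : G 0%N < G 1%N by rewrite ltrD2r ltr_pM2r.
have G0 : G 0%N < 0.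
  rewrite ltNge; apply/negP => G0.
  suff : 0 < 0 :> R by rewrite ltxx.
  apply: has_sum_gt0 sG (_ : 0 < a 1%N * G 1%N).
    by move=> j; apply: mulr_ge0 => //; exact: le_trans G0 (Gm _ _ (leq0n j)).
  by rewrite mulr_gt0// (le_lt_trans G0).
have m1 : (0 < m0)%N.
  by rewrite lt0n; apply/negP => /eqP m00; move: Gm00; rewrite m00 leNgt G0.
apply: has_sum_gt0 d0 sd (_ : 0 < d 0%N).
rewrite /d -mulrA mulr_gt0// nmulr_rgt0// subr_lt0 (lt_le_trans h01)//.
exact: hm.
Qed.

Lemma chebyshev_le : B * C <= D * A.
Proof. by have [] := chebyshev_both. Qed.

Lemma chebyshev_lt : 0 < a 1%N -> g 0%N < g 1%N -> h 0%N < h 1%N ->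
  B * C < D * A.
Proof. by have [_] := chebyshev_both. Qed.

End Chebyshev.

End Series.

(** * Hypergeometric weights *)

Section Coefficients.
Context {R : realType}.
Implicit Types (x y : R) (g : nat -> R).

Lemma pochhammerS (a : R) n : pochhammer a n.+1 = pochhammer a n * (a + n%:R).
Proof. by rewrite /pochhammer big_ord_recr. Qed.

Lemma pochhammer_gt0 (a : R) n : 0 < a -> 0 < pochhammer a n.
Proof. by move=> a0; apply: prodr_gt0 => i _; rewrite ltr_wpDr. Qed.

(** The factor (j + 1)^2 leaves room for a harmonic number and for the mean of the
    negative binomial law. *)
Lemma nb_weight_summable (a x : R) : 0 < a -> 0 <= x < 1 ->
  cvgn (series (fun j => pochhammer a j / j`!%:R * x ^+ j * j.+1%:R ^+ 2)).
Proof.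
move=> a0 /andP[x0 x1].
have [->|xn0] := eqVneq x 0.
  apply: (@ratio_test _ _ 2^-1 0%N) => //; [|by apply/andP; split; lra|].
    move=> j; rewrite !mulr_ge0// ?invr_ge0// ltW// pochhammer_gt0//.
  by move=> j _; rewrite expr0n/= mulr0 mul0r !mulr_ge0// ?invr_ge0// ltW// pochhammer_gt0.
have {}x0 : 0 < x by rewrite lt_neqAle eq_sym xn0.
pose A := a + 1.
have A1 : 1 <= A by rewrite /A; lra.
(* With n = j + 1 >= 14 A / (1 - x) one has A <= n, hence
   (n + A)^3 <= n^3 + 7 A n^2 <= n^3 + (1 - x) n^3 / 2, and the ratio of
   consecutive terms is at most x (n + A)^3 / n^3 <= (1 + x) / 2. *)
pose n0 := (Num.truncn (14 * A / (1 - x))).+1.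
apply: (@ratio_test _ _ ((1 + x) / 2) n0).
- by move=> j; rewrite !mulr_ge0// ?invr_ge0 ?exprn_ge0// ltW// pochhammer_gt0.
- by apply/andP; split; lra.
- move=> j n0j.
  rewrite pochhammerS factS natrM exprS.
  have fj : 0 < (j`!%:R : R) by rewrite ltr0n fact_gt0.
  set n : R := j.+1%:R.
  have -> : j.+2%:R = n + 1 :> R by rewrite /n -natr1.
  have -> : j%:R = n - 1 :> R by rewrite /n -natr1 addrK.
  have n1 : 1 <= n by rewrite /n ler1n.
  have nA : 14 * A <= n * (1 - x).
    rewrite -ler_pdivrMr ?subr_gt0//; apply: le_trans (_ : n0%:R <= _).
      by apply/ltW/truncnS_gt; rewrite divr_ge0 ?subr_ge0 ?ltW//; lra.
    by rewrite /n ler_nat ltnW.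
  have main : x * (a + (n - 1)) * (n + 1) ^+ 2 <= (1 + x) / 2 * n ^+ 3.
    have An : A <= n by nra.
    apply: (@le_trans _ _ (x * (n + A) ^+ 3)).
      rewrite [(n + A) ^+ 3]exprS -mulrA ler_pM2l//; apply: ler_pM.
      - lra.
      - by rewrite exprn_ge0//; lra.
      - by rewrite /A; lra.
      - by rewrite lerXn2r// ?nnegrE; lra.
    have : (n + A) ^+ 3 <= n ^+ 3 + 7 * A * n ^+ 2.
      have : A ^+ 2 <= n * A by nra.
      have : A ^+ 3 <= A * n ^+ 2 by rewrite exprS ler_pM2l ?lerXn2r ?nnegrE; lra.
      nra.
    move=> h; apply: (@le_trans _ _ (x * (n ^+ 3 + 7 * A * n ^+ 2))).
      by rewrite ler_pM2l.
    have : 7 * A * n ^+ 2 <= n ^+ 3 * (1 - x) / 2.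
      have := ler_wpM2r (exprn_ge0 2 (ltW (lt_le_trans ltr01 n1))) nA.
      rewrite !exprS; lra.
    have : 0 <= n ^+ 3 * (1 - x) by rewrite mulr_ge0 ?exprn_ge0//; lra.
    nra.
  rewrite -[leLHS]/(_ * _).
  have -> : pochhammer a j * (a + (n - 1)) / (n * j`!%:R) * (x * x ^+ j) * (n + 1) ^+ 2
    = (pochhammer a j / j`!%:R * x ^+ j / n) * (x * (a + (n - 1)) * (n + 1) ^+ 2).
    by field; rewrite gt_eqF//= gt_eqF//; lra.
  have -> : (1 + x) / 2 * (pochhammer a j / j`!%:R * x ^+ j * n ^+ 2) =
    (pochhammer a j / j`!%:R * x ^+ j / n) * ((1 + x) / 2 * n ^+ 3).
    by field; rewrite gt_eqF//= gt_eqF//; lra.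
  apply: ler_wpM2l => //.
  rewrite !mulr_ge0// ?invr_ge0 ?exprn_ge0// ?ltW// ?pochhammer_gt0//.
Qed.

Lemma s0S (p : nat -> R) k n : (k <= n)%N ->
  s0 p k.+1 n.+1 = s0 p k.+1 n * (1 - p n.+1).
Proof. by move=> kn; rewrite /s0 big_nat_recr. Qed.

Lemma s0_id (p : nat -> R) k : s0 p k.+1 k = 1.
Proof. by rewrite /s0 big_geq. Qed.

End Coefficients.

Section Hypergeometric.
Context {R : realType} {theta nu : R}.
Context (th0 : 0 < theta) (nu0 : 0 < nu).
Implicit Types (x y : R) (g : nat -> R) (k : nat).
Local Notation p := (success_prob theta).

(** The coefficient (k)_j (k + nu)_j / ((k + theta)_j j!) of a hypergeometric
    series, in the form in which it appears in W0. *)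
Definition hyp_coef k j : R :=
  pochhammer (k%:R + nu) j / j`!%:R * s0 p k.+1 (k + j).

(** Monotone in j, decreasing for nu > theta and increasing for nu < theta; every
    dependence on the sign of nu - theta goes through this ratio. *)
Definition hyp_ratio k j : R := (k%:R + nu + j%:R) / (k%:R + theta + j%:R).

Definition shifted_harmonic k j : R := \sum_(i < j) (k%:R + i%:R)^-1.

Local Notation coef := hyp_coef.
Local Notation lam := hyp_ratio.
Local Notation har := shifted_harmonic.

Lemma fail_probE n : (0 < n)%N -> 1 - p n.+1 = n%:R / (theta + n%:R).
Proof.
move=> n0; have n0' : 0 < n%:R :> R by rewrite ltr0n.
rewrite /success_prob -natr1; field.
by rewrite lt0r_neq0// addr_gt0.
Qed.

Lemma odds_ratioE n : (0 < n)%N -> p n.+1 / (1 - p n.+1) = theta / n%:R.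
Proof.
move=> n0; have n0' : 0 < n%:R :> R by rewrite ltr0n.
rewrite fail_probE// /success_prob -natr1; field.
by rewrite !lt0r_neq0// addr_gt0.
Qed.

Lemma s0_gt0 k n : (0 < k)%N -> 0 < s0 p k.+1 n.
Proof.
move=> k0; rewrite /s0 big_nat; apply: prodr_gt0 => -[//|i] /andP[ki _].
have i0 : (0 < i)%N by rewrite (leq_trans k0).
by rewrite fail_probE// divr_gt0 ?ltr0n// addr_gt0// ltr0n.
Qed.

Lemma s0_le1 k n : (0 < k)%N -> s0 p k.+1 n <= 1.
Proof.
move=> k0; rewrite /s0 big_nat; apply: prodr_ile1 => -[//|i] /andP[ki _].
have i0 : (0 < i)%N by rewrite (leq_trans k0).
have i0' : 0 < i%:R :> R by rewrite ltr0n.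
have t0 : 0 < theta + i%:R by rewrite addr_gt0.
by rewrite fail_probE// divr_ge0 ?ltW//= ltr_pdivrMr// mul1r ltrDr.
Qed.

Lemma coef0 k : coef k 0 = 1.
Proof. by rewrite /hyp_coef /pochhammer big_ord0 addn0 s0_id fact0 divr1 mulr1. Qed.

Lemma lam_gt0 k j : 0 < lam k j.
Proof.
by rewrite /hyp_ratio divr_gt0// -addrA ltr_wpDl// ltr_wpDr.
Qed.

Lemma coefS k j : (0 < k)%N ->
  coef k j.+1 = coef k j * ((k%:R + j%:R) / j.+1%:R * lam k j).
Proof.
move=> k0; rewrite /hyp_coef pochhammerS addnS s0S ?leq_addr//.
rewrite fail_probE ?addn_gt0 ?k0// factS !natrM natrD.
have k0' : 0 < k%:R :> R by rewrite ltr0n.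
have j0' : 0 <= j%:R :> R by [].
rewrite /hyp_ratio; field.
rewrite nat1r !lt0r_neq0 ?ltr0n ?fact_gt0//.
by apply: ltr_wpDr => //; exact: addr_gt0.
Qed.

Lemma coef_gt0 k j : (0 < k)%N -> 0 < coef k j.
Proof.
move=> k0; rewrite /hyp_coef mulr_gt0 ?s0_gt0// divr_gt0 ?ltr0n ?fact_gt0//.
by rewrite pochhammer_gt0// ltr_wpDl.
Qed.

Lemma coef_le k j : (0 < k)%N -> coef k j <= pochhammer (k%:R + nu) j / j`!%:R.
Proof.
move=> k0; rewrite /hyp_coef ler_piMr ?s0_le1// divr_ge0// ltW//.
by rewrite pochhammer_gt0// ltr_wpDl.
Qed.

Lemma har0 k : har k 0 = 0. Proof. by rewrite /shifted_harmonic big_ord0. Qed.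

Lemma harS k j : har k j.+1 = har k j + (k%:R + j%:R)^-1.
Proof. by rewrite /shifted_harmonic big_ord_recr. Qed.

Lemma har_homo k : {homo har k : i j / (i <= j)%N >-> i <= j}.
Proof.
apply: (homo_leq lexx le_trans) => j.
by rewrite harS lerDl invr_ge0 addr_ge0.
Qed.

Lemma har_ge0 k j : 0 <= har k j.
Proof. by apply: sumr_ge0 => i _; rewrite invr_ge0 addr_ge0. Qed.

Lemma har_le k j : (0 < k)%N -> har k j <= j%:R / k%:R.
Proof.
move=> k0; have k0' : 0 < k%:R :> R by rewrite ltr0n.
elim: j => [|j IH]; first by rewrite har0 mul0r.
rewrite harS -natr1 mulrDl mul1r lerD// lef_pV2 ?posrE ?lerDl//.
by rewrite ltr_wpDr.
Qed.

(** The odds of trial k + i + 1 are theta / (k + i). *)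
Lemma s1E k j : (0 < k)%N -> s1 p k.+1 (k + j) = s0 p k.+1 (k + j) * (theta * har k j).
Proof.
move=> k0; rewrite /s1; congr (_ * _).
elim: j => [|j IH]; first by rewrite addn0 big_geq// har0 mulr0.
rewrite addnS big_nat_recr/= ?ltnS ?leq_addr// IH.
by rewrite odds_ratioE ?addn_gt0 ?k0// harS natrD mulrDr.
Qed.

End Hypergeometric.

(** * Power series of radius at least one *)

Section Radius.
Context {R : realType}.
Implicit Types (x y : R) (c g : nat -> R).

(** Absolute convergence makes the property stable under domination, as in
    [radius1_dominated]; nonnegative x suffice because W0 and W1 are only
    studied on the unit interval. *)
Definition radius1 c :=
  forall x, 0 <= x < 1 -> cvgn (pseries (fun j => `|c j|) x).

Lemma pochhammer1 n : pochhammer (1 : R) n = n`!%:R.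
Proof.
elim: n => [|n IH]; first by rewrite /pochhammer big_ord0.
by rewrite pochhammerS IH factS natrM mulrC nat1r.
Qed.

(** For y between x and 1 the terms |c j| y^j are bounded, and the geometric
    factor (x / y)^j absorbs any polynomial growth of d / c. *)
Lemma radius1_dominated c d (C : R) : 0 <= C -> radius1 c ->
  (forall j, `|d j| <= C * j.+1%:R ^+ 2 * `|c j|) -> radius1 d.
Proof.
move=> C0 rc dc x /andP[x0 x1].
pose y := (1 + x) / 2.
have y01 : 0 <= y < 1 by rewrite /y; apply/andP; split; lra.
have y0 : 0 < y by rewrite /y; lra.
have [M cM] : exists M : R, forall j, `|c j| * y ^+ j <= M.
  have [K [Kreal Kf]] := cvg_series_bounded (rc _ y01).
  exists (K + 1) => j; rewrite -[leLHS]ger0_norm; last first.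
    by apply: mulr_ge0 => //; apply: exprn_ge0; exact: ltW.
  by apply: (Kf (K + 1) _ j) => //; rewrite ltrDl.
have r01 : 0 <= x / y < 1.
  by rewrite divr_ge0 ?(ltW y0)//= ltr_pdivrMr// mul1r /y; lra.
have cw : cvgn (series (fun j => C * M * ((x / y) ^+ j * j.+1%:R ^+ 2))).
  have := nb_weight_summable ltr01 r01.
  move=> /cvgn_has_sum/(has_sumM (C * M))/(eq_has_sum (b := _))/has_sum_cvgn; apply => j.
  by rewrite pochhammer1 divff ?mul1r// pnatr_eq0 -lt0n fact_gt0.
have M0 : 0 <= M by apply: le_trans (cM 0%N); rewrite expr0 mulr1.
have xy0 : 0 <= x / y by case/andP: r01.
apply: series_le_cvg cw => //.
- by move=> j; rewrite mulr_ge0// exprn_ge0.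
- by move=> j; rewrite !mulr_ge0// exprn_ge0.
- move=> j; apply: (@le_trans _ _ (C * j.+1%:R ^+ 2 * `|c j| * x ^+ j)).
    by rewrite ler_wpM2r ?exprn_ge0.
  have -> : C * j.+1%:R ^+ 2 * `|c j| * x ^+ j =
     (C * (x / y) ^+ j * j.+1%:R ^+ 2) * (`|c j| * y ^+ j).
    by rewrite expr_div_n; field; rewrite expf_neq0// lt0r_neq0.
  rewrite [leRHS](_ : _ = (C * (x / y) ^+ j * j.+1%:R ^+ 2) * M); last by ring.
  by rewrite ler_wpM2l// !mulr_ge0// exprn_ge0.
Qed.

Lemma radius1_growth c g (C : R) : 0 <= C -> radius1 c ->
  (forall j, `|g j| <= C * j.+1%:R ^+ 2) -> radius1 (fun j => c j * g j).
Proof.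
move=> C0 rc gC; apply: (radius1_dominated C0 rc) => j.
by rewrite normrM mulrC ler_wpM2r.
Qed.

Lemma radius1_shift c : radius1 c -> radius1 (fun j => c j.+1).
Proof.
move=> rc x /andP[x0 x1].
pose y := (1 + x) / 2.
have y01 : 0 <= y < 1 by rewrite /y; apply/andP; split; lra.
have y0 : 0 < y by rewrite /y; lra.
have := rc y y01.
move=> /cvgn_has_sum/has_sum_shift/(has_sumM y^-1)/has_sum_cvgn cw.
apply: series_le_cvg cw => //.
- by move=> j; rewrite mulr_ge0// exprn_ge0.
- by move=> j; rewrite !mulr_ge0// ?exprn_ge0// ?invr_ge0 ltW.
- move=> j /=.
  have -> : y^-1 * (`|c j.+1| * y ^+ j.+1) = `|c j.+1| * y ^+ j.
    by rewrite exprS; field; exact: lt0r_neq0.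
  by rewrite ler_wpM2l// lerXn2r ?nnegrE ?(ltW y0)//; rewrite /y; lra.
Qed.

Lemma radius1_diffs c : radius1 c -> radius1 (pseries_diffs c).
Proof.
move=> /radius1_shift rc.
apply: (@eq_ind _ _ radius1 (radius1_growth ler01 rc (g := fun j => j.+1%:R) _)).
  move=> j; rewrite normr_nat mul1r expr2 ler_peMr// ler1n//.
by apply/funext => j; rewrite /pseries_diffs mulrC.
Qed.

Lemma radius1_cvgn c x : radius1 c -> 0 <= x < 1 -> cvgn (pseries c x).
Proof.
move=> rc x01; apply: normed_cvg.
rewrite (_ : [normed _] = pseries (fun j => `|c j|) x); first exact: rc.
apply/funext => n; rewrite /normed_series_of/= /pseries !seriesEnat/=.
apply: eq_bigr => j _; rewrite normrM (ger0_norm (exprn_ge0 _ _))//.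
by case/andP: x01.
Qed.

Lemma radius1_derive c x : radius1 c -> 0 <= x < 1 ->
  is_derive x 1 (fun x => limn (pseries c x))
    (limn (pseries (pseries_diffs c) x)).
Proof.
move=> rc /andP[x0 x1].
have y01 : 0 <= (1 + x) / 2 < 1 by apply/andP; split; lra.
apply: (@pseries_snd_diffs _ _ ((1 + x) / 2)).
- exact: radius1_cvgn.
- by apply: radius1_cvgn => //; exact: radius1_diffs.
- by apply: radius1_cvgn => //; do 2! apply: radius1_diffs.
- by rewrite !ger0_norm//; lra.
Qed.

End Radius.

(** * The ratio W1 / W0 and its monotonicity *)

Section MeanHarmonic.
Context {R : realType} {theta nu : R}.
Context (th0 : 0 < theta) (nu0 : 0 < nu).
Implicit Types (x y : R) (g : nat -> R) (k : nat).
Local Notation coef := (@hyp_coef R theta nu).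
Local Notation lam := (@hyp_ratio R theta nu).
Local Notation har := (@shifted_harmonic R).

(** Multiplication of the generating function by its variable. *)
Definition delay (c : nat -> R) j : R := if j is i.+1 then c i else 0.

(** Up to the factor (1 - x)^(k + nu), the functions W0 and W1 / theta are
    [none_gf] and [har_gf]; see [W0E] and [W1E]. *)
Definition none_gf k x : R := limn (pseries (coef k) x).
Definition har_gf k x : R := limn (pseries (fun j => coef k j * har k j) x).
Definition mean_har k x : R := har_gf k x / none_gf k x.

Lemma radius1_coef k : (0 < k)%N -> radius1 (coef k).
Proof.
move=> k0 x x01; have x0 : 0 <= x by case/andP: x01.
have a0 : 0 < k%:R + nu by rewrite ltr_wpDl.
apply: series_le_cvg (nb_weight_summable a0 x01) => j /=.
- by rewrite mulr_ge0// exprn_ge0.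
- by rewrite !mulr_ge0 ?invr_ge0 ?exprn_ge0// ltW// pochhammer_gt0.
- rewrite -[leLHS]mulr1 ler_pM ?mulr_ge0 ?exprn_ge0//.
    rewrite ler_wpM2r ?exprn_ge0// gtr0_norm ?coef_gt0//.
    exact: coef_le.
  by rewrite exprn_ege1// ler1n.
Qed.

Lemma radius1_coef_har k : (0 < k)%N -> radius1 (fun j => coef k j * har k j).
Proof.
move=> k0; apply: (@radius1_growth _ _ _ 1) => //; first exact: radius1_coef.
move=> j; rewrite ger0_norm ?har_ge0// mul1r (le_trans (har_le _ k0))//.
apply: (@le_trans _ _ j.+1%:R); last by rewrite expr2 ler_peMr// ler1n.
rewrite ler_pdivrMr ?ltr0n//.
apply: (@le_trans _ _ j.+1%:R); first by rewrite ler_nat.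
by rewrite ler_peMr// ler1n.
Qed.

Section fixed_k.
Variable (k : nat).
Hypothesis (k0 : (0 < k)%N).
Let kR0 : 0 < k%:R :> R. Proof. by rewrite ltr0n. Qed.

Let coef_ge0 j : 0 <= coef k j. Proof. exact: ltW (coef_gt0 th0 nu0 j k0). Qed.

Lemma none_gf_sum x : 0 <= x < 1 -> has_sum (fun j => coef k j * x ^+ j) (none_gf k x).
Proof.
move=> x01; apply: cvgn_has_sum; apply: radius1_cvgn => //.
exact: radius1_coef.
Qed.

Lemma har_gf_sum x : 0 <= x < 1 ->
  has_sum (fun j => coef k j * har k j * x ^+ j) (har_gf k x).
Proof.
move=> x01; apply: cvgn_has_sum.
exact: (radius1_cvgn (radius1_coef_har k0) x01).
Qed.

Lemma none_gf_gt0 x : 0 <= x < 1 -> 0 < none_gf k x.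
Proof.
move=> x01; have x0 : 0 <= x by case/andP: x01.
apply: (has_sum_gt0 (j := 0) _ (none_gf_sum x01)).
  by move=> j; rewrite mulr_ge0 ?coef_ge0 ?exprn_ge0.
by rewrite expr0 mulr1 coef_gt0.
Qed.

Lemma har_gf_ge0 x : 0 <= x < 1 -> 0 <= har_gf k x.
Proof.
move=> x01; have x0 : 0 <= x by case/andP: x01.
apply: (has_sum_ge0 _ (har_gf_sum x01)) => j.
by rewrite mulr_ge0 ?exprn_ge0// mulr_ge0 ?har_ge0.
Qed.

(** The weights at x are those at y times (x / y)^j, which decreases with j,
    whereas the harmonic numbers increase: Chebyshev's inequality applies. *)
Lemma mean_har_lt x y : 0 <= x -> x < y -> y < 1 ->
  mean_har k x < mean_har k y.
Proof.
move=> x0 xy y1.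
have y0 : 0 < y by exact: le_lt_trans xy.
have x01 : 0 <= x < 1 by rewrite x0 (lt_trans xy).
have y01 : 0 <= y < 1 by rewrite ltW.
rewrite /mean_har ltr_pdivrMr ?none_gf_gt0// mulrAC ltr_pdivlMr ?none_gf_gt0//.
have xyE j : y ^+ j * (x / y) ^+ j = x ^+ j.
  by rewrite -exprMn mulrCA divff ?mulr1// lt0r_neq0.
have xy1 : x / y < 1 by rewrite ltr_pdivrMr// mul1r.
have xy0 : 0 <= x / y by rewrite divr_ge0// ltW.
(* Signs are changed because (x / y)^j decreases. *)
suff : - none_gf k x * har_gf k y < - har_gf k x * none_gf k y.
  by rewrite !mulNr ltrN2 (mulrC (none_gf k x)).
apply: (@chebyshev_lt _ (fun j => coef k j * y ^+ j)
  (fun j => - (x / y) ^+ j) (har k)).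
- by move=> j; rewrite mulr_ge0 ?exprn_ge0 ?(ltW y0).
- by rewrite expr0 mulr1 coef_gt0.
- by move=> i j ij; rewrite lerN2 ler_wiXn2l// ltW.
- exact: har_homo.
- exact: none_gf_sum.
- have := has_sumM (-1) (none_gf_sum x01); rewrite mulN1r; apply: eq_has_sum => j.
  by rewrite -xyE; ring.
- by have := har_gf_sum y01; apply: eq_has_sum => j; ring.
- have := has_sumM (-1) (har_gf_sum x01); rewrite mulN1r; apply: eq_has_sum => j.
  by rewrite -xyE; ring.
- by rewrite mulr_gt0 ?coef_gt0 ?exprn_gt0.
- by rewrite expr0 expr1 ltrN2.
- by rewrite harS har0 add0r addr0 invr_gt0.
Qed.

Lemma coef_next j :
  coef k.+1 j * (k%:R * lam k 0) = coef k j * ((k%:R + j%:R) * lam k j).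
Proof.
elim: j => [|j IH]; first by rewrite !coef0 addr0.
have lamS : lam k.+1 j = lam k j.+1.
  by rewrite /hyp_ratio -!natr1; congr (_ / _); ring.
rewrite !coefS// lamS mulrAC IH -!natr1; ring.
Qed.

Let lamn0 j : lam k j != 0. Proof. by rewrite lt0r_neq0// lam_gt0. Qed.

Let kn0 : k%:R != 0 :> R. Proof. exact: lt0r_neq0. Qed.

Let kl0 : k%:R * lam k 0 != 0. Proof. exact: mulf_neq0. Qed.

Let coef_nextE j : coef k.+1 j / lam k j =
  coef k j * (k%:R + j%:R) / (k%:R * lam k 0).
Proof.
apply: (@mulIf _ (k%:R * lam k 0)); first exact: kl0.
rewrite divfK//.
rewrite mulrAC coef_next mulrA mulfK//.
Qed.

Lemma coef_succ j : coef k j.+1 * j.+1%:R = coef k.+1 j * (k%:R * lam k 0).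
Proof.
rewrite coef_next coefS//; field; by rewrite nat1r pnatr_eq0.
Qed.

Lemma har_next j : har k.+1 j = har k j.+1 - k%:R^-1.
Proof.
elim: j => [|j IH]; first by rewrite harS !har0 addr0 add0r subrr.
rewrite harS IH [in RHS]harS.
have -> : k.+1%:R + j%:R = k%:R + j.+1%:R :> R by rewrite -!natrD addSnnS.
ring.
Qed.

(** Size biasing: up to constants j c_k(j) = c_(k+1)(j-1) ([coef_succ]) and
    (k + j) lambda_j c_k(j) = c_(k+1)(j) ([coef_next]), and k + j is the sum of k
    and j. *)
Lemma coef_size_bias j : coef k.+1 j / lam k j =
  coef k j / lam k 0 + delay (coef k.+1) j.
Proof.
rewrite coef_nextE; case: j => [|j]; rewrite /delay.
  by rewrite !coef0 addr0; field; rewrite lamn0.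
apply: (@mulIf _ (k%:R * lam k 0)); first exact: kl0.
rewrite mulrDl -coef_succ; field.
by rewrite kn0 lamn0.
Qed.

(** Besides [coef_size_bias] this uses
    (k + j) h_(k+1)(j) = k h_k(j) + j h_(k+1)(j-1), a consequence of
    [har_next]. *)
Lemma coef_har_size_bias j : coef k.+1 j * har k.+1 j / lam k j =
  coef k j * har k j / lam k 0 +
  delay (fun i => coef k.+1 i * har k.+1 i) j.
Proof.
rewrite mulrAC coef_nextE; case: j => [|j]; rewrite /delay.
  by rewrite !har0 !mulr0 mul0r addr0.
apply: (@mulIf _ (k%:R * lam k 0)); first exact: kl0.
rewrite [RHS]mulrDl (mulrAC (coef k.+1 j)) -coef_succ !har_next (harS _ j.+1).
have : k%:R + j.+1%:R != 0 :> R by rewrite -natrD pnatr_eq0 addnS.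
move: (har k j.+1) (j.+1%:R : R) => H J J0; field.
by rewrite J0 kn0 lamn0.
Qed.

End fixed_k.

Section size_bias_sums.
Variables (k : nat) (x : R).
Hypotheses (k0 : (0 < k)%N) (x01 : 0 <= x < 1).

(** Together with [size_bias_har_sum], this expresses the correlation of 1 / lambda
    and the harmonic numbers under the weights for k + 1 through the difference
    between H_k and H_(k+1) alone: the terms in x cancel. *)
Lemma size_bias_sum : has_sum (fun j => coef k.+1 j * x ^+ j * (lam k j)^-1)
  (none_gf k x / lam k 0 + x * none_gf k.+1 x).
Proof.
have s1 := has_sumM (lam k 0)^-1 (none_gf_sum k0 x01).
have s2 := has_sumM x (none_gf_sum (ltn0Sn k) x01).
have s3 : has_sum (fun j => delay (coef k.+1) j * x ^+ j)
    (x * none_gf k.+1 x).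
  rewrite -[X in has_sum _ X]add0r -[X in has_sum _ (X + _)](mul0r (x ^+ 0)).
  apply: has_sum_unshift; apply: eq_has_sum s2 => j.
  by rewrite exprS /delay; ring.
rewrite mulrC; apply: eq_has_sum (has_sumD s1 s3) => j.
rewrite [RHS]mulrAC coef_size_bias//; ring.
Qed.

Lemma size_bias_har_sum :
  has_sum (fun j => coef k.+1 j * x ^+ j * (lam k j)^-1 * har k.+1 j)
  (har_gf k x / lam k 0 + x * har_gf k.+1 x).
Proof.
have s1 := has_sumM (lam k 0)^-1 (har_gf_sum k0 x01).
have s2 := has_sumM x (har_gf_sum (ltn0Sn k) x01).
have s3 : has_sum (fun j => delay (fun i => coef k.+1 i * har k.+1 i) j
    * x ^+ j) (x * har_gf k.+1 x).
  rewrite -[X in has_sum _ X]add0r -[X in has_sum _ (X + _)](mul0r (x ^+ 0)).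
  apply: has_sum_unshift; apply: eq_has_sum s2 => j.
  by rewrite exprS /delay; ring.
rewrite mulrC; apply: eq_has_sum (has_sumD s1 s3) => j.
have -> : coef k.+1 j * x ^+ j * (lam k j)^-1 * har k.+1 j =
  (coef k.+1 j * har k.+1 j / lam k j) * x ^+ j by ring.
rewrite coef_har_size_bias//; ring.
Qed.

Lemma lamVE j : (lam k j)^-1 = 1 + (theta - nu) / (k%:R + nu + j%:R).
Proof.
rewrite /hyp_ratio invf_div; field.
by rewrite lt0r_neq0// -addrA ltr_wpDl// ltr_wpDr.
Qed.

(** For theta <= nu the function 1 / lambda is nondecreasing, hence positively
    correlated with the harmonic numbers. *)
Lemma mean_har_nonincr : theta <= nu -> mean_har k.+1 x <= mean_har k x.
Proof.
move=> thnu.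
have x0 : 0 <= x by case/andP: x01.
rewrite /mean_har ler_pdivrMr ?none_gf_gt0// mulrAC ler_pdivlMr ?none_gf_gt0//.
suff : (none_gf k x / lam k 0 + x * none_gf k.+1 x) * har_gf k.+1 x <=
  (har_gf k x / lam k 0 + x * har_gf k.+1 x) * none_gf k.+1 x.
  move=> H; rewrite -subr_ge0; move: H; rewrite -subr_ge0 [X in 0 <= X -> _](_ : _ =
    (har_gf k x * none_gf k.+1 x - har_gf k.+1 x * none_gf k x) / lam k 0); last by ring.
  by rewrite pmulr_lge0// invr_gt0 lam_gt0.
apply: (@chebyshev_le _ (fun j => coef k.+1 j * x ^+ j)
  (fun j => (lam k j)^-1) (har k.+1)).
- by move=> j; apply: mulr_ge0; [apply/ltW/coef_gt0|exact: exprn_ge0].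
- by rewrite expr0 mulr1 coef_gt0.
- move=> i j ij; rewrite !lamVE lerD2l; apply: ler_wnM2l.
    by rewrite subr_le0.
  by rewrite lef_pV2 ?posrE ?lerD2l ?ler_nat// -addrA ltr_wpDl// ltr_wpDr.
- exact: har_homo.
- exact: none_gf_sum.
- exact: size_bias_sum.
- by apply: eq_has_sum (har_gf_sum (ltn0Sn k) x01) => j; ring.
- exact: size_bias_har_sum.
Qed.

(** For nu < theta the function 1 / lambda is strictly decreasing. *)
Lemma mean_har_incr : nu < theta -> 0 < x -> mean_har k x < mean_har k.+1 x.
Proof.
move=> thnu x0.
rewrite /mean_har ltr_pdivrMr ?none_gf_gt0// mulrAC ltr_pdivlMr ?none_gf_gt0//.
suff : - (none_gf k x / lam k 0 + x * none_gf k.+1 x) * har_gf k.+1 x <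
  - (har_gf k x / lam k 0 + x * har_gf k.+1 x) * none_gf k.+1 x.
  move=> H; rewrite -subr_gt0; move: H; rewrite -subr_gt0 [X in 0 < X -> _](_ : _ =
    (har_gf k.+1 x * none_gf k x - har_gf k x * none_gf k.+1 x) / lam k 0); last by ring.
  by rewrite pmulr_lgt0// invr_gt0 lam_gt0.
apply: (@chebyshev_lt _ (fun j => coef k.+1 j * x ^+ j)
  (fun j => - (lam k j)^-1) (har k.+1)).
- by move=> j; apply: mulr_ge0; apply: ltW; rewrite ?coef_gt0 ?exprn_gt0.
- by rewrite expr0 mulr1 coef_gt0.
- move=> i j ij; rewrite lerN2 !lamVE lerD2l; apply: ler_wpM2l.
    by rewrite subr_ge0 ltW.
  by rewrite lef_pV2 ?posrE ?lerD2l ?ler_nat// -addrA ltr_wpDl// ltr_wpDr.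
- exact: har_homo.
- exact: none_gf_sum.
- have := has_sumM (-1) size_bias_sum; rewrite mulN1r.
  by apply: eq_has_sum => j; ring.
- by apply: eq_has_sum (har_gf_sum (ltn0Sn k) x01) => j; ring.
- have := has_sumM (-1) size_bias_har_sum; rewrite mulN1r.
  by apply: eq_has_sum => j; ring.
- by rewrite mulr_gt0 ?coef_gt0 ?exprn_gt0.
- rewrite ltrN2 !lamVE ltrD2l ltr_pM2l ?subr_gt0//.
  by rewrite ltf_pV2 ?posrE ?ltrD2l ?ltr_nat// -addrA ltr_wpDl// ltr_wpDr.
- by rewrite harS har0 add0r addr0 invr_gt0.
Qed.

End size_bias_sums.
End MeanHarmonic.

(** * Logarithmic approximation of the mean harmonic number *)

Lemma mean_value_from0 (R : realType) (f df : R -> R) (x : R) : 0 < x ->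
  f 0 = 0 -> (forall s, s \in `[0, x] -> is_derive s 1 f (df s)) ->
  exists2 s, s \in `[0, x] & f x = df s * x.
Proof.
move=> x0 f0 fD.
have x0' : 0 <= x by exact: ltW.
have d1 s : s \in `]0, x[ -> is_derive s 1 f (df s).
  by move=> /subset_itv_oo_cc; exact: fD.
have d2 : {within `[0, x], continuous f}.
  by apply: derivable_within_continuous => s sI; have [] := fD s sI.
have [s sI] := MVT_segment x0' d1 d2.
by rewrite f0 !subr0; exists s.
Qed.

Section Approximation.
Context {R : realType} {theta nu : R}.
Context (th0 : 0 < theta) (nu0 : 0 < nu).
Variable (k : nat).
Hypothesis (k0 : (0 < k)%N).
Implicit Types (x y : R) (g : nat -> R).
Local Notation coef := (@hyp_coef R theta nu k).
Local Notation lam := (@hyp_ratio R theta nu k).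
Local Notation har := (@shifted_harmonic R k).
Local Notation none_gf := (@none_gf R theta nu k).
Local Notation har_gf := (@har_gf R theta nu k).
Local Notation H := (@mean_har R theta nu k).
Local Notation D := (nu - theta).

Let kR0 : 0 < k%:R :> R. Proof. by rewrite ltr0n. Qed.
Let coef_ge0 j : 0 <= coef j. Proof. exact: ltW (coef_gt0 th0 nu0 j k0). Qed.
Let kt0 j : 0 < k%:R + theta + j%:R.
Proof. by rewrite -addrA ltr_wpDl// ltr_wpDr. Qed.

Definition none_gf' x : R := limn (pseries (pseries_diffs coef) x).
Definition har_gf' x : R := limn (pseries (pseries_diffs (fun j => coef j * har j)) x).

Lemma none_gf_derive x : 0 <= x < 1 -> is_derive x 1 none_gf (none_gf' x).
Proof. by apply: radius1_derive; exact: radius1_coef. Qed.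

Lemma har_gf_derive x : 0 <= x < 1 -> is_derive x 1 har_gf (har_gf' x).
Proof. by apply: radius1_derive; exact: radius1_coef_har. Qed.

Lemma lamE j : lam j = 1 + D / (k%:R + theta + j%:R).
Proof. by rewrite /hyp_ratio; field; rewrite lt0r_neq0. Qed.

Lemma coef_diffsE j :
  pseries_diffs coef j = coef j * ((k%:R + j%:R) * lam j).
Proof.
rewrite /pseries_diffs coefS//; field.
by rewrite nat1r pnatr_eq0.
Qed.

Lemma coef_har_diffsE j : pseries_diffs (fun j => coef j * har j) j =
  coef j * ((k%:R + j%:R) * lam j * har j + lam j).
Proof.
rewrite /pseries_diffs coefS// harS; field.
by rewrite nat1r pnatr_eq0 lt0r_neq0// ltr_wpDr.
Qed.

Section at_x.
Variable x : R.
Hypothesis x01 : 0 <= x < 1.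
Let x0 : 0 <= x. Proof. by case/andP: x01. Qed.
Let x1 : x < 1. Proof. by case/andP: x01. Qed.

Let df_sum : has_sum (fun j => pseries_diffs coef j * x ^+ j) (none_gf' x).
Proof.
apply: cvgn_has_sum; apply: radius1_cvgn => //.
by apply: radius1_diffs; exact: radius1_coef.
Qed.

Let du_sum : has_sum (fun j => pseries_diffs (fun j => coef j * har j) j * x ^+ j)
  (har_gf' x).
Proof.
apply: cvgn_has_sum; apply: radius1_cvgn => //.
by apply: radius1_diffs; exact: radius1_coef_har.
Qed.

Let xdiffs_sum c s : has_sum (fun j => pseries_diffs c j * x ^+ j) s ->
  has_sum (fun j => j%:R * c j * x ^+ j) (x * s).
Proof.
move=> /(has_sumM x) h.
rewrite -[x * s]add0r -[X in has_sum _ (X + _)](mul0r (c 0%N * x ^+ 0)) mulrA.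
apply: (has_sum_unshift (a := fun j => j%:R * c j * x ^+ j)).
by apply: eq_has_sum h => j; rewrite /pseries_diffs exprS; ring.
Qed.

Let r j : R := (k%:R + theta + j%:R)^-1.
Let r0 j : 0 < r j. Proof. by rewrite invr_gt0. Qed.
Let rle j : r j <= (k%:R + theta)^-1.
Proof. by rewrite lef_pV2 ?posrE ?lerDl// ltr_wpDl. Qed.

(** The recurrence (j + 1) c(j + 1) = (k + j) lambda_j c(j) with
    lambda_j = 1 + D / (k + theta + j) turns into first-order differential
    equations.  The error terms R0 and R1 are the sums of the series of the two
    generating functions with their terms divided by k + theta + j. *)
Lemma ode_sums : exists R0 R1, [/\
  0 <= R0 <= none_gf x / (k%:R + theta), 0 <= R1 <= har_gf x / (k%:R + theta),
  (1 - x) * none_gf' x = (k%:R + D) * none_gf x - D * theta * R0 &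
  (1 - x) * har_gf' x = (k%:R + D) * har_gf x - D * theta * R1 + none_gf x + D * R0].
Proof.
have fs := none_gf_sum th0 nu0 k0 x01; have us := har_gf_sum th0 nu0 k0 x01.
have rad0 : radius1 (fun j => coef j * r j).
  apply: (@radius1_growth _ _ _ (k%:R + theta)^-1).
  - by rewrite invr_ge0 ltW// ltr_wpDl.
  - exact: radius1_coef.
  - move=> j; rewrite gtr0_norm// (le_trans (rle j))// ler_peMr//.
      by rewrite invr_ge0 ltW// ltr_wpDl.
    by rewrite exprn_ege1// ler1n.
have rad1 : radius1 (fun j => coef j * har j * r j).
  apply: (@radius1_growth _ _ _ (k%:R + theta)^-1).
  - by rewrite invr_ge0 ltW// ltr_wpDl.
  - exact: radius1_coef_har.
  - move=> j; rewrite gtr0_norm// (le_trans (rle j))// ler_peMr//.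
      by rewrite invr_ge0 ltW// ltr_wpDl.
    by rewrite exprn_ege1// ler1n.
have s0 := cvgn_has_sum (radius1_cvgn rad0 x01).
have s1 := cvgn_has_sum (radius1_cvgn rad1 x01).
move: (limn _) s0 => R0 s0; move: (limn _) s1 => R1 s1.
exists R0, R1.
have xj j : 0 <= x ^+ j by exact: exprn_ge0.
have rn0 j : k%:R + theta + j%:R != 0 by rewrite lt0r_neq0.
split.
- apply/andP; split.
    apply: has_sum_ge0 s0 => j.
    by apply: mulr_ge0 => //; apply: mulr_ge0 => //; exact: ltW.
  rewrite [leRHS]mulrC.
  apply: (le_has_sum _ s0 (has_sumM (k%:R + theta)^-1 fs)) => j /=.
  rewrite mulrAC mulrC; apply: ler_wpM2r => //; exact: mulr_ge0.
- apply/andP; split.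
    apply: has_sum_ge0 s1 => j.
    apply: mulr_ge0 => //; apply: mulr_ge0; last exact: ltW.
    by apply: mulr_ge0 => //; exact: har_ge0.
  rewrite [leRHS]mulrC.
  apply: (le_has_sum _ s1 (has_sumM (k%:R + theta)^-1 us)) => j /=.
  rewrite mulrAC mulrC; apply: ler_wpM2r => //; apply: mulr_ge0 => //.
  by apply: mulr_ge0 => //; exact: har_ge0.
- rewrite mulrBl mul1r.
  have h1 := has_sumB df_sum (xdiffs_sum df_sum).
  have h2 := has_sumB (has_sumM (k%:R + D) fs) (has_sumM (D * theta) s0).
  apply: has_sum_unique h1 (eq_has_sum _ h2) => j.
  by rewrite /= coef_diffsE lamE /r; field.
- rewrite mulrBl mul1r.
  have h1 := has_sumB du_sum (xdiffs_sum du_sum).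
  have h2 := has_sumD (has_sumD (has_sumB (has_sumM (k%:R + D) us)
     (has_sumM (D * theta) s1)) fs) (has_sumM D s0).
  apply: has_sum_unique h1 (eq_has_sum _ h2) => j.
  by rewrite /= coef_har_diffsE lamE /r; field.
Qed.

Lemma mean_har_ge0 : 0 <= H x.
Proof. by apply: divr_ge0; [exact: har_gf_ge0|apply/ltW/none_gf_gt0]. Qed.

(** As h j <= j / k, the mean of h is at most 1 / k times the mean of j, which is a
    logarithmic derivative and is controlled by the first equation of
    [ode_sums]. *)
Lemma mean_har_bound : H x <= (1 + `|D|) * (x / (1 - x)).
Proof.
have [R0 [R1 [/andP[R00 R0f] _ fE _]]] := ode_sums.
have f0 : 0 < none_gf x by exact: none_gf_gt0.
have kt : 0 < k%:R + theta by rewrite ltr_wpDl.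
rewrite /mean_har ler_pdivrMr//.
have uf : har_gf x <= k%:R^-1 * (x * none_gf' x).
  apply: (le_has_sum _ (har_gf_sum th0 nu0 k0 x01)
    (has_sumM k%:R^-1 (xdiffs_sum df_sum))) => j.
  have -> : k%:R^-1 * (j%:R * coef j * x ^+ j) =
    coef j * (j%:R / k%:R) * x ^+ j by ring.
  apply: ler_wpM2r; first exact: exprn_ge0.
  by apply: ler_wpM2l => //; exact: har_le.
apply: (le_trans uf).
have R0f' : theta * R0 <= none_gf x.
  have : theta * R0 <= theta * (none_gf x / (k%:R + theta)) by rewrite ler_pM2l.
  move/le_trans; apply; rewrite mulrCA ler_piMr ?ltW//.
  by rewrite ltr_pdivrMr// mul1r ltrDr.
have fB : (1 - x) * none_gf' x <= (k%:R + `|D|) * none_gf x.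
  have t0 : 0 <= theta * R0 by rewrite mulr_ge0// ltW.
  rewrite fE -(mulrA D); move: (D) (theta * R0) (none_gf x) t0 R0f' f0.
  move=> d t f t0 tf f0; case: (ger0P d) => d0.
    by have := mulr_ge0 d0 t0; lra.
  have d0' : 0 <= - d by rewrite oppr_ge0 ltW.
  have := ler_wpM2l d0' tf; have := mulr_ge0 d0' (ltW f0); lra.
have x10 : 0 < 1 - x by rewrite subr_gt0.
have k1 : 1 <= k%:R :> R by rewrite ler1n.
rewrite -(ler_pM2l x10) -(ler_pM2l kR0).
have -> : k%:R * ((1 - x) * (k%:R^-1 * (x * none_gf' x))) = x * ((1 - x) * none_gf' x).
  by field; rewrite lt0r_neq0.
have -> : k%:R * ((1 - x) * ((1 + `|D|) * (x / (1 - x)) * none_gf x)) =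
   x * (k%:R * (1 + `|D|) * none_gf x).
  by field; rewrite lt0r_neq0.
apply: ler_wpM2l => //; apply: (le_trans fB); apply: ler_wpM2r; first exact: ltW.
rewrite mulrDr mulr1 lerD2l ler_peMl//.
Qed.

Definition mean_har' : R := (har_gf' x * none_gf x - har_gf x * none_gf' x) / none_gf x ^+ 2.

Lemma mean_har_derive : is_derive x 1 H mean_har'.
Proof.
have f0 : none_gf x != 0 by rewrite lt0r_neq0// none_gf_gt0.
have df := none_gf_derive x01; have du := har_gf_derive x01.
have := is_deriveM du (is_deriveV f0 df).
move/is_derive_eq; apply.
by rewrite /mean_har' /GRing.scale/=; field.
Qed.

(** In the derivative of the quotient the main terms (k + D) of the two
    equations cancel, and only the error terms of order 1 / (k + theta)
    remain besides 1. *)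
Lemma mean_har'_approx :
  `| (1 - x) * mean_har' - 1 | <= `|D| / (k%:R + theta) * (1 + theta * H x).
Proof.
have [R0 [R1 [/andP[R00 R0f] /andP[R10 R1u] fE uE]]] := ode_sums.
have f0 : 0 < none_gf x by exact: none_gf_gt0.
have kt : 0 < k%:R + theta by rewrite ltr_wpDl.
have -> : (1 - x) * mean_har' - 1 =
    D * (R0 / none_gf x + theta * (R0 / none_gf x * H x - R1 / none_gf x)).
  rewrite /mean_har' mulrA mulrBr !mulrA uE (mulrAC _ (har_gf x)) fE /mean_har.
  by field; rewrite lt0r_neq0.
rewrite normrM -[leRHS]mulrA; apply: ler_wpM2l => //.
have a0 : 0 <= R0 / none_gf x by rewrite divr_ge0// ltW.
have a1 : R0 / none_gf x <= (k%:R + theta)^-1 by rewrite ler_pdivrMr// mulrC.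
have b0 : 0 <= R1 / none_gf x by rewrite divr_ge0// ltW.
have b1 : R1 / none_gf x <= (k%:R + theta)^-1 * H x.
  by rewrite ler_pdivrMr// /mean_har -mulrA divfK ?lt0r_neq0// mulrC.
have H0 := mean_har_ge0.
move: (R0 / none_gf x) (R1 / none_gf x) (k%:R + theta)^-1 (H x) a0 a1 b0 b1 H0.
move=> a b c h a0 a1 b0 b1 H0.
have c0 : 0 <= c by exact: le_trans a1.
have e1 : a * h <= c * h by rewrite ler_wpM2r.
have e2 : 0 <= a * h by rewrite mulr_ge0.
have e3 : `|a * h - b| <= c * h by rewrite ler_norml; apply/andP; split; lra.
apply: (le_trans (ler_normD _ _)).
have -> : c * (1 + theta * h) = c + theta * (c * h) by ring.
apply: lerD; first by rewrite ger0_norm.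
by rewrite normrM (gtr0_norm th0) ler_pM2l.
Qed.

End at_x.

Lemma mean_har0 : H 0 = 0.
Proof.
apply/eqP; rewrite eq_le mean_har_ge0 ?lexx ?ltr01// andbT.
have := @mean_har_bound 0; rewrite lexx ltr01 mul0r mulr0; exact.
Qed.

(** Integration of [mean_har'_approx] from 0 to x, since 1 / (1 - x) is the
    derivative of - ln (1 - x).  The bound vanishes for nu = theta. *)
Lemma mean_har_approx x : 0 <= x < 1 ->
  `|H x + ln (1 - x)| <=
  `|D| / (k%:R + theta) * (1 + theta * ((1 + `|D|) * (x / (1 - x)))) * - ln (1 - x).
Proof.
move=> /andP[x0 x1].
set eta := (X in _ <= X * _).
have [->|xn0] := eqVneq x 0.
  by rewrite mean_har0 subr0 ln1 oppr0 mulr0 addr0 normr0.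
have {}x0 : 0 < x by rewrite lt_neqAle eq_sym xn0.
have kt : 0 < k%:R + theta by rewrite ltr_wpDl.
have sx (s : R) : s \in `[0, x] -> 0 <= s < 1.
  by rewrite in_itv/= => /andP[s0 sx]; rewrite s0 (le_lt_trans sx).
have etaP (s : R) : s \in `[0, x] -> `| (1 - s) * mean_har' s - 1 | <= eta.
  move=> sI; apply: (le_trans (mean_har'_approx (sx _ sI))).
  apply: ler_wpM2l; first by rewrite divr_ge0// ltW.
  rewrite lerD2l ler_pM2l//; apply: (le_trans (mean_har_bound (sx _ sI))).
  apply: ler_wpM2l; first by rewrite addr_ge0.
  move: sI; rewrite in_itv/= => /andP[s0 sx'].
  apply: ler_pM => //; first by rewrite invr_ge0; lra.
  by rewrite lef_pV2 ?posrE; lra.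
(* For c = 1 + eta and c = 1 - eta this function has a derivative of constant
   sign on the interval [0, x]. *)
pose phi (c s : R) : R := H s + c * ln (1 - s).
have phiD (c s : R) : s \in `[0, x] -> is_derive s 1 (phi c) (mean_har' s - c / (1 - s)).
  move=> sI; have /andP[s0 s1] := sx _ sI.
  have dH := mean_har_derive (sx _ sI).
  have s10 : 0 < 1 - s by rewrite subr_gt0.
  have d1 : is_derive s (1 : R) (fun s : R => 1 - s) (-1).
    have := is_deriveB (is_derive_cst (1 : R) s (1 : R)) (is_derive_id s (1 : R)).
    by rewrite sub0r.
  have dl := @is_derive1_comp _ (@ln R) (fun s => 1 - s) s _ _ (is_derive1_ln s10) d1.
  have := is_deriveD dH (is_deriveZ c dl).
  by move/is_derive_eq; apply; rewrite /GRing.scale/= mulrN1 mulrN.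
have phi0 c : phi c 0 = 0 by rewrite /phi mean_har0 subr0 ln1 mulr0 addr0.
have mvt (c : R) := @mean_value_from0 _ (phi c)
  (fun s => mean_har' s - c / (1 - s)) x x0 (phi0 c) (phiD c).
have [s1 s1I e1] := mvt (1 + eta).
have [s2 s2I e2] := mvt (1 - eta).
have {e1} : phi (1 + eta) x <= 0.
  rewrite e1 pmulr_lle0// subr_le0 ler_pdivlMr.
    by have := etaP _ s1I; rewrite ler_norml => /andP[]; lra.
  by have := sx _ s1I => /andP[_]; lra.
have {e2} : 0 <= phi (1 - eta) x.
  rewrite e2 pmulr_lge0// subr_ge0 ler_pdivrMr.
    by have := etaP _ s2I; rewrite ler_norml => /andP[]; lra.
  by have := sx _ s2I => /andP[_]; lra.
rewrite /phi ler_norml => h1 h2; apply/andP; split; nra.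
Qed.

End Approximation.

(** * The roots alpha_k *)

Section Harmonic.
Context {R : realType}.

Lemma harmonic_unbounded (m : nat) (B : R) :
  exists n, B < \sum_(m <= j < m + n) (j.+1%:R)^-1.
Proof.
apply: contrapT => /forallNP nB.
apply: (@dvg_harmonic R); apply: nondecreasing_is_cvgn.
  by apply: nondecreasing_series => i _ _; rewrite invr_ge0.
exists (\sum_(0 <= j < m) (j.+1%:R)^-1 + B) => _ [n _ <-].
have Bn : \sum_(m <= j < m + n) (j.+1%:R)^-1 <= B by rewrite leNgt; apply/negP/nB.
rewrite seriesEnat/=.
apply: (@le_trans _ _ (\sum_(0 <= j < m + n) (j.+1%:R)^-1)).
  rewrite [leRHS](@big_cat_nat _ _ _ n)//= ?leq_addl//.
  by rewrite lerDl; apply: sumr_ge0 => i _; rewrite invr_ge0.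
by rewrite (@big_cat_nat _ _ _ m)//= ?leq_addr// lerD2l.
Qed.

Lemma har_unbounded k (B : R) : (0 < k)%N -> exists n, B <= shifted_harmonic k n.
Proof.
move=> k0; have kR0 : 0 < k%:R :> R by rewrite ltr0n.
have [n nB] := harmonic_unbounded 0 (B * k%:R).
exists n; rewrite -(ler_pM2r kR0); apply/ltW/(lt_le_trans nB).
rewrite add0n big_mkord /shifted_harmonic mulr_suml; apply: ler_sum => i _.
have ki : 0 < k%:R + i%:R :> R by rewrite ltr_wpDr.
rewrite [leRHS]mulrC ler_pdivlMr// mulrC ler_pdivrMr ?ltr0n//.
rewrite -natr1 mulrDr mulr1 addrC lerD2r ler_peMl// ler1n//.
Qed.

Lemma exprn_bernoulli (x : R) j : 0 <= x <= 1 -> 1 - x ^+ j <= j%:R * (1 - x).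
Proof.
move=> /andP[x0 x1]; elim: j => [|j IH]; first by rewrite expr0 subrr mul0r.
rewrite exprS -natr1.
have : x ^+ j <= 1 by rewrite exprn_ile1.
have : 0 <= x ^+ j by rewrite exprn_ge0.
nra.
Qed.

Lemma has_sum_ge_partial (a : nat -> R) s n :
  (forall j, (n <= j)%N -> 0 <= a j) -> has_sum a s ->
  \sum_(0 <= j < n) a j <= s.
Proof.
move=> a0 as_; rewrite -(has_sum_lim as_).
apply: limr_ge; first exact: has_sum_cvgn as_.
near=> m.
have nm : (n <= m)%N by near: m; exists n.
rewrite seriesEnat/= [leRHS](@big_cat_nat _ _ _ n)//= lerDl big_nat.
by apply: sumr_ge0 => i /andP[ni _]; exact: a0.
Unshelve. all: by end_near. Qed.

End Harmonic.

Section RootExistence.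
Context {R : realType} {theta nu : R}.
Context (th0 : 0 < theta) (nu0 : 0 < nu).
Implicit Types (x y : R) (k : nat).
Local Notation H := (@mean_har R theta nu).
Local Notation none_gf := (@none_gf R theta nu).
Local Notation har_gf := (@har_gf R theta nu).
Local Notation coef := (@hyp_coef R theta nu).
Local Notation har := (@shifted_harmonic R).

Section fixed_k.
Variable k : nat.
Hypothesis k0 : (0 < k)%N.
Let kR0 : 0 < k%:R :> R. Proof. by rewrite ltr0n. Qed.
Let k1 : 1 <= k%:R :> R. Proof. by rewrite ler1n. Qed.
Let c0 j : 0 < coef k j. Proof. exact: coef_gt0. Qed.
Let V n := \sum_(0 <= j < n) coef k j * (theta * har k j - 1).
Let U n := \sum_(0 <= j < n) coef k j * har k j.

(** The right-hand side is j (k + theta + j - 1) c(j) h(j) / (k + j - 1) for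
    j = n + 1; by the recurrence for c, its increments dominate those of the
    left-hand side. *)
Lemma gap_telescope n : (k%:R + nu) * U n.+1 - V n.+1 <=
  (k%:R + nu + n%:R) * coef k n * har k n.+1.
Proof.
elim: n => [|n IH].
  rewrite /U /V !big_nat1 coef0 harS har0.
  rewrite !(mulr0, add0r, addr0, mul1r, sub0r, opprK, mulr1).
  by rewrite ler_pdivlMr// mul1r lerDl ltW.
have -> : U n.+2 = U n.+1 + coef k n.+1 * har k n.+1 by rewrite /U big_nat_recr.
have -> : V n.+2 = V n.+1 + coef k n.+1 * (theta * har k n.+1 - 1).
  by rewrite /V big_nat_recr.
have cS : coef k n.+1 * ((k%:R + theta + n%:R) * n.+1%:R) =
    (k%:R + nu + n%:R) * coef k n * (k%:R + n%:R).
  have := lt0r_neq0 (ltr_wpDr (ler0n R n) (addr_gt0 kR0 th0)) => kt.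
  rewrite coefS// /hyp_ratio; field.
  by rewrite kt nat1r pnatr_eq0.
have kn0 : 0 < k%:R + n%:R :> R by rewrite ltr_wpDr.
set c := coef k n.+1 in cS *; set h := har k n.+1 in IH *.
have h0 : 0 <= h by exact: har_ge0.
have cc0 : 0 < c by exact: c0.
have -> : har k n.+2 = h + (k%:R + n.+1%:R)^-1 by rewrite harS.
have IH' : (k%:R + nu) * U n.+1 - V n.+1 <= c * ((n.+1%:R + theta) * h).
  apply: (le_trans IH); rewrite -(ler_pM2r kn0) mulrAC -cS.
  have -> : c * ((k%:R + theta + n%:R) * n.+1%:R) * h =
     c * h * ((k%:R + theta + n%:R) * n.+1%:R) by ring.
  have -> : c * ((n.+1%:R + theta) * h) * (k%:R + n%:R) =
     c * h * ((n.+1%:R + theta) * (k%:R + n%:R)) by ring.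
  apply: ler_wpM2l; first by apply: mulr_ge0 => //; exact: ltW.
  rewrite -natr1; have := mulr_ge0 (ltW th0) (_ : 0 <= k%:R - 1); rewrite subr_ge0.
  by move=> /(_ k1); lra.
have e : 1 <= (k%:R + nu + n.+1%:R) / (k%:R + n.+1%:R).
  rewrite ler_pdivlMr ?mul1r; last by rewrite ltr_wpDr.
  by rewrite lerD2r lerDl ltW.
have e' : c <= c * ((k%:R + nu + n.+1%:R) / (k%:R + n.+1%:R)).
  by rewrite ler_peMr// ltW.
have -> : (k%:R + nu + n.+1%:R) * c * (h + (k%:R + n.+1%:R)^-1) =
  (k%:R + nu + n.+1%:R) * c * h + c * ((k%:R + nu + n.+1%:R) / (k%:R + n.+1%:R)).
  by ring.
rewrite mulrDr; lra.
Qed.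

(** Otherwise V <= 0 eventually, and [gap_telescope] bounds (k + nu) U by a multiple
    of (n + 1) c(n) h(n).  As U stays above a positive constant, c(n) h(n) is at
    least a constant over n + 1; since h is unbounded, so are the increments of V
    eventually, and the divergence of the harmonic series makes V positive. *)
Lemma gap_positive n0 : exists2 n, (n0 <= n)%N & 0 < V n.
Proof.
have [n1 Bn1] := har_unbounded (2 / theta) k0.
pose m := (maxn n0 n1).+2.
have mn0 : (n0 <= m)%N by rewrite /m; lia.
have mn1 : (n1 <= m)%N by rewrite /m; lia.
apply: contrapT => /forall2NP nV.
have V0 n : (m <= n)%N -> V n <= 0.
  move=> mn; have [|/negP] := nV n; last by rewrite -leNgt.
  by move=> /negP; rewrite -ltnNge => ?; lia.
set u := coef k 1 * har k 1.
have u0 : 0 < u by rewrite mulr_gt0 ?c0// harS har0 add0r addr0 invr_gt0.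
have ch n : (m <= n)%N -> u / 2 / n.+1%:R <= coef k n * har k n.
  move=> mn.
  have n2 : (2 <= n)%N by rewrite (leq_trans _ mn)// /m; lia.
  have Uu : u <= U n.+1.
    rewrite /U big_mkord (bigD1 (Ordinal (leqW n2)))//= lerDl.
    by apply: sumr_ge0 => i _; apply: mulr_ge0; [exact: ltW|exact: har_ge0].
  have := gap_telescope n; have := V0 n.+1 (leqW mn) => Vn Tn.
  have hh : har k n.+1 <= 2 * har k n.
    have : k%:R^-1 <= har k n.
      by apply: le_trans (har_homo k (ltnW n2)); rewrite harS har0 add0r addr0.
    have : (k%:R + n%:R)^-1 <= k%:R^-1 :> R.
      by rewrite lef_pV2 ?posrE ?lerDl// ltr_wpDr.
    by rewrite harS; lra.
  have kn : 0 < k%:R + nu by rewrite addr_gt0.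
  have a1 : (k%:R + nu) * u <= (k%:R + nu + n%:R) * (2 * (coef k n * har k n)).
    apply: (@le_trans _ _ ((k%:R + nu) * U n.+1)); first by rewrite ler_pM2l.
    apply: (@le_trans _ _ ((k%:R + nu + n%:R) * coef k n * har k n.+1)); first lra.
    have -> : (k%:R + nu + n%:R) * (2 * (coef k n * har k n)) =
      (k%:R + nu + n%:R) * coef k n * (2 * har k n) by ring.
    apply: ler_wpM2l => //; apply: mulr_ge0; last exact: ltW.
    by rewrite addr_ge0// ltW.
  rewrite ler_pdivrMr ?ltr0n// -[n.+1%:R]natr1.
  have n0R : 0 <= n%:R :> R by [].
  have kn1 : 1 <= k%:R + nu by apply: (le_trans k1); rewrite lerDl ltW.
  have w0 : 0 <= coef k n * har k n by apply: mulr_ge0; [exact: ltW|exact: har_ge0].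
  move: (coef k n * har k n) w0 a1 => w w0 a1.
  rewrite ler_pdivrMr//.
  have a2 : (k%:R + nu) * u <= (k%:R + nu) * (w * (n%:R + 1) * 2).
    apply: (le_trans a1).
    have : 0 <= w * n%:R * (k%:R + nu - 1).
      by rewrite mulr_ge0 ?mulr_ge0// subr_ge0.
    lra.
  by rewrite ler_pM2l in a2.
have [l] := harmonic_unbounded m (- V m / (theta * u / 4)).
rewrite ltr_pdivrMr; last by rewrite divr_gt0// mulr_gt0.
apply/negP; rewrite -leNgt.
have -> : - V m = V (m + l) - V m - V (m + l) by ring.
have VD : theta * u / 4 * \sum_(m <= j < m + l) j.+1%:R^-1 <= V (m + l) - V m.
  have -> : V (m + l) - V m =
      \sum_(m <= j < m + l) coef k j * (theta * har k j - 1).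
    apply/eqP; rewrite subr_eq addrC; apply/eqP.
    by apply: big_cat_nat; rewrite ?leq_addr.
  rewrite mulr_sumr big_nat [leRHS]big_nat; apply: ler_sum => j /andP[mj _].
  have hj : 2 <= theta * har k j.
    rewrite mulrC -ler_pdivrMr//; apply: (le_trans Bn1); apply: har_homo.
    exact: leq_trans mj.
  have := ch j mj; have := c0 j => cj chj.
  apply: (@le_trans _ _ (theta / 2 * (coef k j * har k j))).
    have -> : theta * u / 4 * j.+1%:R^-1 = theta / 2 * (u / 2 / j.+1%:R).
      by field; rewrite nat1r pnatr_eq0.
    by rewrite ler_pM2l// divr_gt0.
  have -> : theta / 2 * (coef k j * har k j) = coef k j * (theta * har k j / 2).
    by field.
  by rewrite ler_pM2l//; lra.
have := V0 (m + l)%N (leq_addr _ _); rewrite mulrC; lra.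
Qed.

(** A partial sum of the series at 1 of theta har_gf - none_gf is positive, and stays
    so at x close to 1; the terms beyond are nonnegative. *)
Lemma mean_har_large : exists2 x : R, 0 < x < 1 & 1 < theta * H k x.
Proof.
have [n1 Bn1] := har_unbounded (1 / theta) k0.
have [n n1n Vn] := gap_positive n1.
pose K := \sum_(0 <= j < n) `|coef k j * (theta * har k j - 1)| * j%:R.
have K0 : 0 <= K by apply: sumr_ge0 => i _; rewrite mulr_ge0.
pose d := V n / (K + V n + 1).
have KV : 0 < K + V n + 1 by lra.
have d0 : 0 < d by rewrite divr_gt0.
have d1 : d < 1 by rewrite ltr_pdivrMr//; lra.
have dK : d * K < V n.
  rewrite /d mulrAC ltr_pdivrMr//; have := mulr_gt0 Vn Vn; nra.
have x01 : 0 <= 1 - d < 1 by apply/andP; split; lra.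
exists (1 - d); first by apply/andP; split; lra.
rewrite /mean_har mulrA ltr_pdivlMr ?none_gf_gt0// mul1r -subr_gt0.
have s := has_sumB (has_sumM theta (har_gf_sum th0 nu0 k0 x01)) (none_gf_sum th0 nu0 k0 x01).
have {}s : has_sum (fun j => coef k j * (theta * har k j - 1) * (1 - d) ^+ j)
    (theta * har_gf k (1 - d) - none_gf k (1 - d)).
  by apply: (eq_has_sum _ s) => j; ring.
apply: lt_le_trans (has_sum_ge_partial (n := n) _ s); last first.
  move=> j nj; apply: mulr_ge0; last by rewrite exprn_ge0//; lra.
  apply: mulr_ge0; first exact: ltW.
  rewrite subr_ge0 mulrC -ler_pdivrMr//; apply: (le_trans Bn1).
  by apply: har_homo; exact: leq_trans nj.
apply: (@lt_le_trans _ _ (V n - d * K)); first by rewrite subr_gt0.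
rewrite /V /K mulr_sumr -sumrB; apply: ler_sum => j _.
move: (coef k j * (theta * har k j - 1)) => g.
have : 1 - (1 - d) ^+ j <= j%:R * (1 - (1 - d)).
  by apply: exprn_bernoulli; apply/andP; split; lra.
have : 0 <= 1 - (1 - d) ^+ j.
  by rewrite subr_ge0 exprn_ile1//; lra.
rewrite (_ : 1 - (1 - d) = d); last by ring.
move ee : (1 - (1 - d) ^+ j) => e e0 ed.
have -> : (1 - d) ^+ j = 1 - e by rewrite -ee; ring.
have gg := ler_norm g; have g0 := normr_ge0 g.
have h1 : g * e <= `|g| * e by rewrite ler_wpM2r.
have h2 : `|g| * e <= `|g| * (j%:R * d) by rewrite ler_wpM2l.
lra.
Qed.

End fixed_k.
End RootExistence.

Section Roots.
Context {R : realType} {theta nu : R}.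
Context (th0 : 0 < theta) (nu0 : 0 < nu).
Implicit Types (x y : R) (k : nat).
Local Notation p := (success_prob theta).
Local Notation H := (@mean_har R theta nu).
Local Notation none_gf := (@none_gf R theta nu).
Local Notation har_gf := (@har_gf R theta nu).
Local Notation D := (nu - theta).

Section fixed_k.
Variable k : nat.
Hypothesis k0 : (0 < k)%N.
Let kR0 : 0 < k%:R :> R. Proof. by rewrite ltr0n. Qed.
Lemma mean_har_derivable x : 0 <= x < 1 -> derivable (H k) x 1.
Proof. by move=> /(mean_har_derive th0 nu0 k0) []. Qed.

Lemma mean_har_root : exists2 x : R, 0 < x < 1 & theta * H k x = 1.
Proof.
have [y /andP[y0 y1] yH] := mean_har_large th0 nu0 k0.
have cH : {within `[0, y], continuous (H k)}.
  apply: derivable_within_continuous => s; rewrite in_itv/= => /andP[s0 sy].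
  by apply: mean_har_derivable; rewrite s0 (le_lt_trans sy).
have ty : theta^-1 < H k y by rewrite -(ltr_pM2l th0) divff ?lt0r_neq0.
have v : Num.min (H k 0) (H k y) <= theta^-1 <= Num.max (H k 0) (H k y).
  rewrite ge_min le_max (mean_har0 th0 nu0 k0) (ltW ty) invr_ge0 (ltW th0).
  by rewrite orbT.
have [x xI xH] := IVT (ltW y0) cH v.
have xH' : theta * H k x = 1 by rewrite xH divff// lt0r_neq0.
exists x => //; move: xI; rewrite in_itv/= => /andP[x0 xy].
rewrite (le_lt_trans xy)// andbT lt_neqAle x0 andbT.
apply/eqP => x00; move: xH'; rewrite -x00 (mean_har0 th0 nu0 k0) mulr0.
by move/eqP; rewrite eq_sym oner_eq0.
Qed.

Lemma W0E x : 0 <= x < 1 -> W0 p nu x k = (1 - x) `^ (k%:R + nu) * none_gf k x.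
Proof.
move=> x01; rewrite /W0 /Wfun; congr (_ * _).
apply: has_sum_lim; apply: eq_has_sum (none_gf_sum th0 nu0 k0 x01) => j.
by rewrite /hyp_coef; ring.
Qed.

Lemma W1E x : 0 <= x < 1 ->
  W1 p nu x k = (1 - x) `^ (k%:R + nu) * (theta * har_gf k x).
Proof.
move=> x01; rewrite /W1 /Wfun; congr (_ * _).
apply: has_sum_lim; apply: eq_has_sum (has_sumM theta (har_gf_sum th0 nu0 k0 x01)).
by move=> j; rewrite s1E// /hyp_coef; ring.
Qed.

Lemma W_rootE x : W_root p nu k x <-> 0 < x < 1 /\ theta * H k x = 1.
Proof.
split=> -[x01]; have /andP[x0 x1] := x01;
  have x01' : 0 <= x < 1 by rewrite (ltW x0).
- have P0 : (1 - x) `^ (k%:R + nu) != 0.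
    by rewrite lt0r_neq0// powR_gt0// subr_gt0.
  rewrite W0E// W1E// => /(mulfI P0) h; split=> //.
  by rewrite /mean_har mulrA -h divff// lt0r_neq0// none_gf_gt0.
- move=> h; split=> //; rewrite W0E// W1E//; congr (_ * _).
  have f0 := none_gf_gt0 th0 nu0 k0 x01'.
  by rewrite -[LHS]mul1r -h /mean_har mulrA divfK// lt0r_neq0.
Qed.

Lemma mean_har_ltP x y : 0 <= x < 1 -> 0 <= y < 1 -> H k x < H k y -> x < y.
Proof.
move=> /andP[x0 x1] /andP[y0 y1]; apply: contraTT; rewrite -!leNgt.
rewrite le_eqVlt => /predU1P[->//|yx]; apply: ltW.
exact: (mean_har_lt th0 nu0 k0).
Qed.

Lemma mean_har_leP x y : 0 <= x < 1 -> 0 <= y < 1 -> H k x <= H k y -> x <= y.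
Proof.
move=> /andP[x0 x1] /andP[y0 y1]; apply: contraTT; rewrite -!ltNge => yx.
exact: (mean_har_lt th0 nu0 k0).
Qed.

Lemma mean_har_homo x y : 0 <= x -> x <= y -> y < 1 -> H k x <= H k y.
Proof.
move=> x0; rewrite le_eqVlt => /predU1P[->//|xy] y1; apply: ltW.
exact: (mean_har_lt th0 nu0 k0).
Qed.

Lemma W_root_unique : exists! x, W_root p nu k x.
Proof.
have [x x01 xH] := mean_har_root; exists x; split; first by apply/W_rootE.
move=> y /W_rootE[y01 yH].
have e : H k x = H k y.
  by apply: (mulfI (lt0r_neq0 th0)); rewrite xH yH.
have x01' : 0 <= x < 1 by case/andP: x01 => ? ->; rewrite ltW.
have y01' : 0 <= y < 1 by case/andP: y01 => ? ->; rewrite ltW.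
have h1 : H k x <= H k y by rewrite e.
have h2 : H k y <= H k x by rewrite e.
apply/eqP; rewrite eq_le.
by rewrite (mean_har_leP x01' y01' h1) (mean_har_leP y01' x01' h2).
Qed.

End fixed_k.

Lemma mean_har_nonincr_le k l x : theta <= nu -> 0 <= x < 1 -> (0 < k)%N ->
  (k <= l)%N -> H l x <= H k x.
Proof.
move=> tn x01 k0; elim: l => [|l IH]; first by rewrite leqn0 => /eqP ->.
rewrite leq_eqVlt => /predU1P[->//|]; rewrite ltnS => kl.
apply: le_trans (IH kl); apply: mean_har_nonincr => //.
exact: leq_trans kl.
Qed.

Lemma mean_har_incr_le k l x : nu < theta -> 0 <= x < 1 -> (0 < k)%N ->
  (k <= l)%N -> H k x <= H l x.
Proof.
move=> tn x01 k0; elim: l => [|l IH]; first by rewrite leqn0 => /eqP ->.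
rewrite leq_eqVlt => /predU1P[->//|]; rewrite ltnS => kl.
have l0 : (0 < l)%N by exact: leq_trans kl.
apply: (le_trans (IH kl)).
have [->|xn0] := eqVneq x 0; first by rewrite !(mean_har0 th0 nu0).
apply/ltW/mean_har_incr => //.
by rewrite lt_neqAle eq_sym xn0; case/andP: x01.
Qed.

Lemma mean_har_limit x e : 0 <= x < 1 -> 0 < e ->
  exists K, forall k, (K < k)%N -> `|H k x + ln (1 - x)| < e.
Proof.
move=> x01 e0; have /andP[x0 x1] := x01.
pose C := `|D| * (1 + theta * ((1 + `|D|) * (x / (1 - x)))) * - ln (1 - x).
have C0 : 0 <= C.
  apply: mulr_ge0; last by rewrite oppr_ge0 ln_le0//; lra.
  apply: mulr_ge0 => //; apply: addr_ge0 => //; apply: mulr_ge0; first exact: ltW.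
  by apply: mulr_ge0; [apply: addr_ge0|apply: divr_ge0 => //; lra].
exists (Num.bound (C / e)) => k Kk; have k0 : (0 < k)%N by exact: leq_trans Kk.
apply: (le_lt_trans (mean_har_approx th0 nu0 k0 x01)).
have kt : 0 < k%:R + theta by rewrite ltr_wpDl.
have -> : `|D| / (k%:R + theta) * (1 + theta * ((1 + `|D|) * (x / (1 - x))))
   * - ln (1 - x) = C / (k%:R + theta) by rewrite /C; ring.
rewrite ltr_pdivrMr// mulrC -ltr_pdivrMr//.
have := archi_boundP (divr_ge0 C0 (ltW e0)).
move=> /lt_le_trans; apply; apply: (@le_trans _ _ k%:R).
  by rewrite ler_nat ltnW.
by rewrite lerDl ltW.
Qed.

Lemma alpha_star_log : - ln (1 - (1 - expR (- theta^-1))) = theta^-1 :> R.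
Proof. by rewrite opprB addrC subrK expRK opprK. Qed.

Section sequence_of_roots.
Variable alpha : nat -> R.
Hypothesis alphaP : forall k, (0 < k)%N -> W_root p nu k (alpha k).
Local Notation alpha_star := (1 - expR (- theta^-1)).

Let alpha01 k : (0 < k)%N -> 0 <= alpha k < 1.
Proof. by move=> k0; have /(W_rootE k0)[/andP[/ltW -> ->]] := alphaP k0. Qed.

Let alphaH k : (0 < k)%N -> H k (alpha k) = theta^-1.
Proof.
move=> k0; have /(W_rootE k0)[_ h] := alphaP k0.
by apply: (mulfI (lt0r_neq0 th0)); rewrite h divff ?lt0r_neq0.
Qed.

Lemma alpha_nondecr k l : theta <= nu -> (0 < k)%N -> (k <= l)%N ->
  alpha k <= alpha l.
Proof.
move=> tn k0 kl; have l0 : (0 < l)%N by exact: leq_trans kl.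
apply: (@mean_har_leP l l0) => //; try exact: alpha01.
rewrite (alphaH l0) -(alphaH k0); apply: mean_har_nonincr_le => //.
exact: alpha01.
Qed.

Lemma alpha_nonincr k l : nu < theta -> (0 < k)%N -> (k <= l)%N ->
  alpha l <= alpha k.
Proof.
move=> tn k0 kl; have l0 : (0 < l)%N by exact: leq_trans kl.
apply: (@mean_har_leP l l0) => //; try exact: alpha01.
rewrite (alphaH l0) -(alphaH k0); apply: mean_har_incr_le => //.
exact: alpha01.
Qed.

(** On both sides of alpha^* the limit of H_k is strictly separated from
    1 / theta, and H_k increases. *)
Lemma alpha_cvg : alpha @ \oo --> alpha_star.
Proof.
have ex0 : 0 < expR (- theta^-1) by exact: expR_gt0.
have ex1 : expR (- theta^-1) < 1 by rewrite expR_lt1 oppr_lt0 invr_gt0.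
set a := alpha_star.
have a0 : 0 < a by rewrite /a; lra.
have a1 : a < 1 by rewrite /a; lra.
have alog : - ln (1 - a) = theta^-1 by exact: alpha_star_log.
apply/cvgrPdist_lt => e e0.
have ln_lt x y : x < 1 -> x < y -> y < 1 -> - ln (1 - x) < - ln (1 - y).
  by move=> x1 xy y1; rewrite ltrN2 ltr_ln ?posrE; lra.
have [K1 K1P] : exists K, forall k, (K < k)%N -> alpha k < a + e.
  pose x := a + Num.min e (1 - a) / 2.
  have m0 : 0 < Num.min e (1 - a) by rewrite lt_min e0; lra.
  have me : Num.min e (1 - a) <= e by rewrite ge_min lexx.
  have ma : Num.min e (1 - a) <= 1 - a by rewrite ge_min lexx orbT.
  have x01 : 0 <= x < 1 by rewrite /x; apply/andP; split; lra.
  have gap : 0 < - ln (1 - x) - theta^-1.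
    by rewrite subr_gt0 -alog ln_lt// /x; lra.
  have [K KP] := mean_har_limit x01 gap.
  exists K => k Kk; have k0 : (0 < k)%N by exact: leq_trans Kk.
  apply: (@lt_trans _ _ x); last by rewrite /x; lra.
  apply: (@mean_har_ltP k k0) => //; first exact: alpha01.
  by rewrite (alphaH k0); have := KP _ Kk; rewrite ltr_norml => /andP[]; lra.
have [K2 K2P] : exists K, forall k, (K < k)%N -> a - e < alpha k.
  pose x := a - Num.min e a / 2.
  have m0 : 0 < Num.min e a by rewrite lt_min e0; lra.
  have me : Num.min e a <= e by rewrite ge_min lexx.
  have ma : Num.min e a <= a by rewrite ge_min lexx orbT.
  have x01 : 0 <= x < 1 by rewrite /x; apply/andP; split; lra.
  have gap : 0 < theta^-1 - - ln (1 - x).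
    by rewrite subr_gt0 -alog ln_lt// /x; lra.
  have [K KP] := mean_har_limit x01 gap.
  exists K => k Kk; have k0 : (0 < k)%N by exact: leq_trans Kk.
  apply: (@lt_trans _ _ x); first by rewrite /x; lra.
  apply: (@mean_har_ltP k k0) => //; first exact: alpha01.
  by rewrite (alphaH k0); have := KP _ Kk; rewrite ltr_norml => /andP[]; lra.
near=> k.
have kK1 : (K1 < k)%N by near: k; exists K1.+1.
have kK2 : (K2 < k)%N by near: k; exists K2.+1.
have := K1P _ kK1; have := K2P _ kK2.
by rewrite ltr_norml => h1 h2; apply/andP; split; lra.
Unshelve. all: by end_near. Qed.

(** The error term of [mean_har_approx] has the factor nu - theta. *)
Lemma alpha_const k : nu = theta -> (0 < k)%N -> alpha k = alpha_star.
Proof.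
move=> e k0; have /andP[a0 a1] := alpha01 k0.
have := mean_har_approx th0 nu0 k0 (alpha01 k0).
rewrite (alphaH k0) e subrr normr0 !mul0r normr_le0 addr_eq0 => /eqP ->.
by rewrite opprK lnK ?posrE ?subr_gt0//; ring.
Qed.

End sequence_of_roots.
End Roots.

(** * Real-valued probabilities *)

Section RealProbability.
Context {d : measure_display} {T : measurableType d} {R : realType}.
Variable (P : probability T R).
Implicit Types (X Y : set T).

(** Real values rather than extended ones, so that sums, differences and linear
    arithmetic are available. *)
Definition prob X : R := fine (P X).

Lemma probE X : measurable X -> P X = (prob X)%:E.
Proof. by move=> mX; rewrite /prob fineK// fin_num_measure. Qed.

Lemma prob_ge0 X : 0 <= prob X.
Proof. exact: fine_ge0. Qed.

Lemma prob0 : prob set0 = 0.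
Proof. by rewrite /prob measure0. Qed.

Lemma probT : prob setT = 1.
Proof. by rewrite /prob probability_setT. Qed.

Lemma prob_le X Y : measurable X -> measurable Y -> X `<=` Y ->
  prob X <= prob Y.
Proof.
move=> mX mY XY; rewrite -lee_fin -!probE//.
by apply: le_measure => //; rewrite inE.
Qed.

Lemma probU X Y : measurable X -> measurable Y -> X `&` Y = set0 ->
  prob (X `|` Y) = prob X + prob Y.
Proof.
move=> mX mY XY; apply: EFin_inj; rewrite EFinD -!probE//; last exact: measurableU.
exact: measureU.
Qed.

Lemma probU_le X Y : measurable X -> measurable Y ->
  prob (X `|` Y) <= prob X + prob Y.
Proof.
move=> mX mY; rewrite -lee_fin EFinD -!probE//; last exact: measurableU.
exact: measureU2.
Qed.

Lemma prob_split X Y : measurable X -> measurable Y ->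
  prob X = prob (X `&` Y) + prob (X `\` Y).
Proof.
move=> mX mY; rewrite -probU; first by rewrite setUIDK.
- exact: measurableI.
- exact: measurableD.
- by rewrite setDE setICA -setIA setICr !setI0.
Qed.

Lemma prob_fin (F : finType) (g : T -> F) X : measurable X ->
  (forall t, measurable (g @^-1` [set t])) ->
  prob X = \sum_t prob (X `&` g @^-1` [set t]).
Proof.
move=> mX mg.
have mr (r : seq F) : measurable [set w | g w \in r].
  elim: r => [|t r IH].
    by rewrite (_ : [set _ | _] = set0)//; apply/seteqP; split.
  rewrite (_ : [set _ | _] = g @^-1` [set t] `|` [set w | g w \in r]).
    exact: measurableU.
  apply/seteqP; split=> w /=; rewrite in_cons.
    by move=> /orP[/eqP|]; [left|right].
  by move=> [/eqP ->|->]; rewrite ?orbT.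
suff main (r : seq F) : uniq r -> prob (X `&` [set w | g w \in r]) =
    \sum_(t <- r) prob (X `&` g @^-1` [set t]).
  rewrite -[in RHS]big_enum/= -main ?enum_uniq//; congr prob.
  by apply/seteqP; split=> [w Xw|w []//]; split=> //=; rewrite mem_enum.
elim: r => [_|t r IH /= /andP[tr ur]].
  rewrite big_nil (_ : _ `&` _ = set0) ?prob0//.
  by apply/seteqP; split=> w// [].
rewrite big_cons -IH// -probU; try exact: measurableI.
  congr prob; rewrite -setIUr; congr (_ `&` _).
  apply/seteqP; split=> w /=; rewrite in_cons.
    by move=> /orP[/eqP|]; [left|right].
  by move=> [/eqP ->|->]; rewrite ?orbT.
apply/seteqP; split=> w//= [[_ gt] [_ gr]].
by rewrite -gt gr in tr.
Qed.

Lemma prob_bigcup (F : nat -> set T) : (forall n, measurable (F n)) ->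
  trivIset setT F -> has_sum (fun n => prob (F n)) (prob (\bigcup_n F n)).
Proof.
move=> mF tF.
have cv : (fun n => (\sum_(0 <= i < n) P (F i))%E) @ \oo -->
    (prob (\bigcup_n F n))%:E.
  by rewrite -probE//; [exact: measure_sigma_additive|exact: bigcup_measurable].
move/fine_cvg: cv; rewrite /has_sum.
rewrite (_ : _ \o _ = series (fun n => prob (F n)))//.
apply/funext => n /=; rewrite seriesEnat/=.
by under eq_bigr do rewrite probE//; rewrite sumEFin.
Qed.

Lemma prob_nat (g : T -> nat) X : measurable X ->
  (forall n, measurable (g @^-1` [set n])) ->
  has_sum (fun n => prob (X `&` g @^-1` [set n])) (prob X).
Proof.
move=> mX mg.
rewrite -[X in has_sum _ (prob X)](_ : \bigcup_n (X `&` g @^-1` [set n]) = X).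
  apply: prob_bigcup => [n|]; first exact: measurableI.
  apply/trivIsetP => i j _ _ ij; apply/seteqP; split=> w//= [[_ gi] [_ gj]].
  by rewrite -gi -gj eqxx in ij.
by apply/seteqP; split=> [w [n _ []]|w Xw]//; exists (g w).
Qed.

Lemma prob_le0_subset X Y : measurable X -> measurable Y -> X `<=` Y ->
  prob Y = 0 -> prob X = 0.
Proof.
move=> mX mY XY Y0; apply/eqP; rewrite eq_le prob_ge0 andbT -Y0.
exact: prob_le.
Qed.

End RealProbability.

(** * Means over lists of independent outcomes *)

Section ListExpectation.
Context {R : comNzRingType} {C : finType}.

(** The recursion reveals the outcomes in chronological order, which makes the
    factorization at any index ([list_mean_cat]) immediate and matches the
    way in which [observed_law] reveals the trials. *)
Fixpoint list_mean (w : nat -> C -> R) (m n : nat) (phi : seq C -> R) : R :=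
  if n is n'.+1 then
    \sum_c w m.+1 c * list_mean w m.+1 n' (fun l => phi (c :: l))
  else phi [::].

Lemma eq_list_mean w m n phi psi : phi =1 psi -> list_mean w m n phi = list_mean w m n psi.
Proof.
elim: n m phi psi => [|n IH] m phi psi e /=; first exact: e.
by apply: eq_bigr => c _; congr (_ * _); apply: IH => l; exact: e.
Qed.

Lemma list_meanZ w m n a phi :
  list_mean w m n (fun l => a * phi l) = a * list_mean w m n phi.
Proof.
elim: n m phi => [|n IH] m phi //=.
by rewrite mulr_sumr; apply: eq_bigr => c _; rewrite IH mulrCA.
Qed.

Lemma list_mean0 w m n : list_mean w m n (fun=> 0) = 0.
Proof.
elim: n m => [|n IH] m //=; by rewrite big1// => c _; rewrite IH mulr0.
Qed.

Lemma list_mean_cat w m k j phi psi :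
  list_mean w m (k + j) (fun l => phi (take k l) * psi (drop k l)) =
  list_mean w m k phi * list_mean w (m + k) j psi.
Proof.
elim: k m phi => [|k IH] m phi /=.
  rewrite add0n addn0 -list_meanZ; apply: eq_list_mean => l.
  by rewrite take0 drop0.
rewrite mulr_suml; apply: eq_bigr => c _.
by rewrite (IH _ (fun l => phi (c :: l))) addSnnS mulrA.
Qed.

Lemma list_mean_shift (v : C -> R) i j n f :
  list_mean (fun=> v) i n f = list_mean (fun=> v) j n f.
Proof.
elim: n i j f => [|n IHn] i j f //=.
by apply: eq_bigr => c _; congr (_ * _); exact: IHn.
Qed.

(** For identically distributed entries it does not matter where the k selected ones
    are placed; this is the origin of the binomial coefficient. *)
Lemma list_mean_filter (w : C -> R) (a : pred C) w0 m n (k : nat) (psi : seq C -> bool) :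
  \sum_(c | ~~ a c) w c = w0 ->
  list_mean (fun=> w) m n
    (fun l => ((size [seq c <- l | a c] == k) && psi [seq c <- l | a c])%:R) =
  'C(n, k)%:R * w0 ^+ (n - k) *
  list_mean (fun=> fun c => w c * (a c)%:R) m k (fun l => (psi l)%:R).
Proof.
move=> w0E; elim: n m k psi => [|n IH] m k psi.
  by case: k => [|k] /=; rewrite ?bin0 ?bin0n ?expr0 ?mul1r ?mul0r.
rewrite [LHS]/= (bigID a)/= addrC.
under eq_bigr => c /negbTE ac do rewrite ac IH.
rewrite -mulr_suml w0E.
case: k => [|k].
  rewrite big1 ?addr0; last first.
    by move=> c ac; rewrite (@eq_list_mean _ _ _ _ (fun=> 0)) ?list_mean0 ?mulr0// => l;
      rewrite ac.
  by rewrite /= !bin0 !subn0 !mul1r exprS mulrA.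
under eq_bigr => c ac do rewrite ac/= (IH _ k (fun l => psi (c :: l))).
rewrite binS natrD subSS mulrDl mulrDl; congr (_ + _).
  rewrite mulrA mulrCA; congr (_ * _); last exact: list_mean_shift.
  case: (ltnP k n) => kn; last by rewrite bin_small ?mul0r.
  by congr (_ * _); rewrite -exprS subnSK.
rewrite /= mulr_sumr [RHS](bigID a)/= [X in _ = _ + X]big1 ?addr0; last first.
  by move=> c /negbTE ac; rewrite ac mulr0 mul0r mulr0.
by apply: eq_bigr => c ac; rewrite ac mulr1 mulrCA.
Qed.

End ListExpectation.

Lemma list_mean_pair (R : comNzRingType) (C D : finType) (u : nat -> C -> R)
    (v : nat -> D -> R) m n phi psi :
  list_mean (fun i cd => u i cd.1 * v i cd.2) m n
    (fun l => phi (unzip1 l) * psi (unzip2 l)) =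
  list_mean u m n phi * list_mean v m n psi.
Proof.
elim: n m phi psi => [|n IH] m phi psi //=.
rewrite mulr_suml -(pair_bigA _ (fun c d => u m.+1 c * v m.+1 d *
  list_mean _ m.+1 n (fun l => phi (c :: unzip1 l) * psi (d :: unzip2 l))))/=.
apply: eq_bigr => c _; rewrite mulr_sumr; apply: eq_bigr => d _.
by rewrite (IH _ (fun l => phi (c :: l)) (fun l => psi (d :: l))) mulrACA.
Qed.

(** * Arrival times and outcomes *)

Section Uniform.
Context {R : realType}.

Definition unif (S : set R) : R := fine (uniform_prob (@ltr01 R) S).

Lemma uniform_probE (S : set R) : measurable S ->
  uniform_prob (@ltr01 R) S = lebesgue_measure (S `&` `[0, 1]).
Proof.
move=> mS; rewrite /uniform_prob integral_uniform_pdf.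
rewrite (eq_integral (fun=> 1%E)); last first.
  move=> x; rewrite inE/= in_itv/= => -[_ x01].
  by rewrite /uniform_pdf x01 subr0 invr1.
by rewrite integral_cst ?mul1e//; exact: measurableI.
Qed.

Lemma le_set_measurable (t : R) : measurable [set u : R | u <= t].
Proof.
by rewrite (_ : [set _ | _] = `]-oo, t]%classic).
Qed.

Lemma unif_le (t : R) : 0 <= t <= 1 -> unif [set u | u <= t] = t.
Proof.
move=> /andP[t0 t1]; rewrite /unif uniform_probE; last exact: le_set_measurable.
rewrite (_ : _ `&` _ = `[0, t]%classic).
  rewrite lebesgue_measure_itv/= lte_fin; move: t0.
  by rewrite le_eqVlt => /predU1P[<-|->]; rewrite ?ltxx ?sube0.
apply/seteqP; split=> x; rewrite /= !in_itv/=.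
  by move=> [xt /andP[-> _]].
by move=> /andP[-> xt]; split=> //=; exact: le_trans t1.
Qed.

Lemma unif_oc (a b : R) : 0 <= a -> a <= b -> b <= 1 ->
  unif [set u | a < u <= b] = b - a.
Proof.
move=> a0 ab b1; rewrite /unif uniform_probE; last first.
  by rewrite (_ : [set _ | _] = `]a, b]%classic)//; apply/seteqP; split=> x;
    rewrite /= in_itv.
rewrite (_ : _ `&` _ = `]a, b]%classic).
  rewrite lebesgue_measure_itv/= lte_fin; move: ab.
  by rewrite le_eqVlt => /predU1P[<-|->]; rewrite ?ltxx ?subrr.
apply/seteqP; split=> x; rewrite /= !in_itv/=.
  by move=> [-> _].
move=> /andP[ax xb]; rewrite ax xb; split=> //=; apply/andP; split.
  by rewrite ltW// (le_lt_trans a0).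
exact: le_trans b1.
Qed.

Lemma unif_set1 (a : R) : unif [set a] = 0.
Proof.
rewrite /unif uniform_probE//.
suff -> : lebesgue_measure ([set a] `&` `[0, 1]) = 0%E :> \bar R by [].
apply/eqP; rewrite eq_le measure_ge0 andbT.
apply: (@le_trans _ _ (lebesgue_measure [set a])); last first.
  by rewrite lebesgue_measure_set1.
by apply: le_measure; rewrite ?inE//; exact: measurableI.
Qed.

End Uniform.

Section Model.
Context {R : realType} {p : nat -> R} {nu q : R}.
Variable M : trial_model p nu q.
Local Notation Om := (Omega M).
Local Notation Pb := (prob (Pr M)).
Implicit Types (w : Om) (t : R) (i j k n m : nat).

Lemma N_measurable (A : set nat) : measurable (N M @^-1` A).
Proof. by rewrite -[X in measurable X]setTI; apply: measurable_funP. Qed.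

Lemma U_measurable i (S : set R) : measurable S -> measurable (U M i @^-1` S).
Proof. by move=> mS; rewrite -[X in measurable X]setTI; apply: measurable_funP. Qed.

Lemma B_measurable i (S : set bool) : measurable (B M i @^-1` S).
Proof. by rewrite -[X in measurable X]setTI; apply: measurable_funP. Qed.

Lemma prob_U i (S : set R) : (0 < i)%N -> measurable S ->
  Pb (U M i @^-1` S) = unif S.
Proof. by move=> i0 mS; rewrite /prob /unif -(U_law M i0 mS). Qed.

Lemma prob_N n : Pb (N M @^-1` [set n]) = nb_pmf nu q n.
Proof. by rewrite /prob [X in fine X](N_law M). Qed.

Lemma prob_B i : (0 < i)%N -> Pb (B M i @^-1` [set true]) = p i.
Proof. by move=> i0; rewrite /prob [X in fine X](B_law M i0). Qed.

Lemma prob_Bfalse i : (0 < i)%N -> Pb (B M i @^-1` [set false]) = 1 - p i.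
Proof.
move=> i0; apply/eqP; rewrite eq_sym subr_eq -(prob_B i0) -probU;
  try exact: B_measurable.
  rewrite -(probT (Pr M)); apply/eqP; congr prob; apply/seteqP; split=> w //= _.
  by case: (B M i w); [right|left].
by apply/seteqP; split=> w //= [->].
Qed.

(** The product events on the first m trials to which the independence
    assumption of the model applies. *)
Definition box m (S : nat -> set R) (D : nat -> set bool) : set Om :=
  \bigcap_(i in [set i | (0 < i <= m)%N]) (U M i @^-1` S i `&` B M i @^-1` D i).

Lemma box_measurable m S D : (forall i, measurable (S i)) ->
  measurable (box m S D).
Proof.
move=> mS; apply: bigcap_measurableType => i _.
by apply: measurableI; [exact: U_measurable|exact: B_measurable].
Qed.

Lemma box_indep m (A : set nat) S D : (forall i, measurable (S i)) ->
  Pb (N M @^-1` A `&` box m S D) =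
  Pb (N M @^-1` A) *
  \prod_(1 <= i < m.+1) (Pb (U M i @^-1` S i) * Pb (B M i @^-1` D i)).
Proof.
move=> mS; apply: EFin_inj; rewrite -probE; last first.
  by apply: measurableI; [exact: N_measurable|exact: box_measurable].
rewrite [LHS](NUB_indep M)// EFinM -probE; last exact: N_measurable.
congr (_ * _)%E; rewrite -prodEFin; apply: eq_bigr => i _.
rewrite EFinM -!probE//; [exact: B_measurable|exact: U_measurable].
Qed.

Section observations.
Variables (C : finType) (code : R -> C).
Hypothesis (mcode : forall c, measurable (code @^-1` [set c])).

Definition observed m n w : seq (C * bool) :=
  [seq (code (U M i w), B M i w) | i <- iota m.+1 n].

Definition code_weight c : R := unif (code @^-1` [set c]).
Definition outcome_weight i b : R := Pb (B M i @^-1` [set b]).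

Let ob_measurable i c b :
  measurable ((fun w => (code (U M i w), B M i w)) @^-1` [set (c, b)]).
Proof.
rewrite (_ : _ @^-1` _ = U M i @^-1` (code @^-1` [set c]) `&` B M i @^-1` [set b]).
  by apply: measurableI; [exact: U_measurable|exact: B_measurable].
by apply/seteqP; split=> w /= [-> ->].
Qed.

Lemma observed_measurable m n (phi : pred (seq (C * bool))) :
  measurable [set w | phi (observed m n w)].
Proof.
elim: n m phi => [|n IH] m phi.
  rewrite /observed/=; case: (phi [::]).
    by rewrite (_ : [set _ | _] = setT)//; apply/seteqP; split.
  by rewrite (_ : [set _ | _] = set0)//; apply/seteqP; split.
rewrite (_ : [set _ | _] = \bigcup_(cb in [set: C * bool])
  ((fun w => (code (U M m.+1 w), B M m.+1 w)) @^-1` [set cb] `&`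
    [set w | phi (cb :: observed m.+1 n w)])).
  apply: fin_bigcup_measurable; first exact: finite_finset.
  by move=> [c b] _; apply: measurableI => //; exact: (IH _ (fun l => phi ((c, b) :: l))).
apply/seteqP; split=> w /=.
  by move=> h; exists (code (U M m.+1 w), B M m.+1 w).
by move=> [[c b] _ [/= e]]; rewrite /observed/= e.
Qed.

(** The trials m + 1, ..., m + n are revealed one after another; each revealed pair
    of values enlarges the box by one coordinate. *)
Lemma observed_law m n (A : set nat) S D (phi : pred (seq (C * bool))) :
  (forall i, measurable (S i)) ->
  Pb (N M @^-1` A `&` box m S D `&` [set w | phi (observed m n w)]) =
  Pb (N M @^-1` A) *
  \prod_(1 <= i < m.+1) (Pb (U M i @^-1` S i) * Pb (B M i @^-1` D i)) *
  list_mean (fun i cb => code_weight cb.1 * outcome_weight i cb.2) m n (fun l => (phi l)%:R).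
Proof.
elim: n m S D phi => [|n IH] m S D phi mS.
  rewrite /observed/=; case: (phi [::]).
    by rewrite mulr1 -box_indep//; congr prob; apply/seteqP; split=> w // [].
  rewrite mulr0 (_ : _ `&` _ = set0) ?prob0//.
  by apply/seteqP; split=> w // [].
have mX : measurable (N M @^-1` A `&` box m S D `&` [set w | phi (observed m n.+1 w)]).
  apply: measurableI; last exact: observed_measurable.
  by apply: measurableI; [exact: N_measurable|exact: box_measurable].
rewrite (prob_fin (g := fun w => (code (U M m.+1 w), B M m.+1 w)) _ mX); last first.
  by move=> [c b].
rewrite /= mulr_sumr; apply: eq_bigr => -[c b] _ /=.
pose S' i := if i == m.+1 then code @^-1` [set c] else S i.
pose D' i := if i == m.+1 then [set b] else D i.
have mS' i : measurable (S' i) by rewrite /S'; case: ifP.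
rewrite (_ : _ `&` _ = N M @^-1` A `&` box m.+1 S' D' `&`
    [set w | phi ((c, b) :: observed m.+1 n w)]).
  rewrite (IH _ S' D' (fun l => phi ((c, b) :: l)) mS') big_nat_recr//= !mulrA.
  congr (_ * _); rewrite -!mulrA; congr (_ * _); congr (_ * _).
    rewrite big_nat [RHS]big_nat; apply: eq_bigr => i /andP[_ im].
    by rewrite /S' /D' (ltn_eqF im).
  by rewrite /S' /D' eqxx prob_U.
apply/seteqP; split=> w /=.
- move=> [[[NA r] ph] [eU eB]]; split; last by rewrite /observed/= eU eB in ph.
  split=> // i /= /andP[i0 im]; rewrite /S' /D'; case: eqP => [->//|/eqP ne].
  by apply: r; rewrite /= i0 -ltnS ltn_neqAle ne.
- move=> [[NA r] ph]; have := r m.+1; rewrite /S' /D' /= eqxx => /(_ _)[//|eU eB].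
  split; last by rewrite eU eB.
  split; last by rewrite /observed/= eU eB.
  split=> // i /= /andP[i0 im]; have := r i; rewrite /= i0 (leqW im) => /(_ isT).
  have /ltn_eqF e : (i < m.+1)%N by [].
  by rewrite /S' /D' e.
Qed.

Lemma observed_law0 n (A : set nat) (phi : pred (seq (C * bool))) :
  Pb (N M @^-1` A `&` [set w | phi (observed 0 n w)]) =
  Pb (N M @^-1` A) *
  list_mean (fun i cb => code_weight cb.1 * outcome_weight i cb.2) 0 n (fun l => (phi l)%:R).
Proof.
have := @observed_law 0 n A (fun=> setT) (fun=> setT) phi (fun=> measurableT).
rewrite big_geq// mulr1 => <-; congr prob.
rewrite (_ : box _ _ _ = setT) ?setIT//.
by apply/seteqP; split=> w // _ i /= /andP[]; rewrite leqNgt => ->.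
Qed.

End observations.
End Model.

(** * Epochs and counts *)

Section Epochs.
Context {R : realType} {p : nat -> R} {nu q : R}.
Variable M : trial_model p nu q.
Local Notation Om := (Omega M).
Implicit Types (w : Om) (s t : R) (i j k n m : nat).

Lemma count_uptoE t w :
  count_upto t w = count (fun i => U M i w <= t) (iota 1 (N M w)).
Proof.
rewrite /count_upto -sum1_count [RHS]big_mkcond/= /index_iota subn1/=.
by apply: eq_bigr => i _; case: (_ <= _).
Qed.

Lemma count_upto_le_N t w : (count_upto t w <= N M w)%N.
Proof. by rewrite count_uptoE (leq_trans (count_size _ _))// size_iota. Qed.

Lemma count_upto_homo s t w : s <= t -> (count_upto s w <= count_upto t w)%N.
Proof.
move=> st; rewrite !count_uptoE; apply: sub_count => i /=.
by move=> /le_trans; apply.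
Qed.

Lemma later_successesE k w : later_successes k w =
  count id (drop k [seq B M i w | i <- iota 1 (N M w)]).
Proof.
rewrite /later_successes -map_drop drop_iota count_map -sum1_count.
rewrite [RHS]big_mkcond/= /index_iota add1n subSS.
by apply: eq_bigr => i _ /=; case: (B M i w).
Qed.

Let sorted_epochs w := sort <=%R [seq U M i w | i <- iota 1 (N M w)].

Let sorted_epochsP w : sorted <=%R (sorted_epochs w).
Proof. exact/sort_sorted/le_total. Qed.

Let count_sorted_epochs t w : count (<= t) (sorted_epochs w) = count_upto t w.
Proof. by rewrite count_sort count_map count_uptoE. Qed.

(** Translates epochs into counts, whose joint law with the outcomes is accessible
    without sorting. *)
Lemma epoch_leP k t w : (0 < k)%N -> (k <= N M w)%N ->
  (epoch k w <= t) = (k <= count_upto t w)%N.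
Proof.
move=> k0 kN; apply/idP/idP; last first.
  move=> kc; rewrite /epoch; apply: nth_count_le; first exact: sorted_epochsP.
  by rewrite -/(sorted_epochs w) count_sorted_epochs prednK.
apply: contraLR; rewrite -ltnNge -ltNge => ck.
rewrite /epoch; apply: nth_count_gt; first exact: sorted_epochsP.
rewrite -/(sorted_epochs w) count_sorted_epochs -ltnS prednK// ck/=.
by rewrite size_sort size_map size_iota.
Qed.

Lemma epoch_homo j k w : (0 < j)%N -> (j <= k)%N -> (k <= N M w)%N ->
  epoch j w <= epoch k w.
Proof.
move=> j0 jk kN; have k0 : (0 < k)%N by exact: leq_trans jk.
rewrite epoch_leP//; last exact: leq_trans kN.
by apply: (leq_trans jk); rewrite -epoch_leP.
Qed.

Lemma epoch_mem k w : (0 < k <= N M w)%N ->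
  exists2 i, (0 < i <= N M w)%N & epoch k w = U M i w.
Proof.
move=> /andP[k0 kN].
have : epoch k w \in sorted_epochs w.
  by rewrite mem_nth// size_sort size_map size_iota prednK.
rewrite mem_sort => /mapP[i]; rewrite mem_iota add1n ltnS => iN ->.
by exists i.
Qed.

Lemma epoch_range k w : (0 < k <= N M w)%N -> 0 <= epoch k w <= 1.
Proof. by move=> /epoch_mem[i /andP[i0 _] ->]; exact: U_range w i0. Qed.

Lemma count_upto1 w : count_upto 1 w = N M w.
Proof.
rewrite count_uptoE -[RHS](size_iota 1); apply/eqP; rewrite -all_count.
apply/allP => i; rewrite mem_iota => /andP[i0 _].
by have /andP[] := U_range w i0.
Qed.

End Epochs.

(** * The Markov property at a fixed time *)

Section Codes.
Context {R : realType}.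
Variables (L : seq (nat * R * bool)) (t : R).
Implicit Types (u : R).

Definition code_type := ((size L).-tuple bool * bool)%type.
(** An event of the past only involves finitely many times, so that an arrival may
    be replaced by its position relative to these; finitely many codes allow
    for sums over lists. *)
Definition code u : code_type :=
  ([tuple u <= (tnth (in_tuple L) i).1.2 | i < size L], u <= t).

Lemma le_measurable (s : R) b : measurable [set u : R | (u <= s) = b].
Proof.
case: b; first exact: le_set_measurable.
rewrite (_ : [set _ | _] = ~` [set u : R | u <= s]).
  by apply: measurableC; exact: le_set_measurable.
by apply/seteqP; split=> u /=; [move=> ->|move/negP/negbTE].
Qed.

Lemma code_measurable c : measurable (code @^-1` [set c]).
Proof.
rewrite (_ : _ @^-1` _ = (\bigcap_(i in [set: 'I_(size L)])
  [set u : R | (u <= (tnth (in_tuple L) i).1.2) = tnth c.1 i]) `&`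
  [set u : R | (u <= t) = c.2]).
  apply: measurableI; last exact: le_measurable.
  apply: fin_bigcap_measurable; first exact: finite_finset.
  by move=> i _; exact: le_measurable.
apply/seteqP; split=> u /=.
  by move=> <-; split=> // i _; rewrite /= tnth_mktuple.
case: c => c1 c2 /= [c1E <-]; congr pair.
by apply: eq_from_tnth => i; rewrite tnth_mktuple; exact: c1E.
Qed.

Definition past_cond (l : seq code_type) : bool :=
  [forall i : 'I_(size L),
    ((tnth (in_tuple L) i).1.1 <= count (fun c => tnth c.1 i) l)%N].

Definition bits_cond (bs : seq bool) : bool :=
  all (fun g => g.2 ==> nth false bs g.1.1.-1) L.

End Codes.

Section Markov.
Context {R : realType} {p : nat -> R} {nu q : R}.
Variable M : trial_model p nu q.
Hypotheses (nu0 : 0 < nu) (q01 : 0 < q < 1).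
Local Notation Om := (Omega M).
Local Notation Pb := (prob (Pr M)).
Implicit Types (w : Om) (s t : R) (i j k n m : nat) (Q : pred nat)
  (L : seq (nat * R * bool)).

Definition gen_event (g : nat * R * bool) : set Om :=
  [set w | ((g.1.1 <= count_upto g.1.2 w)%N && (g.2 ==> B M g.1.1 w))].

(** Finite intersections of generators of the history: a pi-system. *)
Definition gens_event (L : seq (nat * R * bool)) : set Om :=
  [set w | all (fun g => (g.1.1 <= count_upto g.1.2 w)%N && (g.2 ==> B M g.1.1 w)) L].

Definition later_mass Q k j : R :=
  list_mean (fun i b => Pb (B M i @^-1` [set b])) k j (fun l => (Q (count id l))%:R).

Definition state_event t k Q : set Om :=
  [set w | count_upto t w = k /\ Q (later_successes k w)].

Let observed_pred (L : seq (nat * R * bool)) k Q (l : seq (code_type L * bool)) : bool :=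
  [&& size [seq c <- unzip1 l | c.2] == k,
      past_cond [seq c <- unzip1 l | c.2],
      bits_cond L (take k (unzip2 l)) & Q (count id (drop k (unzip2 l)))].

(** Given N_t = k, the past is a condition on the codes of the arrivals before t and on
    the first k outcomes, whereas the future is a condition on the other outcomes.
    The arrivals after t only enter through their number. *)
Lemma gens_event_obs L t k Q w :
  (forall g, g \in L -> (0 < g.1.1)%N && (g.1.2 <= t)) ->
  (gens_event L `&` state_event t k Q) w <->
  observed_pred k Q (observed (code L t) 0 (N M w) w).
Proof.
move=> LP.
have u1 : unzip1 (observed (code L t) 0 (N M w) w) =
  [seq code L t (U M i w) | i <- iota 1 (N M w)] by rewrite /unzip1 -map_comp.
have u2 : unzip2 (observed (code L t) 0 (N M w) w) =
  [seq B M i w | i <- iota 1 (N M w)] by rewrite /unzip2 -map_comp.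
rewrite /observed_pred u1 u2 -later_successesE.
have -> : size [seq c <- [seq code L t (U M i w) | i <- iota 1 (N M w)] | c.2] =
    count_upto t w.
  by rewrite size_filter count_map count_uptoE.
have pcE (i : 'I_(size L)) :
    count (fun c : code_type L => tnth c.1 i)
      [seq c <- [seq code L t (U M i w) | i <- iota 1 (N M w)] | c.2] =
    count_upto (tnth (in_tuple L) i).1.2 w.
  rewrite count_filter count_map count_uptoE; apply: eq_count => j /=.
  rewrite tnth_mktuple; apply: andb_idr => /le_trans; apply.
  by have /andP[] := LP _ (mem_tnth i (in_tuple L)).
have kN := count_upto_le_N t w.
split.
- move=> [/allP gL [ck Ql]]; rewrite -{1}ck eqxx Ql andbT/=; apply/andP; split.
    apply/forallP => i; rewrite pcE.
    by have /andP[] := gL _ (mem_tnth i (in_tuple L)).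
  apply/allP => g gLin; have /andP[gc /implyP gB] := gL _ gLin.
  have /andP[g0 gt] := LP _ gLin.
  apply/implyP => /gB Bg.
  have gk : (g.1.1 <= k)%N by rewrite -ck (leq_trans gc)// count_upto_homo.
  have gN : (g.1.1.-1 < N M w)%N by rewrite prednK// (leq_trans gk)// -ck.
  rewrite nth_take ?prednK// (nth_map 0%N) ?size_iota//.
  by rewrite nth_iota// add1n prednK.
- move=> /and4P[/eqP ck /forallP pc /allP bc Ql]; split; last by [].
  apply/allP => g gLin; have /andP[g0 gt] := LP _ gLin.
  have iL : (index g L < size L)%N by rewrite index_mem.
  have gE : tnth (in_tuple L) (Ordinal iL) = g.
    by rewrite (tnth_nth g)/= nth_index.
  have gc : (g.1.1 <= count_upto g.1.2 w)%N.
    by have := pc (Ordinal iL); rewrite pcE gE.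
  rewrite gc; apply/implyP => g2; have := bc _ gLin; rewrite g2/=.
  have gk : (g.1.1 <= k)%N by rewrite -ck (leq_trans gc)// count_upto_homo.
  have gN : (g.1.1.-1 < N M w)%N by rewrite prednK// (leq_trans gk)// -ck.
  rewrite nth_take ?prednK// (nth_map 0%N) ?size_iota//.
  by rewrite nth_iota// add1n prednK.
Qed.

Lemma count_event_measurable t k : measurable [set w : Om | (k <= count_upto t w)%N].
Proof.
rewrite (_ : [set _ | _] = \bigcup_n (N M @^-1` [set n] `&`
  [set w | (k <= count (fun c : bool * bool => c.1)
     (observed (fun u : R => (u <= t)%R) 0 n w))%N])).
  apply: bigcup_measurable => n _; apply: measurableI; first exact: N_measurable.
  apply: (@observed_measurable _ _ _ _ M _ _ _ 0 n (fun l => (k <= count (fun c => c.1) l)%N)).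
  by move=> b; exact: (le_measurable t b).
apply/seteqP; split=> w /=.
  move=> kc; exists (N M w) => //; split=> //=.
  by rewrite /observed count_map -count_uptoE.
by move=> [n _ [/= <-]]; rewrite /observed count_map -count_uptoE.
Qed.

Lemma gen_event_measurable g : measurable (gen_event g).
Proof.
rewrite (_ : gen_event g = [set w | (g.1.1 <= count_upto g.1.2 w)%N] `&`
   (if g.2 then B M g.1.1 @^-1` [set true] else setT)).
  apply: measurableI; first exact: count_event_measurable.
  by case: ifP => // _; exact: B_measurable.
apply/seteqP; split=> w; rewrite /gen_event /=; case: (g.2) => /=.
- by move=> /andP[].
- by move=> /andP[].
- by move=> [-> ->].
- by move=> [->].
Qed.

Lemma gens_event_measurable L : measurable (gens_event L).
Proof.
elim: L => [|g L IH].
  by rewrite (_ : gens_event _ = setT)//; apply/seteqP; split.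
rewrite (_ : gens_event _ = gen_event g `&` gens_event L).
  by apply: measurableI => //; exact: gen_event_measurable.
by apply/seteqP; split=> w; rewrite /gens_event /gen_event /=;
  [move=> /andP[]|move=> [-> ->]].
Qed.

Lemma count_eq_measurable t k : measurable [set w : Om | count_upto t w = k].
Proof.
rewrite (_ : [set _ | _] = [set w | (k <= count_upto t w)%N] `\`
  [set w | (k.+1 <= count_upto t w)%N]).
  by apply: measurableD; exact: count_event_measurable.
apply/seteqP; split=> w /=; first by move=> ->; rewrite leqnn ltnn.
by move=> [kc /negP]; rewrite -leqNgt => ck; apply/eqP; rewrite eqn_leq ck.
Qed.

Lemma later_measurable k Q : measurable [set w : Om | Q (later_successes k w)].
Proof.
rewrite (_ : [set _ | _] = \bigcup_n (N M @^-1` [set n] `&`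
  [set w | Q (count id (drop k (unzip2 (observed (fun=> tt) 0 n w))))])).
  apply: bigcup_measurable => n _; apply: measurableI; first exact: N_measurable.
  apply: (@observed_measurable _ _ _ _ M _ _ _ 0 n
    (fun l => Q (count id (drop k (unzip2 l))))).
  move=> []; rewrite (_ : _ @^-1` _ = setT)//.
  by apply/seteqP; split.
have e w n : unzip2 (observed (fun=> tt) 0 n w) = [seq B M i w | i <- iota 1 n].
  by rewrite /unzip2 -map_comp.
apply/seteqP; split=> w /=.
  by move=> kc; exists (N M w) => //; split=> //=; rewrite e -later_successesE.
by move=> [n _ [/= <-]]; rewrite e -later_successesE.
Qed.

Lemma state_event_measurable t k Q : measurable (state_event t k Q).
Proof.
by apply: measurableI; [exact: count_eq_measurable|exact: later_measurable].
Qed.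

Lemma future_weight L t : 0 <= t <= 1 ->
  \sum_(c : code_type L | ~~ c.2) code_weight (code L t) c = 1 - t.
Proof.
move=> t01.
have mX b : measurable (U M 1 @^-1` [set u : R | (u <= t) = b]).
  by apply: U_measurable; exact: le_measurable.
have X1 : Pb (U M 1 @^-1` [set u : R | (u <= t) = true]) = t.
  by rewrite prob_U//; [exact: unif_le|exact: le_measurable].
have -> : 1 - t = Pb (U M 1 @^-1` [set u : R | (u <= t) = false]).
  apply/eqP; rewrite subr_eq -[X in _ + X]X1 -probU//.
    rewrite -(probT (Pr M)); apply/eqP; congr prob; apply/seteqP; split=> w //= _.
    by case: (_ <= _); [right|left].
  by apply/seteqP; split=> w //= [->].
rewrite (prob_fin (g := fun w => code L t (U M 1 w)) _ (mX false)); last first.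
  move=> c; apply: (@U_measurable _ _ _ _ M 1 (code L t @^-1` [set c])).
  exact: code_measurable.
rewrite [RHS](bigID (fun c => c.2))/= [X in _ = X + _]big1 ?add0r; last first.
  move=> c c2; rewrite (_ : _ `&` _ = set0) ?prob0//.
  by apply/seteqP; split=> w //= [+ ce]; move: c2; rewrite -ce/= => ->.
apply: eq_bigr => c c2; rewrite /code_weight -(prob_U M (i := 1))//; last first.
  exact: code_measurable.
congr prob; apply/seteqP; split=> w /=; last by case.
by move=> ce; split=> //; move: c2; rewrite -ce/= => /negbTE.
Qed.

(** The constant depends on the past event but neither on n nor on the
    future event Q; this is the factorization behind the Markov property. *)
Lemma joint_law L t k :
  (forall g, g \in L -> (0 < g.1.1)%N && (g.1.2 <= t)) -> 0 <= t <= 1 ->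
  exists Th : R, forall n Q,
    Pb (gens_event L `&` state_event t k Q `&` N M @^-1` [set n]) =
    Th * (nb_pmf nu q n * 'C(n, k)%:R * (1 - t) ^+ (n - k) *
          later_mass Q k (n - k)).
Proof.
move=> LP t01.
pose ThU := list_mean (fun=> fun c => code_weight (code L t) c * (c.2)%:R) 0 k
  (fun l => (past_cond l)%:R).
pose ThB := list_mean (outcome_weight M) 0 k (fun l => (bits_cond L l)%:R).
exists (ThU * ThB) => n Q.
rewrite (_ : _ `&` _ = N M @^-1` [set n] `&`
   [set w | observed_pred k Q (observed (code L t) 0 n w)]); last first.
  apply/seteqP; split=> w /=.
    by move=> [/gens_event_obs -/(_ LP) + <-].
  move=> [<- /gens_event_obs h]; split=> //; exact: h.
rewrite (@observed_law0 _ _ _ _ M _ _ (@code_measurable R L t)).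
rewrite prob_N.
have -> : list_mean (fun i (cb : code_type L * bool) =>
      code_weight (code L t) cb.1 * outcome_weight M i cb.2)
    0 n (fun l => (observed_pred k Q l)%:R) =
  list_mean (fun=> code_weight (code L t)) 0 n (fun l =>
    ((size [seq c <- l | c.2] == k) && past_cond [seq c <- l | c.2])%:R) *
  list_mean (outcome_weight M) 0 n (fun l => (bits_cond L (take k l))%:R *
    (Q (count id (drop k l)))%:R).
  rewrite -list_mean_pair; apply: eq_list_mean => l.
  by rewrite /observed_pred -!natrM !mulnb -andbA.
rewrite (@list_mean_filter _ _ _ (fun c => c.2) _ _ _ _ _ (future_weight L t01)).
case: (leqP k n) => [kn|nk]; last by rewrite bin_small// !(mulr0, mul0r).
have -> : list_mean (outcome_weight M) 0 n (fun l => (bits_cond L (take k l))%:R *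
    (Q (count id (drop k l)))%:R) = ThB * later_mass Q k (n - k).
  have := list_mean_cat (outcome_weight M) 0 k (n - k) (fun l => (bits_cond L l)%:R)
    (fun l => (Q (count id l))%:R).
  by rewrite subnKC// add0n.
rewrite -/ThU; ring.
Qed.

Lemma nb_pmf_gt0 n : 0 < nb_pmf nu q n.
Proof.
have /andP[q0 q1] := q01; rewrite /nb_pmf mulr_gt0 ?exprn_gt0//.
rewrite mulr_gt0 ?powR_gt0 ?subr_gt0// divr_gt0 ?ltr0n ?fact_gt0//.
exact: pochhammer_gt0.
Qed.

Lemma state_law t k : 0 < t <= 1 ->
  exists2 Th : R, 0 < Th & forall n Q,
    Pb (state_event t k Q `&` N M @^-1` [set n]) =
    Th * (nb_pmf nu q n * 'C(n, k)%:R * (1 - t) ^+ (n - k) *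
          later_mass Q k (n - k)).
Proof.
move=> /andP[t0 t1].
have t01 : 0 <= t <= 1 by rewrite ltW.
have [//|Th ThP] := @joint_law [::] t k _ t01.
have ThP' n Q : Pb (state_event t k Q `&` N M @^-1` [set n]) =
    Th * (nb_pmf nu q n * 'C(n, k)%:R * (1 - t) ^+ (n - k) *
          later_mass Q k (n - k)).
  rewrite -ThP; congr prob.
  by apply/seteqP; split=> w; [move=> [? ?]|move=> [[_ ?] ?]].
exists Th => //.
have := ThP' k predT.
rewrite binn subnn expr0 /later_mass !mulr1 => e.
suff : 0 < Th * nb_pmf nu q k by rewrite pmulr_lgt0// nb_pmf_gt0.
rewrite -e; pose S := fun i : nat => [set u : R | u <= t].
have mS i : measurable (S i) by exact: le_set_measurable.
apply: (@lt_le_trans _ _ (Pb (N M @^-1` [set k] `&` box k S (fun=> setT)))).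
  rewrite box_indep// prob_N mulr_gt0 ?nb_pmf_gt0//.
  rewrite big_nat; apply: prodr_gt0 => i /andP[i0 _].
  rewrite prob_U// unif_le// preimage_setT probT mulr1//.
apply: prob_le.
- by apply: measurableI; [exact: N_measurable|exact: box_measurable].
- by apply: measurableI; [exact: state_event_measurable|exact: N_measurable].
move=> w [Nk r]; split=> //; split=> //.
rewrite count_uptoE -[RHS](size_iota 1) Nk; apply/eqP; rewrite -all_count.
apply/allP => i; rewrite mem_iota add1n ltnS => ik.
by have [] := r i ik.
Qed.

End Markov.

Section History.
Context {R : realType} {p : nat -> R} {nu q : R}.
Variable M : trial_model p nu q.
Hypotheses (nu0 : 0 < nu) (q01 : 0 < q < 1).
Local Notation Om := (Omega M).
Local Notation Pb := (prob (Pr M)).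
Local Notation F := (@history R p nu q M).
Implicit Types (w : Om) (s t : R) (i j k n m : nat) (Q : pred nat)
  (L : seq (nat * R * bool)) (E G : set Om).

Lemma state_event_sum E t k Q : measurable E ->
  has_sum (fun n => Pb (E `&` state_event t k Q `&` N M @^-1` [set n]))
    (Pb (E `&` state_event t k Q)).
Proof.
move=> mE; apply: prob_nat; last by move=> n; exact: N_measurable.
by apply: measurableI => //; exact: state_event_measurable.
Qed.

(** By [joint_law] and [state_law] the probabilities with and without the past event are
    sums of proportional series, with a factor independent of Q. *)
Lemma markov_gens L t k Q : 0 < t <= 1 ->
  (forall g, g \in L -> (0 < g.1.1)%N && (g.1.2 <= t)) ->
  Pb (gens_event L `&` state_event t k Q) * Pb (state_event t k predT) =
  Pb (gens_event L `&` state_event t k predT) * Pb (state_event t k Q).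
Proof.
move=> t01 LP.
have t01' : 0 <= t <= 1 by case/andP: t01 => /ltW -> ->.
have [Th0 Th00 Th0P] := state_law M nu0 q01 k t01.
have [Th ThP] := joint_law M k LP t01'.
have key Q' : Pb (gens_event L `&` state_event t k Q') =
    Th * (Th0^-1 * Pb (state_event t k Q')).
  have s1 := @state_event_sum _ t k Q' (gens_event_measurable M L).
  have s2 := @state_event_sum setT t k Q' measurableT.
  have s3 : has_sum (fun n => Pb (state_event t k Q' `&` N M @^-1` [set n]))
      (Pb (state_event t k Q')).
    by have := s2; rewrite setTI.
  apply: has_sum_unique s1 (eq_has_sum _ (has_sumM Th (has_sumM Th0^-1 s3))) => n /=.
  by rewrite Th0P ThP mulKf ?lt0r_neq0.
by rewrite !key; ring.
Qed.

Let pi_system t : set (set Om) :=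
  [set E | exists2 L, (forall g, g \in L -> (0 < g.1.1)%N && (g.1.2 <= t)) &
     E = gens_event L].

Let pi_systemI t : setI_closed (pi_system t).
Proof.
move=> _ _ [L LP ->] [L' LP' ->]; exists (L ++ L').
  by move=> g; rewrite mem_cat => /orP[/LP|/LP'].
by apply/seteqP; split=> w; rewrite /gens_event /= all_cat;
  [move=> [-> ->]|move=> /andP[]].
Qed.

Let history_pi_system t E : F t E -> <<s pi_system t>> E.
Proof.
apply: smallest_sub; first exact: smallest_sigma_algebra.
move=> _ [k [s [k0 st [->|->]]]]; apply: sub_sigma_algebra.
- exists [:: (k, s, false)].
    by move=> g; rewrite inE => /eqP -> /=; rewrite k0.
  apply/seteqP; split=> w; rewrite /gens_event /= !andbT.
    by move=> [kN]; rewrite epoch_leP.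
  move=> kc; have kN : (k <= N M w)%N by exact: leq_trans (count_upto_le_N s w).
  by split=> //; rewrite epoch_leP.
- exists [:: (k, s, true)].
    by move=> g; rewrite inE => /eqP -> /=; rewrite k0.
  apply/seteqP; split=> w; rewrite /gens_event /= !andbT.
    by move=> [kN]; rewrite epoch_leP// => -> ->.
  move=> /andP[kc Bk].
  have kN : (k <= N M w)%N by exact: leq_trans (count_upto_le_N s w).
  by split=> //; rewrite epoch_leP.
Qed.

Let markov_set t k Q : set (set Om) :=
  [set E | measurable E /\ Pb (E `&` state_event t k Q) * Pb (state_event t k predT) =
  Pb (E `&` state_event t k predT) * Pb (state_event t k Q)].

Let state_measurable t k Q : measurable (state_event t k Q : set Om).
Proof. exact: state_event_measurable. Qed.

Let markov_set_dynkin t k Q : dynkin (markov_set t k Q).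
Proof.
split.
- by split=> //; rewrite !setTI mulrC.
- move=> E [mE hE]; split; first exact: measurableC.
  have e Q' : Pb (~` E `&` state_event t k Q') =
      Pb (state_event t k Q') - Pb (E `&` state_event t k Q').
    rewrite (prob_split (Y := E) _ (state_measurable t k Q') mE).
    by rewrite (setIC E) setDE (setIC (~` E)) addrC addKr.
  by rewrite !e !mulrBl hE (mulrC (Pb (state_event t k Q))).
- move=> G tG hG; split; first by apply: bigcup_measurable => n _; have [] := hG n.
  have s Q' : has_sum (fun n => Pb (G n `&` state_event t k Q'))
      (Pb ((\bigcup_n G n) `&` state_event t k Q')).
    rewrite setI_bigcupl; apply: prob_bigcup.
      by move=> n; apply: measurableI => //; have [] := hG n.
    by apply: trivIset_setIr.
  have s1 := has_sumM (Pb (state_event t k predT)) (s Q).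
  have s2 := has_sumM (Pb (state_event t k Q)) (s predT).
  rewrite mulrC [RHS]mulrC; apply: has_sum_unique s1 (eq_has_sum _ s2) => n /=.
  by rewrite mulrC; have [_ <-] := hG n; rewrite mulrC.
Qed.

(** Dynkin's lemma for the pi-system of [gens_event]: both sides of the cross-multiplied
    identity are finite measures as functions of E. *)
Lemma history_markov_set t k Q E : 0 < t <= 1 -> F t E -> markov_set t k Q E.
Proof.
move=> t01 /history_pi_system; apply: lambda_system_subset => //.
- exact/dynkin_lambda_system/markov_set_dynkin.
- move=> _ [L LP ->]; split; first exact: gens_event_measurable.
  exact: markov_gens.
Qed.

Lemma history_measurable t E : 0 <= t <= 1 -> F t E -> measurable E.
Proof.
move=> t01; apply: smallest_sub; first exact: sigma_algebra_measurable.
have m k s (k0 : (0 < k)%N) b : measurable (gen_event (k, s, b) : set Om).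
  exact: gen_event_measurable.
move=> _ [k [s [k0 st [->|->]]]].
- rewrite (_ : [set _ | _] = gen_event (k, s, false)); first exact: m.
  apply/seteqP; split=> w; rewrite /gen_event /= !andbT.
    by move=> [kN]; rewrite epoch_leP.
  move=> kc; have kN : (k <= N M w)%N by exact: leq_trans (count_upto_le_N s w).
  by split=> //; rewrite epoch_leP.
- rewrite (_ : [set _ | _] = gen_event (k, s, true)); first exact: m.
  apply/seteqP; split=> w; rewrite /gen_event /=.
    by move=> [kN]; rewrite epoch_leP// => -> ->.
  move=> /andP[kc Bk].
  have kN : (k <= N M w)%N by exact: leq_trans (count_upto_le_N s w).
  by split=> //; rewrite epoch_leP.
Qed.

Lemma S_condE t k i : S_cond M i t k =
  Pb (state_event t k (pred1 i)) / Pb (state_event t k predT).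
Proof.
rewrite /S_cond /prob; congr (fine (Pr M _) / fine (Pr M _)).
  by apply/seteqP; split=> w; [move=> [? /eqP]|move=> [? /eqP]].
by apply/seteqP; split=> w; [|move=> []].
Qed.

Lemma markov t k i E : 0 < t <= 1 -> F t E ->
  Pb (E `&` state_event t k (pred1 i)) =
  Pb (E `&` state_event t k predT) * S_cond M i t k.
Proof.
move=> t01 FE.
have [mE e] := @history_markov_set t k (pred1 i) E t01 FE.
have [Z0|Z0] := eqVneq (Pb (state_event t k predT)) 0.
  have z Q : Pb (E `&` state_event t k Q) = 0.
    apply: prob_le0_subset Z0; [exact: measurableI|exact: state_measurable|].
    by move=> w [_ []].
  by rewrite !z mul0r.
by rewrite S_condE mulrA -e mulfK.
Qed.

End History.

(** * Events decided at an epoch *)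

Section Past.
Context {R : realType} {p : nat -> R} {nu q : R}.
Variable M : trial_model p nu q.
Local Notation Om := (Omega M).
Local Notation F := (@history R p nu q M).
Implicit Types (w : Om) (s t : R) (i j k n m : nat) (E G : set Om).

Let history_sigma_algebra t : sigma_algebra setT (F t).
Proof. exact: smallest_sigma_algebra. Qed.

Lemma historyT t : F t setT.
Proof.
by have [h0 hC _] := history_sigma_algebra t; have := hC _ h0; rewrite setD0.
Qed.

Lemma historyC t E : F t E -> F t (~` E).
Proof. by rewrite -setTD; have [_ + _] := history_sigma_algebra t; exact. Qed.

Lemma history_bigcup t (G : nat -> set Om) : (forall n, F t (G n)) ->
  F t (\bigcup_n G n).
Proof. by have [_ _] := history_sigma_algebra t; exact. Qed.

Lemma history0 t : F t set0.
Proof. by rewrite -setCT; apply: historyC; exact: historyT. Qed.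

Lemma historyU t E G : F t E -> F t G -> F t (E `|` G).
Proof.
move=> FE FG; rewrite -bigcup2E; apply: history_bigcup => -[|[|n]] //=.
exact: history0.
Qed.

Lemma historyI t E G : F t E -> F t G -> F t (E `&` G).
Proof.
move=> FE FG; rewrite -[E]setCK -[G]setCK -setCU; apply: historyC.
by apply: historyU; exact: historyC.
Qed.

Lemma historyD t E G : F t E -> F t G -> F t (E `\` G).
Proof. by move=> FE FG; rewrite setDE; apply: historyI => //; exact: historyC. Qed.

Lemma history_homo s t E : s <= t -> F s E -> F t E.
Proof.
move=> st; apply: smallest_sub; first exact: smallest_sigma_algebra.
move=> A [k [r [k0 rs AE]]]; apply: sub_sigma_algebra.
by exists k, r; split=> //; exact: le_trans st.
Qed.

Lemma history_count k s t : (0 < k)%N -> s <= t ->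
  F t [set w | (k <= count_upto s w)%N].
Proof.
move=> k0 st; apply: sub_sigma_algebra; exists k, s; split=> //; left.
apply/seteqP; split=> w /=; last by move=> [kN]; rewrite epoch_leP.
move=> kc; have kN : (k <= N M w)%N by exact: leq_trans (count_upto_le_N s w).
by split=> //; rewrite epoch_leP.
Qed.

Lemma history_count_success k s t : (0 < k)%N -> s <= t ->
  F t [set w | (k <= count_upto s w)%N /\ B M k w].
Proof.
move=> k0 st; apply: sub_sigma_algebra; exists k, s; split=> //; right.
apply/seteqP; split=> w /=; last by move=> [kN]; rewrite epoch_leP.
move=> [kc Bk]; have kN : (k <= N M w)%N by exact: leq_trans (count_upto_le_N s w).
by split=> //; rewrite epoch_leP.
Qed.

(** The trace on N >= k of the sigma-algebra of the random time T_k, described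
    through the deterministic times t. *)
Definition past k G :=
  G `<=` [set w | (k <= N M w)%N] /\
  forall t, 0 <= t <= 1 -> F t (G `&` [set w | (k <= count_upto t w)%N]).

Lemma past_measurable k G : past k G -> measurable G.
Proof.
move=> [GN GF]; have h01 : 0 <= (1 : R) <= 1 by rewrite ler01 lexx.
have := history_measurable h01 (GF 1 h01).
rewrite (_ : _ `&` _ = G)//; apply/seteqP; split=> w; first by case.
by move=> Gw; split=> //=; rewrite count_upto1; exact: GN.
Qed.

Section fixed_k.
Variable k : nat.
Hypothesis k0 : (0 < k)%N.

Lemma past_exists : past k [set w | (k <= N M w)%N].
Proof.
split=> // t t01; rewrite (_ : _ `&` _ = [set w | (k <= count_upto t w)%N]).
  exact: history_count.
apply/seteqP; split=> w; first by case.
by move=> kc; split=> //=; exact: leq_trans (count_upto_le_N t w).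
Qed.

Lemma past_success : past k [set w | (k <= N M w)%N /\ B M k w].
Proof.
split=> [w []//|t t01].
rewrite (_ : _ `&` _ = [set w | (k <= count_upto t w)%N /\ B M k w]).
  exact: history_count_success.
apply/seteqP; split=> w /=; first by move=> [[]].
by move=> [kc Bk]; split=> //; split=> //; exact: leq_trans (count_upto_le_N t w).
Qed.

Lemma past_le a : past k [set w | (k <= N M w)%N /\ epoch k w <= a].
Proof.
split=> [w []//|t t01].
rewrite (_ : _ `&` _ = [set w | (k <= count_upto (Num.min a t) w)%N]).
  by apply: history_count => //; rewrite ge_min lexx orbT.
apply/seteqP; split=> w /=.
  move=> [[kN ka] kc]; rewrite -epoch_leP// le_min ka epoch_leP//.
move=> kc.
have kN : (k <= N M w)%N by exact: leq_trans (count_upto_le_N (Num.min a t) w).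
by move: kc; rewrite -epoch_leP// le_min => /andP[ka kt]; split=> //; rewrite -epoch_leP.
Qed.

Lemma past_bigcup (G : nat -> set Om) : (forall n, past k (G n)) ->
  past k (\bigcup_n G n).
Proof.
move=> pG; split=> [w [n _]|t t01]; first by have [+ _] := pG n; exact.
by rewrite setI_bigcupl; apply: history_bigcup => n; have [_] := pG n; exact.
Qed.

Lemma pastI G E : past k G -> past k E -> past k (G `&` E).
Proof.
move=> [GN GF] [EN EF]; split=> [w [/GN]//|t t01].
rewrite (_ : _ `&` _ = (G `&` [set w | (k <= count_upto t w)%N]) `&`
  (E `&` [set w | (k <= count_upto t w)%N])).
  by apply: historyI; [exact: GF|exact: EF].
by rewrite setIACA setIid.
Qed.

Lemma pastD G E : past k G -> past k E -> past k (G `\` E).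
Proof.
move=> [GN GF] [EN EF]; split=> [w [/GN]//|t t01].
rewrite (_ : _ `&` _ = (G `&` [set w | (k <= count_upto t w)%N]) `\`
  (E `&` [set w | (k <= count_upto t w)%N])).
  by apply: historyD; [exact: GF|exact: EF].
apply/seteqP; split=> w /=; first by move=> [[Gw Ew] kc]; split=> // -[].
by move=> [[Gw kc] n]; split=> //; split=> // Ew; apply: n.
Qed.

Lemma past_lt a : past k [set w | (k <= N M w)%N /\ epoch k w < a].
Proof.
rewrite (_ : [set _ | _] =
  \bigcup_n [set w | (k <= N M w)%N /\ epoch k w <= a - n.+1%:R^-1]).
  by apply: past_bigcup => n; exact: past_le.
apply/seteqP; split=> w /=.
  move=> [kN ka].
  have [n] := ltr_add_invr ka; rewrite -ltrBrDr => kn.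
  by exists n => //; split=> //; exact: ltW.
move=> [n _ [kN ka]]; split=> //; apply: (le_lt_trans ka).
by rewrite ltrBlDr ltrDl invr_gt0.
Qed.

(** If T_k < sigma and T_k <= t, then some time r <= t, rational or t itself,
    satisfies T_k <= r < sigma, and both conditions on r are decided by r. *)
Lemma past_before sigma : stopping_strategy sigma ->
  past k [set w | (k <= N M w)%N /\ epoch k w < sigma w].
Proof.
move=> [ms vs hs]; split=> [w []//|t t01]; have /andP[t0 t1] := t01.
(* Rational times cut off to the interval [0, t], and t itself for n = 0. *)
pose r n : R := if n is m.+1 then
  (if @unpickle rat m is Some x then Num.max 0 (Num.min t (ratr x)) else t) else t.
have r01 n : 0 <= r n <= t.
  rewrite /r; case: n => [|m]; first by rewrite t0 lexx.
  case: unpickle => [x|]; last by rewrite t0 lexx.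
  by rewrite le_max lexx ge_max t0 ge_min lexx.
rewrite (_ : _ `&` _ = \bigcup_n ([set w | (k <= count_upto (r n) w)%N] `\`
   [set w | sigma w <= r n])).
  apply: history_bigcup => n; have /andP[rn0 rnt] := r01 n; apply: historyD.
    exact: history_count.
  by apply: (history_homo rnt); apply: hs; rewrite rn0 (le_trans rnt).
apply/seteqP; split=> w /=.
  move=> [[kN ks] kc].
  have [st|ts] := leP (sigma w) t; last first.
    by exists 0%N => //=; split=> //; apply/negP; rewrite -ltNge.
  have [x] := rat_in_itvoo ks; rewrite in_itv/= => /andP[kx xs].
  have /andP[k00 _] := epoch_range (M := M) (k := k) (w := w) (introT andP (conj k0 kN)).
  have rE : r (pickle x).+1 = ratr x.
    rewrite /r pickleK min_r; last exact: ltW (lt_le_trans xs st).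
    by rewrite max_r// (le_trans k00)// ltW.
  exists (pickle x).+1 => //; rewrite rE; split.
    by rewrite /= -epoch_leP// ltW.
  by apply/negP; rewrite -ltNge.
move=> [n _ [kc /negP]]; rewrite -ltNge => rs.
have kN : (k <= N M w)%N by exact: leq_trans (count_upto_le_N (r n) w).
have /andP[_ rt] := r01 n.
split; first split=> //; first by rewrite (le_lt_trans _ rs)// epoch_leP.
by apply: (leq_trans kc); exact: count_upto_homo.
Qed.

End fixed_k.
End Past.

(** * From fixed times to epochs *)

Section Coincidences.
Context {R : realType} {p : nat -> R} {nu q : R}.
Variable M : trial_model p nu q.
Local Notation Om := (Omega M).
Local Notation Pb := (prob (Pr M)).
Implicit Types (w : Om) (s t : R) (i j k n m : nat) (E G : set Om).

Lemma prob_union_bound (I : Type) (r : seq I) (H : I -> set Om) E :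
  measurable E -> (forall x, measurable (H x)) ->
  (forall w, E w -> has (fun x => `[< H x w >]) r) ->
  Pb E <= \sum_(x <- r) Pb (H x).
Proof.
move=> mE mH; elim: r E mE => [|x r IH] E mE EH.
  rewrite big_nil (_ : E = set0) ?prob0//.
  by apply/seteqP; split=> w // /EH.
rewrite big_cons (prob_split _ mE (mH x)); apply: lerD.
  by apply: prob_le; [exact: measurableI|exact: mH|move=> w []].
apply: IH; first exact: measurableD.
by move=> w [/EH/= /orP[/asboolP//|]].
Qed.

Lemma pair_indep i j (S S' : set R) : (0 < i)%N -> (i < j)%N ->
  measurable S -> measurable S' ->
  Pb (U M i @^-1` S `&` U M j @^-1` S') = unif S * unif S'.
Proof.
move=> i0 ij mS mS'.
pose T x := if x == i then S else if x == j then S' else setT.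
have mT x : measurable (T x) by rewrite /T; case: ifP => // _; case: ifP.
have := @box_indep _ _ _ _ M j setT T (fun=> setT) mT.
rewrite preimage_setT setTI probT mul1r.
rewrite (_ : box _ _ _ = U M i @^-1` S `&` U M j @^-1` S'); last first.
  apply/seteqP; split=> w.
    move=> h; split.
      by have [] := h i; rewrite /= ?i0 ?(ltnW ij)// /T eqxx.
    have [] := h j; rewrite /= ?leqnn ?(leq_trans i0 (ltnW ij))// /T eqxx.
    by rewrite gtn_eqF.
  move=> [Si Sj] x /= _; split=> //; rewrite /T.
  by case: eqP => [->//|_]; case: eqP => [->|].
move=> ->.
rewrite (bigD1_seq i) ?iota_uniq//=; last by rewrite mem_index_iota i0 ltnS ltnW.
rewrite (big_rem j)/=; last first.
  by rewrite mem_index_iota ltnS leqnn andbT; exact: leq_trans (ltnW ij).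
rewrite (gtn_eqF ij)/= big1_seq.
  rewrite !mulr1 /T eqxx (gtn_eqF ij) eqxx.
  by rewrite !prob_U//; exact: leq_trans (ltnW ij).
move=> x /andP[xi]; rewrite mem_rem_uniq ?iota_uniq//= inE => /andP[xj].
rewrite mem_index_iota => /andP[x0 _].
by rewrite mulr1 /T (negbTE xi) (negbTE xj) preimage_setT probT.
Qed.

Definition two_in n (S : set R) : set Om :=
  [set w | exists i j, [/\ (0 < i)%N, (i < j)%N, (j <= n)%N, S (U M i w) & S (U M j w)]].

Lemma two_in_measurable n S : measurable S -> measurable (two_in n S).
Proof.
move=> mS.
rewrite (_ : two_in n S = \bigcup_i \bigcup_j
  (if [&& (0 < i)%N, (i < j)%N & (j <= n)%N]
   then U M i @^-1` S `&` U M j @^-1` S else set0)).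
  do 2! apply: bigcup_measurable => ? _; case: ifP => // _.
  by apply: measurableI; exact: U_measurable.
apply/seteqP; split=> w.
  move=> [i [j [i0 ij jn Si Sj]]]; exists i => //; exists j => //.
  by rewrite i0 ij jn.
move=> [i _ [j _]]; case: ifP => // /and3P[i0 ij jn] [Si Sj].
by exists i, j.
Qed.

(** Quadratic in the mass of S, so that a sum over the cells of a fine grid is
    small. *)
Lemma prob_two_in n S : measurable S ->
  Pb (two_in n S) <= n.+1%:R ^+ 2 * unif S ^+ 2.
Proof.
move=> mS.
pose H (x : 'I_n.+1 * 'I_n.+1) : set Om :=
  if (0 < x.1)%N && (x.1 < x.2)%N then U M x.1 @^-1` S `&` U M x.2 @^-1` S else set0.
have mH x : measurable (H x).
  by rewrite /H; case: ifP => // _; apply: measurableI; exact: U_measurable.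
apply: (le_trans (@prob_union_bound _ (enum [set: 'I_n.+1 * 'I_n.+1]%SET) H _ _ mH _)).
- exact: two_in_measurable.
- move=> w [i [j [i0 ij jn Si Sj]]]; apply/hasP.
  have jn' : (j < n.+1)%N by [].
  have in' : (i < n.+1)%N by exact: ltn_trans jn'.
  exists (Ordinal in', Ordinal jn'); first by rewrite mem_enum inE.
  by apply/asboolP; rewrite /H /= i0 ij.
apply: (@le_trans _ _ (\sum_(x : 'I_n.+1 * 'I_n.+1) unif S ^+ 2)).
  rewrite big_enum/= big_mkcond/=; apply: ler_sum => x _; rewrite inE.
  rewrite /H; case: ifP => [/andP[x0 xx]|_].
    by rewrite pair_indep// expr2.
  by rewrite prob0 exprn_even_ge0.
by rewrite sumr_const card_prod card_ord -[X in X <= _]mulr_natl natrM -expr2.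
Qed.

(** At most k - 1 arrivals up to a and at least k + 1 up to b leave two in between. *)
Lemma two_epochs_in_cell k a b w : (0 < k)%N -> (k <= N M w)%N ->
  a < epoch k w -> (k < count_upto b w)%N ->
  two_in (N M w) [set u | a < u <= b] w.
Proof.
move=> k0 kN ak kb.
have ka : (count_upto a w < k)%N.
  by rewrite ltnNge -epoch_leP// -ltNge.
pose s := [seq i <- iota 1 (N M w) | a < U M i w <= b].
have ab : a <= b.
  rewrite leNgt; apply/negP => /ltW ba.
  have := count_upto_homo w ba; rewrite leqNgt => /negP; apply.
  exact: ltn_trans kb.
have s2 : (1 < size s)%N.
  have e : (count_upto b w = count_upto a w + size s)%N.
    rewrite !count_uptoE size_filter.
    elim: (iota 1 (N M w)) => //= i l ->; rewrite ltNge.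
    have [ia|ia] /= := leP (U M i w) a; first by rewrite (le_trans ia ab) addnA.
    by case: (_ <= b) => //=; lia.
  move: kb; rewrite e; lia.
have srt : sorted ltn s by apply: sorted_filter (iota_ltn_sorted _ _); exact: ltn_trans.
have sub i : i \in s -> [/\ (0 < i)%N, (i <= N M w)%N & a < U M i w <= b].
  by rewrite mem_filter mem_iota add1n ltnS => /andP[? /andP[? ?]].
move: s2 srt sub; case: s => [//|i [//|j s]] _ /= /andP[ij _] sub.
have [i0 _ Si] := sub i (mem_head _ _).
have [_ jn Sj] := sub j (mem_behead (s := [:: i, j & s]) (mem_head _ _)).
by exists i, j.
Qed.

Lemma N_tail (e : R) : 0 < e ->
  exists n, Pb [set w : Om | (n < N M w)%N] < e.
Proof.
move=> e0.
have := @prob_nat _ _ _ (Pr M) (N M) setT measurableT (fun n => N_measurable M [set n]).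
rewrite probT => s.
have /cvgrPdist_lt/(_ _ e0)[n _ ne] := s.
exists n; have := ne n (leqnn n).
rewrite seriesEnat/=.
have -> : \sum_(0 <= j < n) Pb (setT `&` N M @^-1` [set j]) =
    Pb [set w : Om | (N M w < n)%N].
  elim: (n) => [|l IH].
    by rewrite big_geq// (_ : [set _ | _] = set0) ?prob0//; apply/seteqP; split.
  rewrite big_nat_recr//= IH setTI -probU.
  - congr prob; apply/seteqP; split=> w /=.
      by move=> [/ltnW|->]; rewrite ltnS.
    by rewrite ltnS leq_eqVlt => /orP[/eqP|]; [right|left].
  - exact: (N_measurable M [set j | (j < l)%N]).
  - exact: N_measurable.
  - by apply/seteqP; split=> w //= [+ Nl]; rewrite Nl ltnn.
apply: le_lt_trans.
have -> : 1 = Pb [set w : Om | (N M w < n)%N] + Pb [set w : Om | (n <= N M w)%N].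
  rewrite -probU.
  - rewrite -(probT (Pr M)); congr prob; apply/seteqP; split=> w //= _.
    by case: (ltnP (N M w) n); [left|right].
  - exact: (N_measurable M [set l | (l < n)%N]).
  - exact: (N_measurable M [set l | (n <= l)%N]).
  - by apply/seteqP; split=> w //= []; rewrite ltnNge => /negP.
rewrite addrC addKr ger0_norm ?prob_ge0//; apply: prob_le.
- exact: (N_measurable M [set l | (n < l)%N]).
- exact: (N_measurable M [set l | (n <= l)%N]).
- by move=> w /ltnW.
Qed.

End Coincidences.

Section Comparison.
Context {R : realType} {p : nat -> R} {nu q : R}.
Variable M : trial_model p nu q.
Hypotheses (nu0 : 0 < nu) (q01 : 0 < q < 1).
Local Notation Om := (Omega M).
Local Notation Pb := (prob (Pr M)).
Local Notation F := (@history R p nu q M).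
Implicit Types (w : Om) (s t a b delta : R) (i j k n m : nat) (E G : set Om).

Definition later k i : set Om := [set w | later_successes k w = i].

Lemma later_set_measurable k i : measurable (later k i).
Proof.
rewrite (_ : later k i = [set w | pred1 i (later_successes k w)]).
  exact: later_measurable.
by apply/seteqP; split=> w /= => [->|/eqP].
Qed.

Lemma N_gt_measurable n : measurable [set w : Om | (n < N M w)%N].
Proof. exact: (N_measurable M [set l | (n < l)%N]). Qed.

Lemma oc_measurable a b : measurable [set u : R | a < u <= b].
Proof.
rewrite (_ : [set _ | _] = `]a, b]%classic)//.
Qed.

Section cell.
Variables (k : nat) (G : set Om) (i i' : nat) (delta : R).
Hypotheses (k0 : (0 < k)%N) (pG : past k G) (delta0 : 0 <= delta).

Let reached t : set Om := G `&` [set w | (k <= count_upto t w)%N].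

Let mreached t : measurable (reached t).
Proof.
apply: measurableI; first exact: past_measurable pG.
exact: count_event_measurable.
Qed.

(** If T_k lies in ]s, t] and no further epoch does, then N_t = k and the Markov
    property at t applies.  The last bracket bounds the probability of two epochs in
    the cell, with the number of trials truncated at n. *)
Lemma cell_bound s t n : 0 <= s -> s <= t -> 0 < t -> t <= 1 ->
  S_cond M i t k <= S_cond M i' t k + delta ->
  Pb ((reached t `\` reached s) `&` later k i) <=
  Pb ((reached t `\` reached s) `&` later k i') +
  delta * Pb (reached t `\` reached s) +
  (n.+1%:R ^+ 2 * (t - s) ^+ 2 +
   Pb ((reached t `\` reached s) `&` [set w | (n < N M w)%N])).
Proof.
move=> s0 st t0 t1 hS; set C := reached t `\` reached s.
have t01 : 0 < t <= 1 by rewrite t0.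
have t01' : 0 <= t <= 1 by rewrite ltW.
have FC : F t C.
  have [GN GF] := pG; apply: historyD; first exact: GF.
  rewrite (_ : reached s = (G `&` [set w | (k <= count_upto t w)%N]) `&`
     [set w | (k <= count_upto s w)%N]).
    by apply: historyI; [exact: GF|exact: history_count].
  apply/seteqP; split=> w; last by move=> [[]].
  by move=> [Gw kc]; split=> //; split=> //=; rewrite (leq_trans kc)// count_upto_homo.
have mC : measurable C by exact: measurableD.
have mL j : measurable (later k j) := later_set_measurable k j.
have mS (Q : pred nat) : measurable (state_event t k Q : set Om).
  exact: state_event_measurable.
have Ei j : state_event t k (pred1 j) `<=` (later k j : set Om).
  by move=> w [_ /eqP].
pose X := C `&` [set w | (k < count_upto t w)%N].
have mX : measurable X by apply: measurableI => //; exact: count_event_measurable.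
have PX : Pb X <= n.+1%:R ^+ 2 * (t - s) ^+ 2 + Pb (C `&` [set w | (n < N M w)%N]).
  rewrite -(unif_oc s0 st t1).
  have mD := two_in_measurable M n (oc_measurable s t).
  have mCN : measurable (C `&` [set w | (n < N M w)%N]).
    by apply: measurableI => //; exact: N_gt_measurable.
  apply: le_trans (lerD (prob_two_in M n (oc_measurable s t)) (lexx _)).
  apply: le_trans (probU_le (Pr M) mD mCN); apply: prob_le => //.
    exact: measurableU.
  move=> w [Cw kc]; have [Nn|nN] := leqP (N M w) n; last by right; split.
  left; have [[Gw _] ns] := Cw.
  have kN : (k <= N M w)%N by have [GN _] := pG; exact: GN.
  have se : s < epoch k w.
    by rewrite ltNge epoch_leP//; apply/negP => ks; apply: ns; split.
  have [x [y [x0 xy yN Sx Sy]]] := two_epochs_in_cell k0 kN se kc.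
  by exists x, y; split=> //; exact: leq_trans Nn.
have step1 : Pb (C `&` later k i) <= Pb (C `&` state_event t k (pred1 i)) + Pb X.
  have mY : measurable (C `&` state_event t k (pred1 i)) by exact: measurableI.
  apply: le_trans (probU_le (Pr M) mY mX); apply: prob_le.
  - exact: measurableI.
  - exact: measurableU.
  move=> w [Cw li]; have [[_ kc] _] := Cw.
  have := kc; rewrite /= leq_eqVlt => /orP[/eqP ek|kc']; last by right.
  by left; split=> //; split=> //=; exact/eqP.
have step2 : Pb (C `&` state_event t k (pred1 i)) <=
    Pb (C `&` state_event t k (pred1 i')) + delta * Pb C.
  rewrite !(markov nu0 q01 _ _ t01 FC).
  have h : Pb (C `&` state_event t k predT) <= Pb C.
    by apply: prob_le; [exact: measurableI|exact: mC|move=> w []].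
  have := ler_wpM2l delta0 h.
  have := ler_wpM2l (prob_ge0 (Pr M) (C `&` state_event t k predT)) hS.
  rewrite mulrDr; lra.
have step3 : Pb (C `&` state_event t k (pred1 i')) <= Pb (C `&` later k i').
  apply: prob_le; [exact: measurableI|exact: measurableI|].
  by move=> w [Cw /Ei].
lra.
Qed.

(** The interval ]a, b] is cut into m cells of equal length; the errors of
    [cell_bound] add up to at most (n + 1)^2 / m plus the tail of N, and vanish as
    first n and then m is taken large. *)
Lemma compare_later a b : 0 <= a -> a < b -> b <= 1 ->
  (forall w, G w -> a < epoch k w <= b) ->
  (forall t, a < t <= b -> S_cond M i t k <= S_cond M i' t k + delta) ->
  Pb (G `&` later k i) <= Pb (G `&` later k i') + delta * Pb G.
Proof.
move=> a0 ab b1 Gab hS; apply/ler_addgt0Pr => e e0.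
have e20 : 0 < e / 2 by rewrite divr_gt0.
have [n nP] := N_tail M e20.
have ba0 : 0 < b - a by rewrite subr_gt0.
have n0 : 0 < n.+1%:R ^+ 2 :> R by rewrite exprn_gt0.
have [m mP] : exists m, n.+1%:R ^+ 2 / m.+1%:R < e / 2.
  have [m] := ltr_add_invr (divr_gt0 e20 n0); rewrite add0r => h.
  by exists m; rewrite -ltr_pdivlMl// mulrC.
have m0 : 0 < m.+1%:R :> R by rewrite ltr0n.
pose h := (b - a) / m.+1%:R.
have h0 : 0 < h by rewrite divr_gt0.
have hm : h * m.+1%:R = b - a by rewrite /h divfK ?lt0r_neq0.
pose t l : R := a + h * l%:R.
have tS l : t l.+1 = t l + h by rewrite /t -natr1; ring.
have ta l : a <= t l by rewrite lerDl mulr_ge0// ltW.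
have tb l : (l <= m.+1)%N -> t l <= b.
  move=> lm; have : h * l%:R <= h * m.+1%:R by rewrite ler_pM2l// ler_nat.
  by rewrite hm /t; lra.
have tm : t m.+1 = b by rewrite /t hm; ring.
have mL j : measurable (later k j) := later_set_measurable k j.
have claim l : (l <= m.+1)%N -> Pb (reached (t l) `&` later k i) <=
   Pb (reached (t l) `&` later k i') + delta * Pb (reached (t l)) +
   (l%:R * (n.+1%:R ^+ 2 * h ^+ 2) +
    Pb (reached (t l) `&` [set w | (n < N M w)%N])).
  elim: l => [_|l IH lm].
    rewrite (_ : reached (t 0%N) = set0); last first.
      apply/seteqP; split=> w // [Gw].
      have kN : (k <= N M w)%N by have [GN _] := pG; exact: GN.
      rewrite /= -epoch_leP// /t mulr0 addr0 leNgt.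
      by have /andP[-> _] := Gab w Gw.
    by rewrite !set0I prob0 mulr0 !add0r mul0r addr0.
  have {}IH := IH (ltnW lm).
  have tl1 : t l.+1 <= 1 by exact: le_trans (tb _ lm) b1.
  have tll : t l <= t l.+1 by rewrite tS; lra.
  have atl : a < t l.+1 by rewrite tS; have := ta l; lra.
  have tl0 : 0 < t l.+1 by exact: le_lt_trans atl.
  have := cell_bound n (le_trans a0 (ta l)) tll tl0 tl1.
  have := hS (t l.+1); rewrite atl tb// => /(_ isT) h1 /(_ h1).
  have split Y : measurable Y -> Pb (reached (t l.+1) `&` Y) =
      Pb (reached (t l) `&` Y) + Pb ((reached (t l.+1) `\` reached (t l)) `&` Y).
    move=> mY; rewrite (prob_split _ (measurableI _ _ (mreached _) mY) (mreached (t l))).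
    congr (_ + _); congr prob; apply/seteqP; split=> w /=.
    - by move=> [[_ ?] ?].
    - move=> [[Gw kc] Yw]; split; split=> //; split=> //=.
      by apply: (leq_trans kc); exact: count_upto_homo.
    - by move=> [[? ?] ?].
    - by move=> [[? ?] ?].
  have := split setT measurableT; rewrite !setIT => ->.
  rewrite !(split (later k _))// (split _ (N_gt_measurable n)).
  have -> : t l.+1 - t l = h by rewrite tS; ring.
  rewrite -[l.+1%:R]natr1; move: IH; clear; lra.
have rb : reached (t m.+1) = G.
  apply/seteqP; split=> w; first by case.
  move=> Gw; split=> //=.
  have kN : (k <= N M w)%N by have [GN _] := pG; exact: GN.
  by rewrite -epoch_leP// tm; have /andP[] := Gab w Gw.
have := claim m.+1 (leqnn _); rewrite rb => /le_trans; apply.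
rewrite lerD2l.
have : Pb (G `&` [set w | (n < N M w)%N]) <= e / 2.
  apply: le_trans (ltW nP); apply: prob_le; last by move=> w [].
    by apply: measurableI; [exact: past_measurable pG|exact: N_gt_measurable].
  exact: N_gt_measurable.
have : m.+1%:R * (n.+1%:R ^+ 2 * h ^+ 2) <= e / 2.
  apply: le_trans (ltW mP).
  have -> : m.+1%:R * (n.+1%:R ^+ 2 * h ^+ 2) =
     (b - a) ^+ 2 * (n.+1%:R ^+ 2 / m.+1%:R).
    by rewrite /h; field; rewrite lt0r_neq0.
  rewrite ler_piMl//.
  by rewrite expr_le1//; lra.
lra.
Qed.

End cell.
End Comparison.

(** * Conditional probabilities of zero and one later success *)

Lemma has_sum_drop (R : realType) (a : nat -> R) s k :
  (forall j, (j < k)%N -> a j = 0) -> has_sum a s ->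
  has_sum (fun j => a (k + j)%N) s.
Proof.
elim: k => [_|k IH a0 sa]; first by apply: eq_has_sum => j; rewrite add0n.
have sk := IH (fun j jk => a0 j (ltnW jk)) sa.
have := has_sum_shift sk; rewrite addn0 a0// subr0.
by apply: eq_has_sum => j; rewrite addSnnS.
Qed.

Lemma pochhammerD (R : realType) (x : R) k j :
  pochhammer x (k + j) = pochhammer x k * pochhammer (k%:R + x) j.
Proof.
elim: j => [|j IH]; first by rewrite addn0 {3}/pochhammer big_ord0 mulr1.
by rewrite addnS !pochhammerS IH natrD; ring.
Qed.

Lemma discount_range (R : realType) (q t : R) :
  0 < q < 1 -> 0 <= t <= 1 -> 0 <= q * (1 - t) < 1.
Proof.
move=> /andP[q0 q1] /andP[t0 t1]; rewrite mulr_ge0 ?subr_ge0 ?(ltW q0)//=.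
by apply: (le_lt_trans _ q1); rewrite ger_pMr//; lra.
Qed.

Section Conditional.
Context {R : realType} {theta nu q : R}.
Hypotheses (th0 : 0 < theta) (nu0 : 0 < nu) (q01 : 0 < q < 1).
Local Notation p := (success_prob theta).
Variable M : trial_model p nu q.
Local Notation Om := (Omega M).
Local Notation Pb := (prob (Pr M)).
Local Notation H := (@mean_har R theta nu).
Local Notation none_gf := (@none_gf R theta nu).
Local Notation har_gf := (@har_gf R theta nu).
Implicit Types (t : R) (i j k n : nat).

Lemma later_massS Q k j : later_mass M Q k j.+1 =
  p k.+1 * later_mass M (fun i => Q i.+1) k.+1 j +
  (1 - p k.+1) * later_mass M Q k.+1 j.
Proof.
by rewrite /later_mass /= big_bool/= prob_B// prob_Bfalse.
Qed.

(** The first of the remaining trials has to fail. *)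
Lemma later_mass_none k j : later_mass M (pred1 0%N) k j = s0 p k.+1 (k + j).
Proof.
elim: j k => [|j IH] k; first by rewrite /later_mass /s0 addn0 big_geq.
rewrite later_massS IH {1}/later_mass list_mean0 mulr0 add0r.
rewrite /s0 [RHS]big_ltn; last by rewrite ltnS addnS ltnS leq_addr.
by rewrite addSnnS.
Qed.

Lemma later_mass_one k j : (0 < k)%N ->
  later_mass M (pred1 1%N) k j = s1 p k.+1 (k + j).
Proof.
elim: j k => [|j IH] k k0.
  by rewrite /later_mass /s1 addn0 (big_geq (leqnn _)) mulr0.
rewrite later_massS IH//.
have -> : later_mass M (fun i => pred1 1%N i.+1) k.+1 j = s0 p k.+2 (k.+1 + j).
  by rewrite -later_mass_none.
have lt : (k.+1 < (k + j.+1).+1)%N by rewrite ltnS addnS ltnS leq_addr.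
rewrite /s1 /s0 [in RHS]big_ltn// [X in _ = _ * X]big_ltn// addSnnS.
have : 1 - p k.+1 != 0.
  rewrite fail_probE// mulf_neq0 ?invr_neq0 ?pnatr_eq0 -?lt0n//.
  by rewrite lt0r_neq0// addr_gt0// ltr0n.
move=> ?; by field.
Qed.

(** With n = k + j trials in all, the binomial coefficient turns the negative binomial
    weight of n into a constant times (k + nu)_j / j! times (q (1 - t))^j: given
    N_t = k, the remaining number of trials is again negative binomial. *)
Lemma state_prob t k : (0 < k)%N -> 0 < t <= 1 ->
  exists2 c, 0 < c &
    Pb (state_event t k (pred1 0%N)) = c * none_gf k (q * (1 - t)) /\
    Pb (state_event t k (pred1 1%N)) = c * (theta * har_gf k (q * (1 - t))).
Proof.
move=> k0 t01; have /andP[q0 q1] := q01; have /andP[t0 t1] := t01.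
set x := q * (1 - t).
have x01 : 0 <= x < 1.
  by apply: discount_range => //; rewrite ltW.
have [Th Th0 ThP] := state_law M nu0 q01 k t01.
pose c := Th * (pochhammer nu k / k`!%:R * (1 - q) `^ nu * q ^+ k).
have c0 : 0 < c.
  rewrite mulr_gt0// mulr_gt0 ?exprn_gt0// mulr_gt0 ?powR_gt0 ?subr_gt0//.
  by rewrite divr_gt0 ?ltr0n ?fact_gt0// pochhammer_gt0.
have sm Q : has_sum (fun j => c * (pochhammer (k%:R + nu) j / j`!%:R * x ^+ j *
    later_mass M Q k j)) (Pb (state_event t k Q)).
  have := @state_event_sum _ _ _ _ M setT t k Q measurableT; rewrite setTI.
  move/(eq_has_sum (fun n => ThP n Q)) => s.
  have z n : (n < k)%N -> Th * (nb_pmf nu q n * 'C(n, k)%:R * (1 - t) ^+ (n - k) *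
      later_mass M Q k (n - k)) = 0.
    by move=> nk; rewrite bin_small// !(mulr0, mul0r).
  apply: eq_has_sum (has_sum_drop z s) => j.
  rewrite addKn /c /nb_pmf pochhammerD exprD exprMn_comm; last exact: mulrC.
  have -> : (k + j)`!%:R = 'C(k + j, k)%:R * (k`!%:R * j`!%:R) :> R.
    by rewrite -!natrM -(bin_fact (leq_addr j k)) addKn.
  field; rewrite !pnatr_eq0 -!lt0n !fact_gt0 bin_gt0 leq_addr//.
exists c => //; split.
  apply: has_sum_unique (sm _) (has_sumM c (eq_has_sum _ (none_gf_sum th0 nu0 k0 x01))).
  by move=> j; rewrite later_mass_none /hyp_coef; ring.
apply: has_sum_unique (eq_has_sum _ (sm _))
  (has_sumM c (has_sumM theta (har_gf_sum th0 nu0 k0 x01))).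
by move=> j /=; rewrite later_mass_one// s1E// /hyp_coef; ring.
Qed.

Lemma S_cond_ratio t k : (0 < k)%N -> 0 < t <= 1 ->
  0 < S_cond M 0 t k <= 1 /\
  S_cond M 1 t k = theta * H k (q * (1 - t)) * S_cond M 0 t k.
Proof.
move=> k0 t01; have /andP[q0 q1] := q01; have /andP[t0 t1] := t01.
have [c c0 [P0 P1]] := state_prob k0 t01.
have x01 : 0 <= q * (1 - t) < 1.
  by apply: discount_range => //; rewrite ltW.
have f0 := @none_gf_gt0 _ _ _ th0 nu0 _ k0 _ x01.
have P00 : 0 < Pb (state_event t k (pred1 0%N)) by rewrite P0 mulr_gt0.
have mS Q : measurable (state_event t k Q : set Om) by exact: state_event_measurable.
have Ple : Pb (state_event t k (pred1 0%N)) <= Pb (state_event t k predT).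
  by apply: prob_le; [exact: mS|exact: mS|move=> w []].
have Z0 : 0 < Pb (state_event t k predT) by exact: lt_le_trans Ple.
rewrite !S_condE; split; first by rewrite divr_gt0//= ler_pdivrMr// mul1r.
rewrite P0 P1 /mean_har; field.
by rewrite !lt0r_neq0.
Qed.

Lemma S_cond_leE t k : (0 < k)%N -> 0 < t <= 1 ->
  (S_cond M 1 t k <= S_cond M 0 t k) = (theta * H k (q * (1 - t)) <= 1).
Proof.
move=> k0 t01; have [/andP[S0 _] ->] := S_cond_ratio k0 t01.
by rewrite ger_pMl.
Qed.

End Conditional.

(** * Coinciding epochs *)

Section Coincidence_null.
Context {R : realType} {p : nat -> R} {nu q : R}.
Variable M : trial_model p nu q.
Local Notation Om := (Omega M).
Local Notation Pb := (prob (Pr M)).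
Implicit Types (w : Om) (s t a b : R) (c : nat -> R) (i j k n m : nat) (E G X Y Z : set Om).

Lemma prob_bigcup0 (F : nat -> set Om) : (forall n, measurable (F n)) ->
  (forall n, Pb (F n) = 0) -> Pb (\bigcup_n F n) = 0.
Proof.
move=> mF F0.
have mU : measurable (\bigcup_n F n) by exact: bigcup_measurable.
suff /(negligibleP _ mU) : (Pr M).-negligible (\bigcup_n F n).
  by rewrite /prob => ->.
apply: negligible_bigcup => n; apply/negligibleP => //.
by apply: etrans (probE (Pr M) (mF n)) _; rewrite F0.
Qed.

Lemma prob_le_off X Y Z : measurable X -> measurable Y -> measurable Z ->
  Pb Z = 0 -> X `<=` Y `|` Z -> Pb X <= Pb Y.
Proof.
move=> mX mY mZ Z0 XY; rewrite -[leRHS]addr0 -Z0.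
apply: le_trans (probU_le (Pr M) mY mZ).
by apply: prob_le => //; exact: measurableU.
Qed.

Lemma U_eq_measurable i j : measurable [set w : Om | U M i w = U M j w].
Proof.
have h : measurable_fun setT (fun w : Om => U M i w == U M j w).
  by apply: measurable_realfun.measurable_fun_eqr; exact: measurable_funP.
have := h measurableT [set true] I; rewrite setTI.
by congr measurable; apply/seteqP; split=> w /= /eqP.
Qed.

(** If two arrivals coincide, they share one of m cells of length 1 / m, which
    has probability at most m (1 / m)^2. *)
Lemma prob_U_eq i j : (0 < i)%N -> (i < j)%N ->
  Pb [set w | U M i w = U M j w] = 0.
Proof.
move=> i0 ij; apply/eqP; rewrite eq_le prob_ge0 andbT.
apply/ler_addgt0Pr => e e0; rewrite add0r.
have [m] := ltr_add_invr e0; rewrite add0r => me.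
have m0 : 0 < m.+1%:R :> R by rewrite ltr0n.
pose cell l := [set u : R | l%:R / m.+1%:R < u <= l.+1%:R / m.+1%:R].
have mcell l : measurable (cell l) by exact: oc_measurable.
pose Hc (l : option nat) : set Om := if l is Some l' then
  U M i @^-1` (cell l') `&` U M j @^-1` (cell l') else U M i @^-1` [set 0].
have mH l : measurable (Hc l).
  by case: l => [l|] /=; [apply: measurableI|]; exact: U_measurable.
have mE := U_eq_measurable i j.
apply: (le_trans (@prob_union_bound _ _ _ _ M _
  (None :: [seq Some l | l <- iota 0 m.+1]) Hc _ mE mH _)).
  move=> w Uij; apply/hasP.
  have [U0|U0] := eqVneq (U M i w) 0.
    by exists None; [exact: mem_head|exact/asboolP].
  have /andP[Uge Ule] := U_range w i0.
  have ex : exists l, U M i w <= l%:R / m.+1%:R.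
    by exists m.+1; rewrite divff ?lt0r_neq0.
  case: (ex_minnP ex) => l lU lmin.
  have l0 : (0 < l)%N.
    case: l lU {lmin} => // /[!mul0r] U0'.
    by move: U0; rewrite eq_le U0' Uge.
  have lm : (l <= m.+1)%N by apply: lmin; rewrite divff ?lt0r_neq0.
  have cU : cell l.-1 (U M i w).
    rewrite /cell /= prednK// lU andbT ltNge; apply/negP => /lmin.
    by rewrite leqNgt prednK// leqnn.
  exists (Some l.-1).
    rewrite inE; apply/orP; right; apply: map_f.
    by rewrite mem_iota add0n leq0n prednK.
  by apply/asboolP; split => //; rewrite /preimage/= -Uij.
rewrite big_cons big_map prob_U// unif_set1 add0r.
rewrite big_seq (eq_bigr (fun=> (m.+1%:R^-1) ^+ 2)).
  rewrite -big_seq -[iota _ _]/(index_iota 0 m.+1) sumr_const_nat subn0.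
  have -> : m.+1%:R^-1 ^+ 2 *+ m.+1 = m.+1%:R^-1 :> R.
    by rewrite -mulr_natl; field; rewrite lt0r_neq0.
  exact: ltW.
move=> l; rewrite mem_iota add0n/= => lm.
rewrite pair_indep// unif_oc//.
- by rewrite -expr2 -mulrBl -natrB// subSnn mul1r.
- by rewrite ler_pM2r ?invr_gt0// ler_nat.
- by rewrite ler_pdivrMr// mul1r ler_nat.
Qed.

(** Null by [prob_coincidence].  The times c are those at which strict and weak
    inequalities have to be interchanged. *)
Definition coincidence (c : nat -> R) : set Om := \bigcup_i
  (if (0 < i)%N then
     \bigcup_j ([set w | U M i w = c j] `|`
                (if (i < j)%N then [set w | U M i w = U M j w] else set0))
   else set0).

Lemma coincidence_measurable c : measurable (coincidence c).
Proof.
apply: bigcup_measurable => i _; case: ifP => // _.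
apply: bigcup_measurable => j _; apply: measurableU.
  exact: (U_measurable M i (measurable_set1 (c j))).
by case: ifP => // _; exact: U_eq_measurable.
Qed.

Lemma prob_coincidence c : Pb (coincidence c) = 0.
Proof.
have mX i j : measurable [set w : Om | U M i w = c j].
  exact: (U_measurable M i (measurable_set1 (c j))).
have mY i j : measurable ((if (i < j)%N then [set w | U M i w = U M j w] else set0) : set Om).
  by case: ifP => // _; exact: U_eq_measurable.
apply: prob_bigcup0 => i; case: ifP => // i0; last exact: prob0.
  by apply: bigcup_measurable => j _; exact: measurableU.
apply: prob_bigcup0 => j; first exact: measurableU.
apply/eqP; rewrite eq_le prob_ge0 andbT.
apply: le_trans (probU_le _ (mX i j) (mY i j)) _.
rewrite [X in X + _](prob_U M (S := [set c j]))// unif_set1 add0r.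
by case: ifP => ij; rewrite ?prob0// prob_U_eq.
Qed.

Lemma epoch_neq c k j w : ~ coincidence c w -> (0 < k <= N M w)%N ->
  epoch k w != c j.
Proof.
move=> cw /epoch_mem[i /andP[i0 _] ->]; apply/eqP => Uc; apply: cw.
by exists i => //; rewrite i0; exists j => //; left.
Qed.

Lemma epoch_lt c j k w : ~ coincidence c w -> (0 < j)%N -> (j < k)%N ->
  (k <= N M w)%N -> epoch j w < epoch k w.
Proof.
move=> cw j0 jk kN; rewrite /epoch.
set s := sort _ _.
have sz : size s = N M w by rewrite size_sort size_map size_iota.
have ss : sorted <%R s.
  rewrite lt_sorted_uniq_le sort_sorted ?andbT; last exact: le_total.
  rewrite sort_uniq map_inj_in_uniq ?iota_uniq// => x y.
  rewrite !mem_iota => /andP[x0 _] /andP[y0 _] Uxy.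
  have [xy|yx|//] := ltngtP x y; exfalso; apply: cw.
    by exists x => //; rewrite x0; exists y => //; right; rewrite xy.
  by exists y => //; rewrite y0; exists x => //; right; rewrite yx.
apply: (sorted_ltn_nth lt_trans) => //; rewrite ?inE ?sz.
- by rewrite prednK// (leq_trans (ltnW jk)).
- by rewrite prednK// (leq_trans j0 (ltnW jk)).
- by rewrite -ltnS !prednK// (leq_trans j0 (ltnW jk)).
Qed.

End Coincidence_null.

(** * Strategies stopping at the first accepted trial *)

Section Strategies.
Context {R : realType} {p : nat -> R} {nu q : R}.
Variable M : trial_model p nu q.
Local Notation Om := (Omega M).
Local Notation F := (@history R p nu q M).
Implicit Types (w : Om) (s t a b : R) (i j k l n m : nat) (E G : set Om)
  (sigma : Om -> R).

Lemma measurable_fun_le sigma :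
  (forall t, measurable [set w | sigma w <= t]) -> measurable_fun setT sigma.
Proof.
move=> ms mD.
apply: (measurability _ (measurable_realfun.RGenOInfty.measurableE R)) => //.
move=> _ [_ [a ->] <-]; rewrite setTI.
rewrite (_ : _ @^-1` _ = ~` [set w | sigma w <= a]); first exact: measurableC.
apply/seteqP; split=> w /=; rewrite in_itv/= andbT ltNge; first by move/negP.
by move=> h; apply/negP.
Qed.

(** Shaped like the definition of the myopic rule, so that the two are compared through
    their acceptance conditions. *)
Definition first_stop (Z : nat -> set Om) w : R :=
  head 1 [seq epoch k w | k <- iota 1 (N M w) & `[< Z k w >]].

(** Some accepted epoch up to t exists as soon as the first one is, because epochs are
    nondecreasing.  The bound t < 1 excludes the default value. *)
Lemma first_stop_leP (Z : nat -> set Om) w t : t < 1 ->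
  first_stop Z w <= t <->
  exists k, [/\ (0 < k <= N M w)%N, Z k w & epoch k w <= t].
Proof.
move=> t1; rewrite /first_stop.
set s := [seq k <- iota 1 (N M w) | `[< Z k w >]].
have sE k : (k \in s) <-> (0 < k <= N M w)%N /\ Z k w.
  rewrite mem_filter mem_iota add1n ltnS.
  by split=> [/andP[/asboolP]|[-> /asboolP ->]].
have srt : sorted ltn s.
  by apply: sorted_filter (iota_ltn_sorted _ _); exact: ltn_trans.
move: sE srt; case: s => [|x s] sE /= srt.
  split=> [|[k [kN Zk _]]]; first by rewrite leNgt t1.
  by have /(_ (conj kN Zk)) := (sE k).2.
have [xN Zx] := (sE x).1 (mem_head x s).
split=> [xt|[k [kN Zk kt]]]; first by exists x.
apply: le_trans kt; have /andP[x0 _] := xN; have /andP[_ kN'] := kN.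
apply: epoch_homo => //.
have := (sE k).2 (conj kN Zk); rewrite inE => /predU1P[->//|ks].
by have /allP/(_ _ ks)/ltnW := order_path_min ltn_trans srt.
Qed.

Lemma first_stop_range Z w :
  (exists2 k, (0 < k <= N M w)%N & first_stop Z w = epoch k w) \/
  first_stop Z w = 1.
Proof.
rewrite /first_stop.
have sE k : k \in [seq k <- iota 1 (N M w) | `[< Z k w >]] -> (0 < k <= N M w)%N.
  by rewrite mem_filter mem_iota add1n ltnS => /andP[].
move: sE; set s := [seq k <- _ | _]; case: s => [|x s] sE; first by right.
by left; exists x => //; apply: sE; exact: mem_head.
Qed.

Lemma first_stop_strategy Z : (forall k, (0 < k)%N -> past k (Z k)) ->
  stopping_strategy (first_stop Z).
Proof.
move=> pZ.
have le1 t : 1 <= t -> [set w | first_stop Z w <= t] = setT.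
  move=> t1; apply/seteqP; split=> w //= _; apply: le_trans t1.
  have [[k kN ->]|->//] := first_stop_range Z w.
  by have /andP[] := epoch_range kN.
have hF t : 0 <= t <= 1 -> F t [set w | first_stop Z w <= t].
  move=> t01; have /andP[t0 t1] := t01.
  have [t1'|t1'] := ltP t 1; last by rewrite le1//; exact: historyT.
  rewrite (_ : [set _ | _] = \bigcup_k (if (0 < k)%N then
     Z k `&` [set w | (k <= count_upto t w)%N] else set0)).
    apply: history_bigcup => k; case: ifP => k0; last exact: history0.
    by have [_] := pZ k k0; exact.
  apply/seteqP; split=> w /=.
    move=> /(first_stop_leP _ _ t1')[k [/andP[k0 kN] Zk kt]].
    by exists k => //; rewrite k0; split=> //=; rewrite -epoch_leP.
  move=> [k _]; case: ifP => // k0 [Zk kc]; apply/first_stop_leP => //.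
  have kN : (k <= N M w)%N by exact: leq_trans (count_upto_le_N t w).
  by exists k; rewrite k0 kN epoch_leP.
split=> [|w|//]; last exact: first_stop_range.
apply: measurable_fun_le => t.
have [t0|t0] := leP 0 t; last first.
  rewrite (_ : [set _ | _] = set0)//; apply/seteqP; split=> w //=.
  apply/negP; rewrite -ltNge; apply: (lt_le_trans t0).
  have [[k kN ->]|->//] := first_stop_range Z w.
  by have /andP[] := epoch_range kN.
have [t1|t1] := leP t 1; last by rewrite le1 ?ltW.
by apply: (history_measurable (t := t)); rewrite ?t0//; apply: hF; rewrite t0.
Qed.

Definition last_success l w :=
  [/\ (0 < l <= N M w)%N, B M l w & forall j, (l < j <= N M w)%N -> ~~ B M j w].

Lemma win_first_stop Z l w : last_success l w -> Z l w ->
  (forall j, (0 < j < l)%N -> ~ Z j w) -> win_event (first_stop Z) w.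
Proof.
move=> [lN Bl ml] Zl nZ; exists l; split=> //; rewrite /first_stop.
have /andP[l0 lN'] := lN.
have -> : iota 1 (N M w) = iota 1 l.-1 ++ l :: iota l.+1 (N M w - l).
  rewrite -[in LHS](subnK lN') addnC -{1}(prednK l0) addSnnS iotaD/=.
  by rewrite add1n prednK.
rewrite filter_cat (_ : [seq k <- iota 1 l.-1 | _] = [::]) /=.
  by rewrite (asboolT Zl).
apply/eqP; rewrite -[_ == _]negbK -has_filter; apply/hasPn => j.
by rewrite mem_iota add1n prednK// => jl; apply/asboolP; exact: nZ.
Qed.

Lemma last_success_uniq l l' w : last_success l w -> last_success l' w -> l = l'.
Proof.
move=> [/andP[l0 lN] Bl ml] [/andP[l0' lN'] Bl' ml'].
have [ll|ll|//] := ltngtP l l'.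
  by have := ml l'; rewrite ll lN' Bl' => /(_ isT).
by have := ml' l; rewrite ll lN Bl => /(_ isT).
Qed.

Lemma later_eq0P k w : later k 0 w <->
  forall j, (k < j <= N M w)%N -> ~~ B M j w.
Proof.
rewrite /later /later_successes /=; split=> [/eqP|h].
  rewrite sum_nat_seq_eq0 => /allP h j jN.
  by have := h j; rewrite mem_index_iota ltnS jN /= eqb0 => /(_ isT).
apply/eqP; rewrite sum_nat_seq_eq0; apply/allP => j.
by rewrite mem_index_iota ltnS /= => /h; rewrite eqb0.
Qed.

Lemma later_last k w : (0 < k <= N M w)%N -> B M k w ->
  later k 0 w <-> last_success k w.
Proof.
by move=> kN Bk; split=> [/later_eq0P //|[_ _ /later_eq0P]].
Qed.

Lemma later_split k l w : (k <= l <= N M w)%N ->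
  later_successes k w =
  (\sum_(k.+1 <= j < l.+1) B M j w + later_successes l w)%N.
Proof.
by move=> /andP[kl lN]; rewrite /later_successes (@big_cat_nat _ _ _ l.+1).
Qed.

Lemma later_lt k l w : (k < l <= N M w)%N -> B M l w ->
  (later_successes l w < later_successes k w)%N.
Proof.
move=> /andP[kl lN] Bl; rewrite (@later_split k l w) ?lN ?(ltnW kl)//.
by rewrite big_nat_recr//= Bl -[X in (X < _)%N]add0n ltn_add2r addn1.
Qed.

Lemma penultimate_later k l w : last_success l w -> (k < l)%N ->
  (forall j, (k < j < l)%N -> ~~ B M j w) -> later k 1 w.
Proof.
move=> lsl kl h; have [/andP[l0 lN] Bl _] := lsl.
rewrite /later/= (@later_split k l w) ?lN ?(ltnW kl)//.
have -> : later_successes l w = 0%N by apply/later_last; rewrite ?l0.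
rewrite big_nat_recr//= Bl addn0 addn1; congr S.
apply/eqP; rewrite sum_nat_seq_eq0; apply/allP => j.
by rewrite mem_index_iota /= => /h; rewrite eqb0.
Qed.

Lemma later_one_last k w : (0 < k <= N M w)%N -> later k 1 w ->
  exists l, [/\ (k < l)%N, last_success l w &
    forall j, (k < j < l)%N -> ~~ B M j w].
Proof.
move=> /andP[k0 kN] k1.
have [j jP] : exists j, (k < j <= N M w)%N && B M j w.
  apply: contrapT => /forallNP h.
  suff : later k 0 w by rewrite /later /= => k0'; move: k1; rewrite /later/= k0'.
  by apply/later_eq0P => j jN; apply/negP => Bj; apply: (h j); rewrite jN.
have ub i : (k < i <= N M w)%N && B M i w -> (i <= N M w)%N.
  by move=> /andP[/andP[]].
case: (ex_maxnP (ex_intro _ j jP) ub) => l /andP[/andP[kl lN] Bl] lmax.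
have lsl : last_success l w.
  split=> //; first by rewrite lN (leq_trans k0 (ltnW kl)).
  move=> i /andP[li iN]; apply/negP => Bi.
  by have := lmax i; rewrite (ltn_trans kl li) iN Bi leqNgt li => /(_ isT).
exists l; split=> // i /andP[ki il]; apply/negP => Bi.
have := @later_lt k i w; rewrite ki (leq_trans (ltnW il) lN) => /(_ isT Bi).
have := @later_lt i l w; rewrite il lN => /(_ isT Bl).
by rewrite [later_successes k w]k1 ltnS leqn0 => /[swap] /eqP ->.
Qed.

(** The last success before l has exactly one success after it, at l. *)
Lemma penultimate_exists j l w : last_success l w -> (0 < j < l)%N -> B M j w ->
  exists k, [/\ (j <= k < l)%N, B M k w & later k 1 w].
Proof.
move=> lsl /andP[j0 jl] Bj.
have ub i : (i < l)%N && B M i w -> (i <= l)%N by move=> /andP[/ltnW].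
have jP : (j < l)%N && B M j w by rewrite jl.
case: (ex_maxnP (ex_intro _ j jP) ub) => k /andP[kl Bk] kmax.
exists k; rewrite kl (kmax j jP); split=> //.
apply: penultimate_later lsl kl _ => i /andP[ki il]; apply/negP => Bi.
by have := kmax i; rewrite il Bi leqNgt ki => /(_ isT).
Qed.

Lemma epoch_measurable k : (0 < k)%N ->
  measurable_fun setT (fun w : Om => epoch k w).
Proof.
move=> k0.
pose Z j : set Om := if j == k then [set w | (j <= N M w)%N] else set0.
have pZ j : (0 < j)%N -> past j (Z j).
  rewrite /Z => j0; case: ifP => _; first exact: past_exists.
  by split=> // t t01; rewrite set0I; exact: history0.
rewrite (_ : (fun w => _) = first_stop Z).
  by have [] := first_stop_strategy pZ.
apply/funext => w; rewrite /first_stop.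
have ZE j : j \in iota 1 (N M w) -> `[< Z j w >] = (j == k).
  rewrite mem_iota add1n ltnS /Z => /andP[_ jN].
  by case: ifP => _; [exact: asboolT|exact: asboolF].
rewrite (eq_in_filter ZE).
have [kN|Nk] := leqP k (N M w).
  by rewrite filter_pred1_uniq ?iota_uniq// mem_iota k0 add1n ltnS.
rewrite /epoch nth_default; last first.
  by rewrite size_sort size_map size_iota -ltnS prednK.
rewrite (_ : [seq _ <- _ | _] = [::])//.
apply/eqP; rewrite -[_ == _]negbK -has_filter; apply/hasPn => j.
rewrite mem_iota add1n ltnS => /andP[_ jN].
by rewrite ltn_eqF// (leq_ltn_trans jN).
Qed.

Lemma win_eventE sigma : win_event sigma =
  [set w | exists2 l, last_success l w & sigma w = epoch l w].
Proof.
by apply/seteqP; split=> w [l]; [move=> [? ? ? ?]|move=> [? ? ?] ?]; exists l.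
Qed.

Lemma last_success_measurable l : measurable [set w | last_success l w].
Proof.
have [l0|] := posnP l.
  rewrite (_ : [set _ | _] = set0)//.
  by apply/seteqP; split=> w // []; rewrite l0.
move=> l0.
rewrite (_ : [set _ | _] = [set w | (l <= N M w)%N] `&` B M l @^-1` [set true] `&`
    later l 0).
  apply: measurableI; last exact: later_set_measurable.
  apply: measurableI; last exact: B_measurable.
  exact: (N_measurable M [set n | (l <= n)%N]).
apply/seteqP; split=> w.
  by move=> lw; have [/andP[_ lN] Bl _] := lw; split=> //; apply/later_last; rewrite ?l0.
by move=> [[/= lN Bl] ?]; apply/later_last; rewrite ?l0.
Qed.

Lemma win_measurable sigma : measurable_fun setT sigma ->
  measurable (win_event sigma).
Proof.
move=> ms; rewrite win_eventE.
rewrite (_ : [set _ | _] = \bigcup_l (if (0 < l)%N then [set w | last_success l w] `&`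
   (fun w => sigma w == epoch l w) @^-1` [set true] else set0)).
  apply: bigcup_measurable => l _; case: ifP => // l0.
  apply: measurableI; first exact: last_success_measurable.
  have h : measurable_fun setT (fun w : Om => sigma w == epoch l w).
    by apply: measurable_realfun.measurable_fun_eqr => //; exact: epoch_measurable.
  by have := h measurableT [set true] I; rewrite setTI.
apply/seteqP; split=> w.
  move=> [l lw sl]; exists l => //; have [/andP[-> _] _ _] := lw.
  by split=> //=; exact/eqP.
by move=> [l _]; case: ifP => // l0 [lw /eqP]; exists l.
Qed.

End Strategies.

(** * Optimality of a threshold rule with decreasing thresholds *)

Section Optimality.
Context {R : realType} {p : nat -> R} {nu q : R}.
Variable M : trial_model p nu q.
Hypotheses (nu0 : 0 < nu) (q01 : 0 < q < 1).
Local Notation Om := (Omega M).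
Local Notation Pb := (prob (Pr M)).
Implicit Types (w : Om) (t : R) (i j k l n : nat) (G : nat -> set Om).

Definition success_at k : set Om := [set w | (k <= N M w)%N /\ B M k w].

(** At a success k, the value of [later_successes] determines how many successes
    are still to come, hence determines k: the union is disjoint. *)
Definition at_success (G : nat -> set Om) i : set Om :=
  \bigcup_k (if (0 < k)%N then G k `&` later k i else set0).

Lemma at_success_measurable G i : (forall k, (0 < k)%N -> measurable (G k)) ->
  measurable (at_success G i).
Proof.
move=> mG; apply: bigcup_measurable => k _; case: ifP => // k0.
by apply: measurableI; [exact: mG|exact: later_set_measurable].
Qed.

Lemma prob_at_success G i : (forall k, (0 < k)%N -> measurable (G k)) ->
  (forall k, (0 < k)%N -> G k `<=` success_at k) ->
  has_sum (fun k => Pb (if (0 < k)%N then G k `&` later k i else set0))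
    (Pb (at_success G i)).
Proof.
move=> mG GS; apply: prob_bigcup.
  move=> k; case: ifP => // k0.
  by apply: measurableI; [exact: mG|exact: later_set_measurable].
apply/trivIsetP => k l _ _ kl; apply/seteqP; split=> w //=.
case: ifP => k0; last by case.
case: ifP => l0; last by case.
move=> [[Gk ki] [Gl li]]; have [kN Bk] := GS k k0 w Gk.
have [lN Bl] := GS l l0 w Gl; rewrite /later/= in ki li.
wlog lt : k l kl k0 l0 Gk ki Gl li kN Bk lN Bl / (k < l)%N.
  move=> th; have [lt|gt|e] := ltngtP k l; last by rewrite e eqxx in kl.
    exact: (th k l).
  by apply: (th l k) => //; rewrite eq_sym.
by have := @later_lt _ _ _ _ M k l w; rewrite lt lN ki li ltnn => /(_ isT Bl).
Qed.

Lemma prob_at_success_le G i i' : (forall k, (0 < k)%N -> measurable (G k)) ->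
  (forall k, (0 < k)%N -> G k `<=` success_at k) ->
  (forall k, (0 < k)%N -> Pb (G k `&` later k i) <= Pb (G k `&` later k i')) ->
  Pb (at_success G i) <= Pb (at_success G i').
Proof.
move=> mG GS h; apply: (@le_has_sum _ _ _ _ _ _
  (@prob_at_success G i mG GS) (@prob_at_success G i' mG GS)).
by move=> k; case: ifP => // k0; exact: h.
Qed.

Variables (a : nat -> R) (Z : nat -> set Om).
Hypothesis a_lt1 : forall k, (0 < k)%N -> a k < 1.
Hypothesis a_nonincr : forall k l, (0 < k)%N -> (k <= l)%N -> a l <= a k.
Hypothesis stop_better : forall k t, (0 < k)%N -> 0 < t <= 1 -> a k <= t ->
  S_cond M 1 t k <= S_cond M 0 t k.
Hypothesis wait_better : forall k t, (0 < k)%N -> 0 < t <= 1 -> t <= a k ->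
  S_cond M 0 t k <= S_cond M 1 t k.
Hypothesis Z_past : forall k, (0 < k)%N -> past k (Z k).
Hypothesis ZE : forall k w, (0 < k)%N -> (k <= N M w)%N -> 0 < epoch k w ->
  Z k w <-> B M k w /\ a k <= epoch k w.

Section against.
Variables (sigma : Om -> R).
Hypothesis ss : stopping_strategy sigma.

Let before k : set Om := [set w | (k <= N M w)%N /\ epoch k w < sigma w].

(** Sigma has stopped by T_k although T_k is a success below its threshold.  The
    condition T_k > 0 provides the left end of the interval required by
    [compare_later]. *)
Definition too_early k : set Om :=
  (success_at k `\` before k) `&`
  ([set w | (k <= N M w)%N /\ epoch k w < a k] `\`
   [set w | (k <= N M w)%N /\ epoch k w <= 0]).

(** Sigma goes on after T_k although T_k is a success above its threshold. *)
Definition too_late k : set Om :=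
  (success_at k `&` before k) `\`
  [set w | (k <= N M w)%N /\ epoch k w <= Num.max 0 (a k)].

Let too_early_past k : (0 < k)%N -> past k (too_early k).
Proof.
move=> k0; apply: pastI; apply: pastD.
- exact: past_success.
- exact: past_before.
- exact: past_lt.
- exact: past_le.
Qed.

Let too_late_past k : (0 < k)%N -> past k (too_late k).
Proof.
move=> k0; apply: pastD; last exact: past_le.
by apply: pastI; [exact: past_success|exact: past_before].
Qed.

Lemma too_early_le : Pb (at_success too_early 0) <= Pb (at_success too_early 1).
Proof.
apply: prob_at_success_le.
- by move=> k k0; exact: past_measurable (too_early_past k0).
- by move=> k k0 w [[]].
move=> k k0.
have te w : too_early k w -> 0 < epoch k w < a k.
  move=> [_ [[kN ->] h]]; rewrite andbT ltNge; apply/negP => e0.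
  by apply: h; split.
have [ak|ak] := leP (a k) 0.
  rewrite (_ : too_early k = set0) ?set0I ?prob0//.
  apply/seteqP; split=> w // /te /andP[e0 ea].
  by have := lt_le_trans (lt_trans e0 ea) ak; rewrite ltxx.
have := @compare_later _ _ _ _ M nu0 q01 k (too_early k) 0 1 0 k0 (too_early_past k0)
  (lexx 0) 0 (a k) (lexx 0) ak (ltW (a_lt1 k0)).
rewrite mul0r addr0; apply.
  by move=> w /te /andP[-> /ltW].
move=> t /andP[t0 ta]; rewrite addr0; apply: wait_better => //.
by rewrite t0 (le_trans ta)// ltW// a_lt1.
Qed.

Lemma too_late_le : Pb (at_success too_late 1) <= Pb (at_success too_late 0).
Proof.
apply: prob_at_success_le.
- by move=> k k0; exact: past_measurable (too_late_past k0).
- by move=> k k0 w [[]].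
move=> k k0.
have tl w : too_late k w -> Num.max 0 (a k) < epoch k w <= 1.
  move=> [[[kN Bk] _] h]; apply/andP; split.
    by rewrite ltNge; apply/negP => e0; apply: h; split.
  by have /andP[] := @epoch_range _ _ _ _ M k w (introT andP (conj k0 kN)).
have a1 : Num.max 0 (a k) < 1 by rewrite gt_max ltr01 a_lt1.
have a0 : 0 <= Num.max 0 (a k) by rewrite le_max lexx.
have := @compare_later _ _ _ _ M nu0 q01 k (too_late k) 1 0 0 k0 (too_late_past k0)
  (lexx 0) _ 1 a0 a1 (lexx 1) tl.
rewrite mul0r addr0; apply.
move=> t /andP[ta t1]; rewrite addr0; move: ta; rewrite gt_max => /andP[t0 ta].
by apply: stop_better => //; [rewrite t0|exact: ltW].
Qed.

(* [too_early] and [too_late] leave the times 0 and a k uncovered. *)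
Let excluded n : R := if n is k.+1 then a k else 0.
Let bad := @coincidence _ _ _ _ M excluded.

Let W := win_event sigma.
Let V := win_event (first_stop Z).

Let epoch_gt0 k w : ~ bad w -> (0 < k <= N M w)%N -> 0 < epoch k w.
Proof.
move=> nb kN; have /andP[h _] := epoch_range kN.
by rewrite lt_neqAle h eq_sym (epoch_neq 0 nb kN).
Qed.

Let before_winE l w : last_success l w -> W w -> sigma w = epoch l w.
Proof.
move=> lw; rewrite /W win_eventE => -[l' lw' ->].
by rewrite (last_success_uniq lw' lw).
Qed.

(** Since the threshold rule does not win at l, it accepts an earlier success j;
    thresholds decrease, so it also accepts the last success k before l, and sigma
    has not stopped by then. *)
Let accepted_before l w : ~ bad w -> last_success l w ->
  a l <= epoch l w <= sigma w -> ~ V w -> at_success too_late 1 w.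
Proof.
move=> nb lw /andP[al ls] nV; have [/andP[l0 lN] Bl _] := lw.
have [j [/andP[j0 jl] Zj]] : exists j, (0 < j < l)%N /\ Z j w.
  apply: contrapT => /forallNP h; apply: nV; apply: (win_first_stop lw).
    by apply/ZE => //; apply: epoch_gt0; rewrite ?l0.
  by move=> j jl Zj; apply: (h j).
have jN : (j <= N M w)%N by exact: leq_trans (ltnW jl) lN.
have [Bj aj] : B M j w /\ a j <= epoch j w.
  by apply/ZE => //; apply: epoch_gt0; rewrite ?j0.
have [k [/andP[jk kl] Bk k1]] : exists k, [/\ (j <= k < l)%N, B M k w & later k 1 w].
  by apply: penultimate_exists lw _ Bj; rewrite j0.
have k0 : (0 < k)%N by exact: leq_trans jk.
have kN : (k <= N M w)%N by exact: leq_trans (ltnW kl) lN.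
exists k => //; rewrite k0; split=> //; split.
  by split; split=> //; apply: lt_le_trans ls; rewrite (epoch_lt nb).
move=> [_]; apply/negP; rewrite -ltNge gt_max epoch_gt0 ?k0//=.
have ek : a k <= epoch k w.
  apply: (le_trans (a_nonincr j0 jk)); apply: (le_trans aj).
  exact: epoch_homo.
rewrite lt_neqAle ek andbT eq_sym.
by apply: (epoch_neq (k.+1) nb); rewrite k0.
Qed.

(** If the last success is below its threshold, sigma has won by stopping too early;
    otherwise the threshold rule has stopped before, where sigma has waited. *)
Let missed w : ~ bad w -> W w -> ~ V w ->
  at_success too_early 0 w \/ at_success too_late 1 w.
Proof.
move=> nb; rewrite {1}/W win_eventE => -[l lw sl] nV.
have [/andP[l0 lN] Bl _] := lw.
have [al|la] := leP (a l) (epoch l w).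
  by right; apply: (accepted_before nb lw); rewrite ?al ?sl ?lexx.
left; exists l => //; rewrite l0; split; last by apply/later_last; rewrite ?l0.
split; first by split=> // -[_]; rewrite sl ltxx.
by split=> // -[_]; rewrite leNgt epoch_gt0// l0.
Qed.

(** With exactly one success l to come, a too early stop is a loss.  The threshold
    rule passes over all successes before l; either it wins at l, or l itself is
    too early. *)
Let early_repaid w : ~ bad w -> at_success too_early 1 w ->
  ~ W w /\ (V w \/ at_success too_early 0 w).
Proof.
move=> nb [k _]; case: ifP => // k0 [[[[kN Bk] nbef] [[_ eka] e0]] k1].
have [l [kl lw btw]] := later_one_last (introT andP (conj k0 kN)) k1.
have [/andP[l0 lN] Bl _] := lw.
have ekl : epoch k w < epoch l w by exact: (epoch_lt nb).
have sk : sigma w <= epoch k w by rewrite leNgt; apply/negP => h; apply: nbef.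
split.
  move=> /(before_winE lw) sl; move: sk; rewrite sl leNgt; exact/negP/negPn.
have el0 : 0 < epoch l w by apply: epoch_gt0 => //; rewrite l0.
have [al|la] := leP (a l) (epoch l w); last first.
  right; exists l => //; rewrite l0; split; last by apply/later_last; rewrite ?l0.
  split; first by split=> // -[_]; rewrite ltNge (le_trans sk)// ltW.
  by split=> // -[_]; rewrite leNgt el0.
left; apply: (win_first_stop lw); first exact/ZE.
move=> j /andP[j0 jl]; have jN : (j <= N M w)%N by exact: leq_trans (ltnW jl) lN.
move=> /ZE[]//; first by apply: epoch_gt0; rewrite ?j0.
move=> Bj; apply/negP; rewrite -ltNge.
have jk : (j <= k)%N.
  by rewrite leqNgt; apply/negP => kj; have := btw j; rewrite kj jl Bj => /(_ isT).
apply: le_lt_trans (lt_le_trans eka (a_nonincr j0 jk)).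
exact: epoch_homo.
Qed.

(** Waiting at the last success is a loss.  If the threshold rule does not win
    there, it has accepted an earlier success. *)
Let late_repaid w : ~ bad w -> at_success too_late 0 w ->
  ~ W w /\ (V w \/ at_success too_late 1 w).
Proof.
move=> nb [l _]; case: ifP => // l0 [[[[lN Bl] [_ bef]] ea] ll].
have lw : last_success l w by apply/later_last; rewrite ?l0.
split; first by move=> /(before_winE lw) sl; rewrite sl ltxx in bef.
have al : Num.max 0 (a l) < epoch l w by rewrite ltNge; apply/negP => h; apply: ea.
have [Vw|nV] := pselect (V w); [by left|right].
apply: (accepted_before nb lw) => //; rewrite (ltW bef) andbT.
by move: al; rewrite gt_max => /andP[_ /ltW].
Qed.

Let early_late_disjoint w : ~ bad w -> at_success too_early 1 w ->
  at_success too_late 0 w -> False.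
Proof.
move=> nb [k _]; case: ifP => // k0 [[[[kN Bk] nbef] _] k1].
move=> [l _]; case: ifP => // l0 [[[[lN Bl] [_ bef]] _] ll].
have [l' [kl lw btw]] := later_one_last (introT andP (conj k0 kN)) k1.
have lw' : last_success l w by apply/later_last; rewrite ?l0.
rewrite (last_success_uniq lw lw') in kl.
apply: nbef; split=> //; apply: le_lt_trans bef; apply: epoch_homo => //.
exact: ltnW.
Qed.

(** Split according to whether sigma wins, the comparison of 0 and 1 later successes
    at [too_early] bounds the wins by losses, from which the losses common to both
    sides cancel; the remaining ones are wins of the threshold rule.  The same
    holds for [too_late], and the two kinds of compensation are disjoint
    ([early_late_disjoint]). *)
Lemma threshold_beats : Pb W <= Pb V.
Proof.
have mW : measurable W by apply: win_measurable; have [] := ss.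
have mV : measurable V.
  by apply: win_measurable; have [] := first_stop_strategy Z_past.
have mb : measurable bad by exact: coincidence_measurable.
have mE i : measurable (at_success too_early i).
  by apply: at_success_measurable => k k0; exact: past_measurable (too_early_past k0).
have mL i : measurable (at_success too_late i).
  by apply: at_success_measurable => k k0; exact: past_measurable (too_late_past k0).
have b0 : Pb bad = 0 by exact: prob_coincidence.
pose D := V `\` W.
have mD : measurable D by exact: measurableD.
have lose i (X : nat -> set Om) : (forall i, measurable (at_success X i)) ->
  Pb (at_success X i) <= Pb (at_success X (1 - i)%N) ->
  (forall w, ~ bad w -> at_success X (1 - i)%N w -> ~ W w /\ (V w \/ at_success X i w)) ->
  Pb (at_success X i `&` W) <= Pb (at_success X (1 - i)%N `&` D).
  move=> mX XX h.
  have m1 : measurable (at_success X (1 - i)%N `&` D) by exact: measurableI.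
  have m2 : measurable (at_success X i `\` W) by exact: measurableD.
  have : Pb (at_success X (1 - i)%N) <=
      Pb (at_success X (1 - i)%N `&` D) + Pb (at_success X i `\` W).
    apply: le_trans (probU_le (Pr M) m1 m2).
    apply: (prob_le_off (mX _) (measurableU _ _ m1 m2) mb b0) => w Xw.
    have [bw|nb] := pselect (bad w); [by right|left].
    by have [nW [Vw|Xw']] := h w nb Xw; [left|right].
  move: XX; rewrite (prob_split (Pr M) (mX i) mW); lra.
have hE := lose 0%N _ mE too_early_le early_repaid.
have hL := lose 1%N _ mL too_late_le late_repaid.
have WV : Pb (W `\` V) <= Pb (at_success too_early 0 `&` W) + Pb (at_success too_late 1 `&` W).
  have m1 : measurable (at_success too_early 0 `&` W) by exact: measurableI.
  have m2 : measurable (at_success too_late 1 `&` W) by exact: measurableI.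
  apply: le_trans (probU_le (Pr M) m1 m2).
  apply: (prob_le_off (measurableD mW mV) (measurableU _ _ m1 m2) mb b0) => w [Ww nV].
  have [bw|nb] := pselect (bad w); [by right|left].
  by have [|] := missed nb Ww nV; [left|right].
have DD : Pb (at_success too_early 1 `&` D) + Pb (at_success too_late 0 `&` D) <= Pb D.
  rewrite [in leRHS](prob_split (Pr M) mD (mE 1%N)) setIC lerD2l.
  apply: (prob_le_off _ _ mb b0).
  - exact: measurableI.
  - exact: measurableD.
  move=> w [Lw Dw]; have [bw|nb] := pselect (bad w); [by right|left].
  by split=> // Ew; apply: early_late_disjoint nb Ew Lw.
rewrite (prob_split (Pr M) mW mV) (prob_split (Pr M) mV mW) setIC lerD2l.
rewrite -/D; move: hE hL; rewrite /=; lra.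
Qed.

End against.
End Optimality.

(** * Optimality of the myopic rule *)

Section Myopic.
Context {R : realType} {theta nu q : R}.
Hypotheses (th0 : 0 < theta) (nu0 : 0 < nu) (q01 : 0 < q < 1).
Local Notation p := (success_prob theta).
Variable M : trial_model p nu q.
Local Notation Om := (Omega M).
Local Notation H := (@mean_har R theta nu).
Implicit Types (t : R) (k l n : nat) (w : Om).

Definition myopic_stop k : set Om :=
  [set w | [/\ (k <= N M w)%N, B M k w &
     S_cond M 1 (epoch k w) k <= S_cond M 0 (epoch k w) k]].

Lemma myopicE : @myopic R p nu q M = first_stop myopic_stop.
Proof.
apply/funext => w; rewrite /myopic /first_stop; congr (head 1 (map _ _)).
apply: eq_in_filter => k; rewrite mem_iota add1n ltnS => /andP[_ kN].
by apply/andP/asboolP => [[? ?]|[]].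
Qed.

Section threshold.
Variables (k : nat) (alpha : R).
Hypotheses (k0 : (0 < k)%N) (alpha01 : 0 < alpha < 1).
Hypothesis alphaE : theta * H k alpha = 1.

Let alpha01' : 0 <= alpha < 1.
Proof. by case/andP: alpha01 => /ltW -> ->. Qed.

Let q0 : 0 < q. Proof. by case/andP: q01. Qed.

Let threshold_le t : (1 - alpha / q <= t) = (q * (1 - t) <= alpha).
Proof. by rewrite lerBlDr addrC -lerBlDr ler_pdivlMr// mulrC. Qed.

Lemma threshold_lt1 : 1 - alpha / q < 1.
Proof. by case/andP: alpha01 => a0 _; rewrite ltrBlDr ltrDl divr_gt0. Qed.

Lemma myopic_threshold t : 0 < t <= 1 ->
  (S_cond M 1 t k <= S_cond M 0 t k) = (1 - alpha / q <= t).
Proof.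
move=> t01; have x01 : 0 <= q * (1 - t) < 1.
  by apply: discount_range => //; case/andP: t01 => /ltW -> ->.
rewrite (S_cond_leE th0 nu0 q01)// threshold_le -[X in (_ <= X) = _]alphaE ler_pM2l//.
apply/idP/idP; first exact: (mean_har_leP th0 nu0 k0).
case/andP: x01 => x0 _ xa; apply: (mean_har_homo th0 nu0 k0 x0 xa).
by case/andP: alpha01.
Qed.

Lemma wait_threshold t : 0 < t <= 1 -> t <= 1 - alpha / q ->
  S_cond M 0 t k <= S_cond M 1 t k.
Proof.
move=> t01 ta; have /andP[t0 t1] := t01.
have /andP[x0 x1] : 0 <= q * (1 - t) < 1.
  by apply: discount_range => //; rewrite ltW.
have [/andP[S0 _] ->] := S_cond_ratio th0 nu0 q01 M k0 t01.
rewrite ler_peMl ?(ltW S0)// -[leLHS]alphaE ler_pM2l//.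
apply: (mean_har_homo th0 nu0 k0) => //; first by case/andP: alpha01'.
by move: ta; rewrite lerBrDl -lerBrDr ler_pdivrMr// mulrC.
Qed.

(** Above time 0 acceptance is a threshold condition.  At time 0
    the ratios S_cond have a null denominator; rather than evaluating them, the proof
    covers both answers of the test. *)
Lemma myopic_stop_past : past k (myopic_stop k).
Proof.
pose E0 : set Om := if S_cond M 1 0 k <= S_cond M 0 0 k then set0
  else [set w | (k <= N M w)%N /\ epoch k w <= 0].
have pE0 : past k E0.
  rewrite /E0; case: ifP => _; last exact: past_le.
  by split=> // t t01; rewrite set0I; exact: history0.
rewrite (_ : myopic_stop k = ([set w | (k <= N M w)%N /\ B M k w] `\`
  ([set w | (k <= N M w)%N /\ epoch k w < 1 - alpha / q] `\`
   [set w | (k <= N M w)%N /\ epoch k w <= 0])) `\` E0).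
  apply: pastD => //; apply: pastD; first exact: past_success.
  by apply: pastD; [exact: past_lt|exact: past_le].
have acc0 w : (k <= N M w)%N -> epoch k w <= 0 -> epoch k w = 0.
  move=> kN e0; apply/eqP; rewrite eq_le e0.
  by have /andP[] := @epoch_range _ _ _ _ M k w (introT andP (conj k0 kN)).
have acc w : (k <= N M w)%N -> 0 < epoch k w ->
    (S_cond M 1 (epoch k w) k <= S_cond M 0 (epoch k w) k) = (1 - alpha / q <= epoch k w).
  move=> kN e0; apply: myopic_threshold; rewrite e0.
  by have /andP[] := @epoch_range _ _ _ _ M k w (introT andP (conj k0 kN)).
apply/seteqP; split=> w.
  move=> [kN Bk Sk]; split.
    split=> // -[[_ ea] e0]; move: Sk; rewrite acc//; first by rewrite leNgt ea.
    by rewrite ltNge; apply/negP => h; apply: e0.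
  rewrite /E0; case: ifP => [_ []|/negP h [_ e0]]; apply: h.
  by rewrite (acc0 _ kN e0) in Sk.
move=> [[[kN Bk] nea] nE0]; split=> //.
have [e0|e0] := leP (epoch k w) 0.
  rewrite acc0//; case: (boolP (S_cond M 1 0 k <= S_cond M 0 0 k)) => // h.
  by exfalso; apply: nE0; rewrite /E0 (negbTE h).
rewrite acc// leNgt; apply/negP => ea; apply: nea; split=> // -[_].
by rewrite leNgt e0.
Qed.

End threshold.

Lemma myopic_strategy : stopping_strategy (@myopic R p nu q M).
Proof.
rewrite myopicE; apply: first_stop_strategy => k k0.
by have [x x01 xE] := mean_har_root th0 nu0 k0; exact: myopic_stop_past k0 x01 xE.
Qed.

Lemma myopic_optimal : theta <= nu -> optimal (@myopic R p nu q M).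
Proof.
move=> thnu; have /andP[q0 q1] := q01.
have /choice[alpha alphaP] : forall k, exists x : R, (0 < k)%N ->
    0 < x < 1 /\ theta * H k x = 1.
  move=> k; have [->|k0] := posnP k; first by exists 0.
  by have [x ? ?] := mean_har_root th0 nu0 k0; exists x.
pose a k := 1 - alpha k / q.
have Zp k : (0 < k)%N -> past k (myopic_stop k).
  by move=> k0; have [a01 aE] := alphaP k k0; exact: myopic_stop_past k0 a01 aE.
have st := myopic_strategy; split=> // sigma ss.
rewrite !(probE (Pr M)); last 2 first.
- by apply: win_measurable; have [] := st.
- by apply: win_measurable; have [] := ss.
rewrite lee_fin myopicE; apply: (@threshold_beats _ _ _ _ M nu0 q01 a) => //.
- by move=> k k0; have [a01 aE] := alphaP k k0; exact: threshold_lt1 a01.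
- move=> k l k0 kl; rewrite /a lerD2l lerN2 ler_pM2r ?invr_gt0//.
  have l0 : (0 < l)%N by exact: leq_trans kl.
  have [ak01 akE] := alphaP k k0; have [al01 alE] := alphaP l l0.
  apply: (mean_har_leP th0 nu0 l0).
  + by case/andP: ak01 => /ltW -> ->.
  + by case/andP: al01 => /ltW -> ->.
  rewrite -(ler_pM2l th0) alE -akE ler_pM2l//.
  by apply: (mean_har_nonincr_le th0 nu0) => //; case/andP: ak01 => /ltW -> ->.
- move=> k t k0 t01 at_; have [a01 aE] := alphaP k k0.
  by rewrite (myopic_threshold k0 a01 aE).
- move=> k t k0 t01 ta; have [a01 aE] := alphaP k k0.
  exact: (wait_threshold k0 a01 aE t01).
- move=> k w k0 kN e0; have [a01 aE] := alphaP k k0.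
  have e01 : 0 < epoch k w <= 1.
    by rewrite e0; have /andP[] := @epoch_range _ _ _ _ M k w (introT andP (conj k0 kN)).
  by rewrite -(myopic_threshold k0 a01 aE e01); split=> [[]|[]].
Qed.

End Myopic.

(** * A deviation from stopping at the first trial *)

Section Deviation.
Context {R : realType} {p : nat -> R} {nu q : R}.
Variable M : trial_model p nu q.
Hypotheses (nu0 : 0 < nu) (q01 : 0 < q < 1).
Local Notation Om := (Omega M).
Local Notation Pb := (prob (Pr M)).
Local Notation F := (@history R p nu q M).
Implicit Types (t : R) (k l n m i j : nat) (w : Om).
Variables (b c : R).
Hypotheses (b0 : 0 < b) (bc : b <= c) (c1 : c <= 1).

Definition early_start : set Om := [set w | (1 <= N M w)%N /\ epoch 1 w <= b].

(** If T_1 > b the deviation imitates the myopic rule; otherwise it waits for the first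
    success after c. *)
Definition deviate k : set Om :=
  if k == 1%N then [set w | (1 <= N M w)%N /\ b < epoch 1 w]
  else [set w | [/\ (k <= N M w)%N, B M k w, c < epoch k w & epoch 1 w <= b]].

(** The trials after the one with index N_c are those in ]c, 1]. *)
Definition left_after i : set Om :=
  [set w | later_successes (count_upto c w) w = i].

(** The single success that is passed over by waiting from T_1 until c.  This event belongs
    to the history at c, so that the Markov property applies to it. *)
Definition one_passed : set Om := early_start `&`
  [set w | exists2 j, (1 < j <= count_upto c w)%N && B M j w &
     forall i, (1 < i <= count_upto c w)%N && B M i w -> i = j].

Lemma early_startE : early_start = [set w | (1 <= count_upto b w)%N].
Proof.
apply/seteqP; split=> w /=; first by move=> [N1]; rewrite epoch_leP.
move=> c1b; have N1 : (1 <= N M w)%N by exact: leq_trans (count_upto_le_N b w).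
by split=> //; rewrite epoch_leP.
Qed.

Lemma early_start_history : F c early_start.
Proof. by rewrite early_startE; exact: history_count. Qed.

Let c01 : 0 < c <= 1.
Proof. by rewrite c1 (lt_le_trans b0 bc). Qed.

Let c01' : 0 <= c <= 1.
Proof. by case/andP: c01 => /ltW -> ->. Qed.

Lemma early_start_measurable : measurable early_start.
Proof. exact: history_measurable c01' early_start_history. Qed.

Lemma one_passed_history : F c one_passed.
Proof.
apply: historyI; first exact: early_start_history.
pose A j : set Om := if (1 < j)%N then [set w | (j <= count_upto c w)%N /\ B M j w]
  else set0.
have FA j : F c (A j).
  rewrite /A; case: ifP => j1; last exact: history0.
  by apply: history_count_success; rewrite ?(ltnW j1).
have AE j w : A j w <-> (1 < j <= count_upto c w)%N && B M j w.
  rewrite /A; case: ifP => j1 //=; split=> [[-> ->]//|/andP[-> ->]//].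
rewrite (_ : [set _ | _] = \bigcup_j (A j `\` \bigcup_i (if i == j then set0 else A i))).
  apply: history_bigcup => j; apply: historyD => //.
  by apply: history_bigcup => i; case: ifP => // _; exact: history0.
apply/seteqP; split=> w.
  move=> [j jA h]; exists j => //; split; first exact/AE.
  move=> [i _]; case: ifP => // /eqP ij /AE Ai; apply: ij; exact: h.
move=> [j _ [/AE jA h]]; exists j => // i iA; apply: contrapT => ij; apply: h.
exists i => //; case: ifP => [/eqP //|_]; exact/AE.
Qed.

Lemma deviate_past k : (0 < k)%N -> past k (deviate k).
Proof.
move=> k0; rewrite /deviate; case: eqP => [->|/eqP k1].
  rewrite (_ : [set _ | _] = [set w | (1 <= N M w)%N] `\`
     [set w | (1 <= N M w)%N /\ epoch 1 w <= b]).
    by apply: pastD; [exact: past_exists|exact: past_le].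
  apply/seteqP; split=> w /= [N1 h]; split=> //.
    by move=> [_]; rewrite leNgt h.
  by rewrite ltNge; apply/negP => h'; apply: h.
rewrite (_ : [set _ | _] = ([set w | (k <= N M w)%N /\ B M k w] `\`
   [set w | (k <= N M w)%N /\ epoch k w <= c]) `&`
   ([set w | (k <= N M w)%N /\ epoch 1 w <= b])).
  apply: pastI.
    by apply: pastD; [exact: past_success|exact: past_le].
  split=> [w []//|t t01].
  rewrite (_ : _ `&` _ = [set w | (1 <= count_upto (Num.min b t) w)%N] `&`
     [set w | (k <= count_upto t w)%N]).
    apply: historyI; last exact: history_count.
    by apply: history_count => //; rewrite ge_min lexx orbT.
  apply/seteqP; split=> w /=.
    move=> [[kN e1] kc]; split=> //.
    have N1 : (1 <= N M w)%N by exact: leq_trans kN.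
    rewrite -epoch_leP// le_min e1 epoch_leP//; exact: leq_trans kc.
  move=> [c1b kc].
  have kN : (k <= N M w)%N by exact: leq_trans (count_upto_le_N t w).
  have N1 : (1 <= N M w)%N by exact: leq_trans kN.
  by move: c1b; rewrite -epoch_leP// le_min => /andP[e1 _]; split.
apply/seteqP; split=> w /=.
  by move=> [kN Bk ck e1]; split; split=> //; rewrite leNgt ck => -[].
move=> [[[kN Bk] h] [_ e1]]; split=> //.
by rewrite ltNge; apply/negP => h'; apply: h.
Qed.

Lemma deviate_strategy : stopping_strategy (first_stop deviate).
Proof. exact: first_stop_strategy deviate_past. Qed.

Lemma deviate_wins w : early_start w -> left_after 1 w ->
  win_event (first_stop deviate) w.
Proof.
move=> [N1 e1] d1.
have cb : (0 < count_upto c w)%N.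
  by rewrite -epoch_leP// (le_trans e1).
have cN := count_upto_le_N c w.
have [l [cl lw btw]] := later_one_last (introT andP (conj cb cN)) d1.
have [/andP[l0 lN] Bl _] := lw.
have l1 : l != 1%N by rewrite gtn_eqF// (leq_ltn_trans _ cl).
apply: (win_first_stop lw).
  rewrite /deviate (negbTE l1); split=> //.
  by rewrite ltNge epoch_leP// -ltnNge.
move=> j /andP[j0 jl]; rewrite /deviate; case: eqP => [_ [_]|_ [jN Bj cj _]].
  by rewrite ltNge e1.
have cj' : (count_upto c w < j)%N by rewrite ltnNge -epoch_leP// -ltNge.
by have := btw j; rewrite cj' jl Bj => /(_ isT).
Qed.

Lemma later_one_passed w : early_start w -> later 1 1 w ->
  (left_after 1 w /\ ~ one_passed w) \/ (one_passed w /\ left_after 0 w).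
Proof.
move=> Gw; have [N1 e1] := Gw.
have cb : (0 < count_upto c w)%N by rewrite -epoch_leP// (le_trans e1).
have cN := count_upto_le_N c w.
rewrite /later/= (@later_split _ _ _ _ M 1 (count_upto c w)) ?cb// /left_after/=.
have [d0|d0] := posnP (later_successes (count_upto c w) w).
  rewrite d0 addn0 => /sum_nat_seq_eq1[j [jc _ Bj uniq_j]]; right; split=> //; split=> //.
  move: jc; rewrite mem_index_iota ltnS => jc.
  exists j; first by rewrite jc; move: Bj; case: (B M j w).
  move=> i /andP[ic Bi]; apply/eqP/negPn/negP => ij.
  by have := uniq_j i ij; rewrite mem_index_iota ltnS Bi => /(_ ic isT).
move=> s1; have s0 : (\sum_(2 <= j < (count_upto c w).+1) B M j w = 0)%N.
  move: d0 s1; case: later_successes => // n _; rewrite addnS => -[/eqP].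
  by rewrite addn_eq0 => /andP[/eqP].
left; split; first by move: s1; rewrite s0 add0n.
move=> [_ [j /andP[jc Bj] _]]; move/eqP: s0; rewrite sum_nat_seq_eq0 => /allP/(_ j).
by rewrite mem_index_iota ltnS jc Bj => /(_ isT).
Qed.

Lemma left_after_measurable i : measurable (left_after i).
Proof.
rewrite (_ : left_after i = \bigcup_m state_event c m (pred1 i)).
  by apply: bigcup_measurable => m _; exact: state_event_measurable.
apply/seteqP; split=> w.
  by move=> /eqP di; exists (count_upto c w).
by move=> [m _ [cm /eqP]]; rewrite /left_after /= cm.
Qed.

Lemma one_passed_measurable : measurable one_passed.
Proof. exact: history_measurable c01' one_passed_history. Qed.

(** Markov property at c, for each value m of N_c; on this event m is at least
    2. *)
Lemma one_passed_gain eps :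
  (forall m, (1 < m)%N -> (1 + eps) * S_cond M 0 c m <= S_cond M 1 c m) ->
  (1 + eps) * Pb (one_passed `&` left_after 0) <= Pb (one_passed `&` left_after 1).
Proof.
move=> h.
have sm i : has_sum (fun m => Pb (one_passed `&` left_after i `&`
    (fun w => count_upto c w) @^-1` [set m])) (Pb (one_passed `&` left_after i)).
  apply: prob_nat.
    by apply: measurableI; [exact: one_passed_measurable|exact: left_after_measurable].
  by move=> m; exact: count_eq_measurable.
have e i m : Pb (one_passed `&` left_after i `&`
    (fun w => count_upto c w) @^-1` [set m]) =
    Pb (one_passed `&` state_event c m predT) * S_cond M i c m.
  rewrite -(markov nu0 q01 _ _ c01 one_passed_history); congr prob.
  apply/seteqP; split=> w.
    by move=> [[Ew di] cm]; split=> //; split=> //=; rewrite -cm; exact/eqP.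
  by move=> [Ew [cm /eqP di]]; split=> //; split=> //; rewrite /left_after /= cm.
apply: (@le_has_sum _ _ _ _ _ _ (has_sumM (1 + eps) (sm 0%N)) (sm 1%N)) => m.
rewrite !e mulrCA; have [m1|m1] := ltnP 1 m.
  by apply: ler_wpM2l; [exact: prob_ge0|exact: h].
rewrite (_ : _ `&` _ = set0) ?prob0 ?mul0r//.
apply/seteqP; split=> w // [[_ [j /andP[/andP[j1 jc] _] _]] [cm _]].
by move: (leq_trans j1 jc); rewrite cm ltnNge m1.
Qed.

(** Exactly one success after the first trial means either exactly one after c
    with none passed, or one passed with none after c.  The second alternative is
    exchanged for one passed and one after c, which is more likely. *)
Lemma deviation_gain eps :
  (forall m, (1 < m)%N -> (1 + eps) * S_cond M 0 c m <= S_cond M 1 c m) ->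
  Pb (early_start `&` later 1 1) + eps * Pb (one_passed `&` left_after 0) <=
  Pb (early_start `&` left_after 1).
Proof.
move=> /one_passed_gain h.
have mG := early_start_measurable; have mE := one_passed_measurable.
have mL := left_after_measurable.
have m1 : measurable ((early_start `&` left_after 1) `\` one_passed).
  by apply: measurableD => //; exact: measurableI.
have m2 : measurable (one_passed `&` left_after 0) by exact: measurableI.
have : Pb (early_start `&` later 1 1) <=
    Pb ((early_start `&` left_after 1) `\` one_passed) +
    Pb (one_passed `&` left_after 0).
  apply: le_trans (probU_le (Pr M) m1 m2); apply: prob_le.
  - by apply: measurableI => //; exact: later_set_measurable.
  - exact: measurableU.
  by move=> w [Gw lw]; have [[d1 nE]|[Ew d0]] := later_one_passed Gw lw; [left|right].
rewrite (prob_split (Pr M) (measurableI _ _ mG (mL 1%N)) mE).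
rewrite (_ : early_start `&` left_after 1 `&` one_passed = one_passed `&` left_after 1).
  by move: h; lra.
apply/seteqP; split=> w; first by move=> [[_ d1] Ew].
by move=> [Ew d1]; split=> //; split=> //; have [] := Ew.
Qed.

Lemma prob_early_start_le mu : has_sum (fun n => nb_pmf nu q n * n%:R) mu ->
  Pb early_start <= mu * b.
Proof.
move=> smu; have mG := early_start_measurable.
have sG := @prob_nat _ _ _ (Pr M) (N M) early_start mG (fun n => N_measurable M [set n]).
rewrite mulrC; apply: (@le_has_sum _ _ _ _ _ _ sG (has_sumM b smu)) => n.
have b1 : b <= 1 by exact: le_trans bc c1.
pose S := [set u : R | u <= b].
have mS : measurable S by exact: le_set_measurable.
pose Hi i : set Om := if (0 < i)%N then N M @^-1` [set n] `&` U M i @^-1` S else set0.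
have mH i : measurable (Hi i).
  rewrite /Hi; case: ifP => // _.
  by apply: measurableI; [exact: N_measurable|exact: U_measurable].
have pH i : (0 < i)%N -> Pb (Hi i) = nb_pmf nu q n * b.
  move=> i0; rewrite /Hi i0.
  pose T j := if j == i then S else setT.
  have mT j : measurable (T j) by rewrite /T; case: ifP.
  have := @box_indep _ _ _ _ M i [set n] T (fun=> setT) mT.
  rewrite (_ : _ `&` box _ _ _ = N M @^-1` [set n] `&` U M i @^-1` S); last first.
    apply/seteqP; split=> w.
      by move=> [Nw /(_ i)]; rewrite /= i0 leqnn /T eqxx => /(_ isT)[].
    move=> [Nw Si]; split=> // j /= _; split=> //; rewrite /T.
    by case: eqP => [->//|].
  move=> ->; rewrite prob_N big_nat_recr//= big1_seq ?mul1r.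
    by rewrite preimage_setT probT mulr1 /T eqxx prob_U// unif_le// (ltW b0).
  move=> j /andP[_]; rewrite mem_index_iota => /andP[_ ji].
  by rewrite /T (ltn_eqF ji) !preimage_setT probT mulr1.
apply: (le_trans (@prob_union_bound _ _ _ _ M _ (iota 1 n) Hi _ _ mH _)).
- by apply: measurableI => //; exact: N_measurable.
- move=> w [[N1 e1] /= Nn].
  have : (0 < count_upto b w)%N by rewrite -epoch_leP.
  rewrite count_uptoE Nn -has_count => /hasP[i iN Ui].
  apply/hasP; exists i => //; apply/asboolP; rewrite /Hi.
  by move: iN; rewrite mem_iota => /andP[-> _].
rewrite big_seq (eq_bigr (fun=> nb_pmf nu q n * b)).
  rewrite -big_seq big_const_seq count_predT size_iota iter_addr_0.
  by rewrite -[leLHS]mulr_natr mulrA [b * _]mulrC.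
by move=> i; rewrite mem_iota => /andP[i0 _]; exact: pH.
Qed.

(** The left-hand side is the probability that N = 2, U_1 <= b, U_2 <= c and the second
    trial is a success. *)
Lemma prob_one_passed_ge : nb_pmf nu q 2 * (b * c * p 2) <=
  Pb (one_passed `&` left_after 0).
Proof.
have b1 : b <= 1 by exact: le_trans bc c1.
pose S i := if i == 1%N then [set u : R | u <= b] else [set u : R | u <= c].
pose D i := if i == 2%N then [set true] else setT.
have mle (s : R) : measurable [set u : R | u <= s] by exact: le_set_measurable.
have mS i : measurable (S i) by rewrite /S; case: ifP.
have := @box_indep _ _ _ _ M 2 [set 2%N] S D mS.
have e (G : nat -> R) : \prod_(1 <= i < 3) G i = G 1%N * G 2%N.
  by rewrite big_ltn// big_ltn// big_geq// mulr1.
rewrite prob_N e {2 3}/S {2 3}/D/=.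
rewrite preimage_setT probT mulr1 !prob_U// !unif_le ?(ltW b0)// prob_B//.
rewrite (mulrA b c) => <-; apply: prob_le.
- by apply: measurableI; [exact: N_measurable|exact: box_measurable].
- by apply: measurableI; [exact: one_passed_measurable|exact: left_after_measurable].
move=> w [/= N2 r].
have [U1 _] := r 1%N isT; have [U2 B2] := r 2%N isT.
rewrite /= in U1 U2 B2.
have cb : (0 < count_upto b w)%N by rewrite count_uptoE N2/= U1.
have cc : count_upto c w = 2%N by rewrite count_uptoE N2/= (le_trans U1 bc) U2.
have N1 : (1 <= N M w)%N by rewrite N2.
split; last first.
  rewrite /left_after /= cc; apply/(@later_eq0P _ _ _ _ M 2 w) => j.
  by rewrite N2 => /andP[j2]; rewrite leqNgt j2.
split; first by split=> //; rewrite epoch_leP.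
exists 2%N; first by rewrite cc B2.
by rewrite cc => i /andP[/andP[i1 i2] _]; apply/eqP; rewrite eqn_leq i2.
Qed.

End Deviation.

(** * Failure of the myopic rule *)

Section NotOptimal.
Context {R : realType} {theta nu q : R}.
Hypotheses (th0 : 0 < theta) (nu0 : 0 < nu) (nuth : nu < theta) (q01 : 0 < q < 1).
Local Notation p := (success_prob theta).
Local Notation H := (@mean_har R theta nu).
Hypothesis qE : theta * H 1 q = 1.
Variable M : trial_model p nu q.
Local Notation Om := (Omega M).
Local Notation Pb := (prob (Pr M)).
Implicit Types (t b c : R) (k l m n : nat) (w : Om).

Let q0 : 0 < q. Proof. by case/andP: q01. Qed.

Lemma success_prob1 : p 1 = 1.
Proof. by rewrite /success_prob addrK divff// lt0r_neq0. Qed.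

(** A null event: the first trial is almost surely a success because p_1 = 1. *)
Definition first_fails : set Om := coincidence (M := M) (fun=> 0) `|` B M 1 @^-1` [set false].

Lemma first_fails_measurable : measurable first_fails.
Proof. by apply: measurableU; [exact: coincidence_measurable|exact: B_measurable]. Qed.

Lemma prob_first_fails : Pb first_fails = 0.
Proof.
apply/eqP; rewrite eq_le prob_ge0 andbT.
apply: le_trans (probU_le _ (coincidence_measurable _ _) (B_measurable M 1 _)) _.
by rewrite prob_coincidence prob_Bfalse// success_prob1 subrr addr0.
Qed.

Lemma myopic_first w : ~ first_fails w -> (0 < N M w)%N -> myopic w = epoch 1 w.
Proof.
move=> nf N0.
have nc : ~ coincidence (M := M) (fun=> 0) w by move=> h; apply: nf; left.
have B1 : B M 1 w.
  by case e : (B M 1 w) => //; exfalso; apply: nf; right.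
have N01 : (0 < 1 <= N M w)%N by [].
have /andP[e0 e1] := epoch_range N01.
have e00 : 0 < epoch 1 w by rewrite lt_neqAle e0 eq_sym (epoch_neq 0 nc N01).
have Z1 : myopic_stop 1 w.
  split=> //; rewrite (myopic_threshold th0 nu0 q01 M (ltn0Sn 0) q01 qE) ?e00//.
  by rewrite divff ?lt0r_neq0// subrr.
rewrite myopicE /first_stop.
have -> : iota 1 (N M w) = 1%N :: iota 2 (N M w).-1 by rewrite -{1}(prednK N0).
by rewrite /= (asboolT Z1).
Qed.

Lemma mean_har_ge2 m x : (1 < m)%N -> 0 < x < 1 -> H 2 x <= H m x.
Proof.
move=> m1 /andP[x0 x1]; elim: m m1 => // m IH; rewrite ltnS leq_eqVlt.
move=> /predU1P[<-//|m1]; apply: le_trans (IH m1) _.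
by apply/ltW/mean_har_incr => //; [exact: ltnW|rewrite ltW].
Qed.

(** H_2 exceeds H_1, and both increase with x. *)
Lemma second_root_lt : exists2 x : R, 0 < x < q & theta * H 2 x = 1.
Proof.
have [x /andP[x0 x1] xE] := mean_har_root th0 nu0 (ltn0Sn 1).
exists x => //; rewrite x0 /=.
have q01' : 0 <= q < 1 by case/andP: q01 => /ltW -> ->.
have x01' : 0 <= x < 1 by rewrite (ltW x0).
apply: (mean_har_ltP th0 nu0 (ltn0Sn 1) x01' q01').
rewrite -(ltr_pM2l th0) xE -qE ltr_pM2l//.
exact: (mean_har_incr th0 nu0 (ltn0Sn 0) q01' nuth q0).
Qed.

Lemma mean_har_near (e : R) : 0 < e -> exists2 d : R, 0 < d &
  forall b, 0 < b < d -> `|H 1 q - H 1 (q * (1 - b))| < e.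
Proof.
move=> e0.
have q01' : 0 <= q < 1 by case/andP: q01 => /ltW -> ->.
have : {for q, continuous (H 1)}.
  apply/differentiable_continuous/derivable1_diffP.
  exact: (mean_har_derivable th0 nu0 (ltn0Sn 0) q01').
move=> /cvgrPdist_lt/(_ _ e0)[d /= d0 h]; exists d => // b /andP[b0 bd].
apply: h; rewrite /ball_/=.
have -> : q - q * (1 - b) = q * b by ring.
rewrite gtr0_norm ?mulr_gt0//; apply: le_lt_trans bd.
by rewrite ger_pMl//; case/andP: q01 => _ /ltW.
Qed.

Lemma nb_mean : exists2 mu : R, 0 <= mu & has_sum (fun n => nb_pmf nu q n * n%:R) mu.
Proof.
have q01' : 0 <= q < 1 by case/andP: q01 => /ltW -> ->.
have w0 n : 0 <= nb_pmf nu q n * n%:R by rewrite mulr_ge0// ltW// nb_pmf_gt0.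
have sw := has_sumM ((1 - q) `^ nu) (cvgn_has_sum (nb_weight_summable nu0 q01')).
have le n : nb_pmf nu q n * n%:R <= (1 - q) `^ nu *
    (pochhammer nu n / n`!%:R * q ^+ n * n.+1%:R ^+ 2).
  have -> : nb_pmf nu q n * n%:R = (1 - q) `^ nu *
      (pochhammer nu n / n`!%:R * q ^+ n * n%:R) by rewrite /nb_pmf; ring.
  apply: ler_wpM2l; first exact: powR_ge0.
  apply: ler_wpM2l.
    apply: mulr_ge0; last exact: exprn_ge0 (ltW q0).
    by apply: divr_ge0 => //; apply/ltW/pochhammer_gt0.
  by rewrite -natrX ler_nat (leq_trans (leqnSn n))// leq_pmulr.
have cv : cvgn (series (fun n => nb_pmf nu q n * n%:R)).
  apply: series_le_cvg (has_sum_cvgn sw) => // n.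
  exact: le_trans (le n).
exists (limn (series (fun n => nb_pmf nu q n * n%:R))); last exact: cvgn_has_sum.
exact: has_sum_ge0 w0 (cvgn_has_sum cv).
Qed.

(** When T_1 > b the two rules agree.  Otherwise the myopic rule wins if and only if
    no success follows the first trial, and the deviation wins if exactly one
    success occurs after c. *)
Lemma myopic_deviation b c : 0 < b -> b <= c -> c <= 1 ->
  Pb (win_event (@myopic R p nu q M)) +
    Pb (early_start (M := M) b `&` left_after c 1) <=
  Pb (win_event (first_stop (deviate (M := M) b c))) +
    Pb (early_start (M := M) b `&` later 1 0).
Proof.
move=> b0 bc c1.
set G := early_start b; set V := win_event _; set W := win_event _.
have mG : measurable G by exact: (early_start_measurable M b0 bc c1).
have mff := first_fails_measurable; have pff := prob_first_fails.
have mW : measurable W.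
  by apply: win_measurable; have [] := deviate_strategy M b c.
have mV : measurable V.
  by apply: win_measurable; have [] := myopic_strategy th0 nu0 q01 M.
have mL k i : measurable (later (M := M) k i) by exact: later_set_measurable.
have VG w : ~ first_fails w -> V w -> last_success 1 w.
  move=> nf; rewrite /V win_eventE => -[l lw]; have [/andP[l0 lN] _ _] := lw.
  rewrite (myopic_first nf (leq_trans l0 lN)) => e.
  move: l0; rewrite leq_eqVlt => /predU1P[l1|l1]; first by rewrite l1.
  have nc : ~ coincidence (M := M) (fun=> 0) w by move=> h; apply: nf; left.
  by have := epoch_lt nc (ltn0Sn 0) l1 lN; rewrite e ltxx.
have VGle : Pb (V `&` G) <= Pb (G `&` later 1 0).
  apply: (prob_le_off _ _ mff pff); [exact: measurableI|exact: measurableI|].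
  move=> w [Vw Gw]; have [fw|nf] := pselect (first_fails w); [by right|left].
  split=> //; have lw := VG w nf Vw; have [lN B1 _] := lw.
  exact/later_last.
have VD : Pb (V `\` G) <= Pb (W `\` G).
  apply: (prob_le_off _ _ mff pff); [exact: measurableD|exact: measurableD|].
  move=> w [Vw nG]; have [fw|nf] := pselect (first_fails w); [by right|left].
  split=> //; have lw := VG w nf Vw; have [/andP[_ lN] B1 _] := lw.
  apply: (win_first_stop lw); last by move=> j /andP[]; case: j.
  rewrite /deviate eqxx; split=> //.
  by rewrite ltNge; apply/negP => e1; apply: nG; split.
have WG : Pb (G `&` left_after c 1) <= Pb (W `&` G).
  apply: prob_le; [|exact: measurableI|].
    by apply: measurableI => //; exact: (left_after_measurable M c).
  by move=> w [Gw d1]; split=> //; exact: deviate_wins.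
rewrite (prob_split (Pr M) mW mG) (prob_split (Pr M) mV mG).
move: VGle VD WG; clear; lra.
Qed.

(** At a time t <= b the ratio S_1 / S_0 is theta H_1(q (1 - t)), which is at least its
    value at b, and at most 1. *)
Lemma early_loss b : 0 < b <= 1 ->
  Pb (early_start (M := M) b `&` later 1 0) <=
  Pb (early_start (M := M) b `&` later 1 1) +
  (1 - theta * H 1 (q * (1 - b))) * Pb (early_start (M := M) b).
Proof.
move=> /andP[b0 b1]; set G := early_start b; set delta := 1 - _.
have Hle t : 0 <= t <= b -> 1 - delta <= theta * H 1 (q * (1 - t)) <= 1.
  move=> /andP[t0 tb].
  have /andP[y0 y1] : 0 <= q * (1 - t) < 1.
    by apply: discount_range => //; rewrite t0 (le_trans tb).
  have /andP[z0 z1] : 0 <= q * (1 - b) < 1.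
    by apply: discount_range => //; rewrite ltW.
  rewrite /delta opprB addrC subrK ler_pM2l//; apply/andP; split.
    apply: (mean_har_homo th0 nu0) => //.
    by rewrite ler_pM2l// lerD2l lerN2.
  rewrite -[leRHS]qE ler_pM2l//; apply: (mean_har_homo th0 nu0) => //.
    by rewrite ger_pMr// gerBl.
  by case/andP: q01.
have delta0 : 0 <= delta.
  have := Hle b; rewrite lexx (ltW b0) => /(_ isT)/andP[_].
  by rewrite /delta subr_ge0.
have mff := first_fails_measurable; have pff := prob_first_fails.
have mL k i : measurable (later (M := M) k i) by exact: later_set_measurable.
have mG : measurable G by exact: (early_start_measurable M b0 (lexx b) b1).
pose G' := G `\` [set w | (1 <= N M w)%N /\ epoch 1 w <= 0].
have pG' : past 1 G' by apply: pastD; exact: past_le.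
have off : G `<=` G' `|` first_fails.
  move=> w Gw; have [fw|nf] := pselect (first_fails w); [by right|left].
  split=> // -[N1 e1].
  have nc : ~ coincidence (M := M) (fun=> 0) w by move=> h; apply: nf; left.
  have N01 : (0 < 1 <= N M w)%N by [].
  have /andP[e0 _] := epoch_range N01.
  by have := epoch_neq 0 nc N01; rewrite eq_le e0 e1.
have mG' := past_measurable pG'.
have h1 : Pb (G `&` later 1 0) <= Pb (G' `&` later 1 0).
  apply: (prob_le_off _ _ mff pff); [exact: measurableI|exact: measurableI|].
  by move=> w [/off[G'w|fw] lw]; [left|right].
have h2 : Pb (G' `&` later 1 1) <= Pb (G `&` later 1 1).
  apply: prob_le; [exact: measurableI|exact: measurableI|].
  by move=> w [[Gw _] lw].
have h3 : delta * Pb G' <= delta * Pb G.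
  by apply: ler_wpM2l => //; apply: prob_le => // w [].
apply: (le_trans h1); apply: le_trans (lerD h2 h3).
apply: (@compare_later _ _ _ _ M nu0 q01 1 G' 0 1 delta isT pG' delta0 0 b (lexx 0) b0 b1).
  move=> w [[N1 e1] n0]; rewrite e1 andbT ltNge; apply/negP => e0.
  by apply: n0; split.
move=> t /andP[t0 tb].
have t01 : 0 < t <= 1 by rewrite t0 (le_trans tb).
have [/andP[S0 S1] ->] := S_cond_ratio th0 nu0 q01 M (ltn0Sn 0) t01.
have /andP[h _] : 1 - delta <= theta * H 1 (q * (1 - t)) <= 1.
  by apply: Hle; rewrite ltW.
have hS : (1 - delta) * S_cond M 0 t 1 <= theta * H 1 (q * (1 - t)) * S_cond M 0 t 1.
  by rewrite ler_pM2r.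
have dS : delta * S_cond M 0 t 1 <= delta by rewrite ler_piMr.
by rewrite -lerBlDr; apply: le_trans hS; rewrite mulrBl mul1r lerD2l lerN2.
Qed.

(** Half the second threshold: there theta H_2 exceeds 1, and H_m >= H_2 for larger
    m. *)
Lemma later_gain : exists2 c, 0 < c <= 1 & exists2 eps, 0 < eps &
  forall m, (1 < m)%N -> (1 + eps) * S_cond M 0 c m <= S_cond M 1 c m.
Proof.
have [x2 /andP[x20 x2q] x2E] := second_root_lt.
have q1 : q < 1 by case/andP: q01.
have xc01 : 0 < (q + x2) / 2 < 1.
  by apply/andP; split; lra.
have x2xc : x2 < (q + x2) / 2 by lra.
have x2q1 : x2 / q < 1 by rewrite ltr_pdivrMr// mul1r.
have x2q0 : 0 < x2 / q by rewrite divr_gt0.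
pose c := (1 - x2 / q) / 2.
have c01 : 0 < c <= 1 by rewrite /c; apply/andP; split; lra.
exists c => //; exists (theta * H 2 ((q + x2) / 2) - 1).
  rewrite subr_gt0 -[ltLHS]x2E ltr_pM2l//.
  by apply: (mean_har_lt th0 nu0 (ltn0Sn 1) (ltW x20) x2xc); case/andP: xc01.
move=> m m1.
have [/andP[S0 _] ->] := S_cond_ratio th0 nu0 q01 M (ltnW m1) c01.
have -> : q * (1 - c) = (q + x2) / 2 by rewrite /c; field; rewrite lt0r_neq0.
by rewrite ler_pM2r// addrC subrK ler_pM2l// mean_har_ge2.
Qed.

(** The gain is at least a constant times b, whereas the loss is at most a constant
    times b (1 - theta H_1(q (1 - b))), and the last factor tends to 0 with b by
    continuity of H_1 at q. *)
Lemma myopic_not_optimal : ~ optimal (@myopic R p nu q M).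
Proof.
move=> [st opt].
have [c c01 [eps eps0 gain]] := later_gain.
have /andP[c0 c1] := c01.
have [mu mu0 smu] := nb_mean.
pose kappa := nb_pmf nu q 2 * (c * p 2).
have p2 : 0 < p 2.
  by rewrite /success_prob divr_gt0// -addrA ltr_wpDr// subr_ge0 ler1n.
have kappa0 : 0 < kappa by rewrite mulr_gt0 ?nb_pmf_gt0// mulr_gt0.
have mu1 : 0 < mu + 1 by rewrite ltr_wpDl.
(* Loss and gain are at most theta eta mu b and at least eps kappa b; mu + 1
   avoids a case distinction on mu. *)
pose eta := eps * kappa / (theta * (mu + 1)).
have eta0 : 0 < eta by apply: divr_gt0; exact: mulr_gt0.
have [d d0 dP] := mean_har_near eta0.
pose b := Num.min c (d / 2).
have b0 : 0 < b by rewrite lt_min c0 divr_gt0.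
have bc : b <= c by rewrite ge_min lexx.
have b1 : b <= 1 by exact: le_trans c1.
have bd : b < d.
  apply: (@le_lt_trans _ _ (d / 2)); first by rewrite ge_min lexx orbT.
  by rewrite ltr_pdivrMr// ltr_pMr// ltr1n.
have loss := @early_loss b; rewrite b0 b1 in loss; have {}loss := loss isT.
have DG := deviation_gain nu0 q01 b0 bc c1 gain.
have PG := prob_early_start_le M b0 bc c1 smu.
have PE := prob_one_passed_ge M b0 bc c1.
have MD := myopic_deviation b0 bc c1.
have ss := deviate_strategy M b c.
have mW : measurable (win_event (first_stop (deviate (M := M) b c))).
  by apply: win_measurable; have [] := ss.
have mV : measurable (win_event (@myopic R p nu q M)).
  by apply: win_measurable; have [] := st.
have := opt _ ss; rewrite !(probE (Pr M))// lee_fin leNgt => /negP; apply.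
set delta := 1 - theta * H 1 (q * (1 - b)) in loss.
have delta_eta : delta <= theta * eta.
  have -> : delta = theta * (H 1 q - H 1 (q * (1 - b))) by rewrite mulrBr qE.
  rewrite ler_pM2l//; apply: (le_trans (ler_norm _)).
  by apply/ltW/dP; rewrite b0.
have small : delta * Pb (early_start (M := M) b) <
    eps * Pb (one_passed b c `&` left_after c 0).
  apply: (@le_lt_trans _ _ (theta * eta * (mu * b))).
    apply: (@le_trans _ _ (theta * eta * Pb (early_start (M := M) b))).
      by apply: ler_wpM2r delta_eta; exact: prob_ge0.
    by apply: ler_wpM2l => //; apply: mulr_ge0; exact: ltW.
  apply: (@lt_le_trans _ _ (eps * (kappa * b))); last first.
    rewrite ler_pM2l//; apply: le_trans PE.
    by rewrite /kappa le_eqVlt; apply/orP; left; apply/eqP; ring.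
  have -> : theta * eta * (mu * b) = eps * (kappa * b) * (mu / (mu + 1)).
    by rewrite /eta; field; rewrite !lt0r_neq0.
  rewrite gtr_pMr; last by do 2! apply: mulr_gt0 => //.
  by rewrite ltr_pdivrMr// mul1r ltrDl.
move: loss DG MD small; clear; lra.
Qed.

End NotOptimal.

Theorem theorem5 (R : realType) (theta nu : R) (htheta : 0 < theta)
    (hnu : 0 < nu) :
  [/\ (forall k : nat, (0 < k)%N ->
         exists! x : R, W_root (success_prob theta) nu k x),
      (forall alpha : nat -> R,
         (forall k : nat, (0 < k)%N ->
            W_root (success_prob theta) nu k (alpha k)) ->
         let alpha_star : R := 1 - expR (- theta^-1) in
         [/\ theta < nu ->
               (forall k l : nat, (0 < k)%N -> (k <= l)%N ->
                  alpha k <= alpha l)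
               /\ alpha @ \oo --> alpha_star,
             nu < theta ->
               (forall k l : nat, (0 < k)%N -> (k <= l)%N ->
                  alpha l <= alpha k)
               /\ alpha @ \oo --> alpha_star
           & nu = theta ->
               forall k : nat, (0 < k)%N -> alpha k = alpha_star]),
      (theta <= nu ->
         forall q : R, 0 < q < 1 ->
         forall M : trial_model (success_prob theta) nu q,
           optimal (@myopic R (success_prob theta) nu q M))
    & (nu < theta ->
         forall M : (forall q : R, 0 < q < 1 ->
                       trial_model (success_prob theta) nu q),
           ~ (forall (q : R) (hq : 0 < q < 1),
                optimal (@myopic R (success_prob theta) nu q (M q hq))))].
Proof.
split.
- by move=> k k0; exact: W_root_unique.
- move=> alpha alphaP alpha_star; split.
  + move=> tn; split; last exact: (alpha_cvg htheta hnu alphaP).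
    by move=> k l; exact: (alpha_nondecr htheta hnu alphaP (ltW tn)).
  + move=> nt; split; last exact: (alpha_cvg htheta hnu alphaP).
    by move=> k l; exact: (alpha_nonincr htheta hnu alphaP nt).
  + by move=> e k; exact: (alpha_const htheta hnu alphaP e).
- by move=> tn q q01 M; exact: myopic_optimal.
- move=> nt M opt.
  (* The discount at which the first threshold vanishes. *)
  have [q q01 qE] := mean_har_root htheta hnu (ltn0Sn 0).
  exact: (myopic_not_optimal htheta hnu nt q01 qE (opt q q01)).
Qed.
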